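(* Let $\hat a_n,\hat b_n,\hat c_n,\hat d_n,\hat e_n,\hat f_n,\hat g_n,\hat h_n,\hat k_n$ denote the sums of the values of the vertices of type $A,B,C,D,E,F,G,H,K$, respectively, on level $n$ of the hyperbolic Pascal simplex based on the hypercube mosaic $\{4,3,3,5\}$, and let $\hat s_n$ be the sum of the values of all vertices on level $n$. (1) Each of the ten sequences $\{\hat a_n\},\{\hat b_n\},\{\hat c_n\},\{\hat d_n\},\{\hat e_n\},\{\hat f_n\},\{\hat g_n\},\{\hat h_n\},\{\hat k_n\},\{\hat s_n\}$ satisfies, for all $n\ge 11$, the tenth order linear homogeneous recurrence $$\begin{aligned}\hat x_n={}&147\hat x_{n-1}-3635\hat x_{n-2}+36277\hat x_{n-3}-175292\hat x_{n-4}+445156\hat x_{n-5}-608920\hat x_{n-6}\\&+438532\hat x_{n-7}-151320\hat x_{n-8}+19344\hat x_{n-9}-288\hat x_{n-10},\end{aligned}$$ with the following initial values for $n=1,\dots,10$: - $\hat a_n$: $0, 12, 36, 108, 348, 1164, 3948, 13452, 45900, 156684$; - $\hat b_n$: $0, 0, 12, 60, 228, 804, 2772, 9492, 32436, 110772$; - $\hat c_n$: $0, 0, 24, 144, 840, 5808, 48552, 458736, 4588008, 46916592$; - $\hat d_n$: $0, 0, 0, 96, 1296, 14400, 152592, 1592448, 16530384, 171272832$; - $\hat e_n$: $0, 0, 0, 72, 1248, 15192, 166176, 1753080, 18264480, 189472440$; - $\hat f_n$: $0, 0, 0, 24, 240, 2280, 26880, 667944, 51411168, 5797305000$; - $\hat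 g_n$: $0, 0, 0, 0, 240, 5976, 255936, 24140328, 2793536160, 331243298952$; - $\hat h_n$: $0, 0, 0, 0, 360, 38400, 4458168, 528618816, 62831416920, 7469847072960$; - $\hat k_n$: $0, 0, 0, 0, 2256, 323592, 39296736, 4682378232, 556809369792, 66200381333976$; - $\hat s_n$: $4, 16, 76, 508, 7060, 407620, 44411764, 5239632532, 622525195252, 74007676940212$. (2) Each of the sequences $\{\hat a_n\},\{\hat b_n\},\{\hat c_n\},\{\hat d_n\},\{\hat e_n\}$ also satisfies $$\hat x_n=18\hat x_{n-1}-99\hat x_{n-2}+226\hat x_{n-3}-224\hat x_{n-4}+92\hat x_{n-5}-12\hat x_{n-6}\qquad(n\ge7).$$ (3) Each of the sequences $\{\hat a_n\},\{\hat b_n\}$ also satisfies $$\hat x_n=5\hat x_{n-1}-6\hat x_{n-2}+2\hat x_{n-3}\qquad(n\ge4).$$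
   Context: The mosaic $\{4,3,3,5\}$ is the regular tessellation of hyperbolic 4-space by 4-dimensional hypercubes $\{4,3,3\}$ with vertex figure the 600-cell $\{3,3,5\}$ (so 600 hypercubes and 120 edges meet at each vertex). Hyperbolic Pascal simplex. Fix a vertex $V_0$ of the mosaic. The value (sign) of a vertex is the number of shortest paths along mosaic edges from $V_0$ to that vertex (the value of $V_0$ is $1$). Define a convex part $\mathcal P$ of the mosaic as follows. Take one hypercube containing $V_0$ and let $V_1$ be its vertex opposite to $V_0$ (the vertex of this hypercube with the largest value, namely $24$). Next take all new hypercubes of the mosaic containing $V_1$, and in each of them the vertex with the largest value. Then take all hypercubes containing these vertices, and in each new one the vertex with the largest value, and so on without end. $\mathcal P$ is the set of all hypercubes obtained. The vertices and edges of $\mathcal P$, with each edge directed from its endpoint nearer to $V_0$ to its endpoint farther from $V_0$, form an infinite digraph called the hyperbolic Pascal simplex. Level $n$ is the set of its vertices whose edge-distance from $V_0$ along edges of $\mathcal P$ is $n$. An incoming edge of a vertex on level $n$ is an edge from a vertex on level $n-1$; the value of a vertex other than $V_0$ is the sum of the values of the starting points of its incoming edges. Vertex types. The boundary of $\mathcal P$ has the combinatorial shape of an infinite simplicial cone with apex $V_0$: four boundary rays, six 2-dimensional faces and four 3-dimensional faces. - Type $1$: vertices on the boundary rays (value $1$). They have degree $5$ in $\mathcal P$, except $V_0$, which has degree $4$. There are four of them on each level $n\ge1$. - Types $A$, $B$: vertices in the interior of a 2-dimensional face (degree $7$ in $\mathcal P$), with exactly two (type $A$) or one (type $B$) incoming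 edges. - Types $C$, $D$, $E$: vertices in the interior of a 3-dimensional face (degree $13$ in $\mathcal P$), with exactly three (type $C$), two (type $D$) or one (type $E$) incoming edges. - Types $F$, $G$, $H$, $K$: vertices in the interior of $\mathcal P$ (degree $120$), with exactly four (type $F$), three (type $G$), two (type $H$) or one (type $K$) incoming edges.
   Formalization: P is taken as the smallest convex part of the mosaic containing the first hypercube and closed under adding all hypercubes around largest-value vertices; the bare iteration described is not convex and gives interior vertices with one incoming edge degree 33, not 120. *)

(* Defs.v *)
(* The sequences take values in the binary integers Z: large numerals of type
   int are unary and cannot be handled. *)
From Stdlib Require Export ZArith.
From mathcomp Require Export all_boot all_order all_algebra.
From mathcomp Require Export finmap.
From mathcomp Require Export all_classical reals.

Set Implicit Arguments.
Unset Strict Implicit.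
Unset Printing Implicit Defensive.

Import Order.TTheory GRing.Theory Num.Theory.

Local Open Scope classical_set_scope.
Local Open Scope ring_scope.

Definition phi (R : realType) : R := (1 + Num.sqrt 5) / 2.

(* Hyperboloid model of hyperbolic 4-space.  The form
   x1^2 + x2^2 + x3^2 + x4^2 - t^2 / phi has signature (4, 1); the rescaling of
   the time coordinate t by sqrt phi puts all vertices of the mosaic in
   Z[phi]^5, and the level 3 - 2 phi < 0 only sets the curvature. *)
Notation point R := 'rV[R]_(4 + 1).

Definition minkowski (R : realType) (x y : point R) : R :=
  (\sum_(i < 4) x 0 (lshift 1 i) * y 0 (lshift 1 i))
  - (phi R)^-1 * (x 0 (rshift 4 0) * y 0 (rshift 4 0)).

Definition hyp4 (R : realType) : set (point R) :=
  [set x | minkowski x x = 3 - 2 * phi R /\ 0 < x 0 (rshift 4 0)].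

(* Hyperbolic convex hull: geodesic segments are the radial projections to the
   hyperboloid of straight segments. *)
Definition hyp_hull (R : realType) (X : set (point R)) : set (point R) :=
  [set z | hyp4 z /\ exists n (p : 'I_n -> point R) (c : 'I_n -> R),
     [/\ forall i, X (p i), forall i, 0 <= c i & z = \sum_i c i *: p i]].

Definition reflection (R : realType) (u x : point R) : point R :=
  x - (2 * minkowski x u / minkowski u u) *: u.

(* The base hypercube {4,3,3} has the vertices (+-1, +-1, +-1, +-1, phi^2). *)
Definition cube_vertex (R : realType) (e : {ffun 'I_4 -> bool}) : point R :=
  row_mx (\row_i (-1) ^+ e i) (const_mx (phi R ^+ 2)).

(* Faces of all dimensions: c prescribes some of the signs, and the number of
   signs left free is the dimension. *)
Definition cube_face (R : realType) (c : {ffun 'I_4 -> option bool}) :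
    set (point R) :=
  [set cube_vertex R e | e in [set e : {ffun 'I_4 -> bool} |
                                forall i b, c i = Some b -> e i = b]].

(* Outer normal of the facet on which the i-th sign is (-1)^b.  These normals
   u satisfy <u, u> = 2, and <u, u'> = - 1 / phi = - 2 cos (2 pi / 5) for
   adjacent facets: the dihedral angles are 2 pi / 5, five hypercubes fit
   around each square, and the Schlaefli symbol of the tessellation is
   {4,3,3,5}. *)
Definition facet_normal (R : realType) (i : 'I_4) (b : bool) : point R :=
  row_mx (\row_j (if j == i then (-1) ^+ b * phi R else 0)) (const_mx 1).

(* The hypercube adjacent to g(Q) across the facet g(F) is g(r(Q)), r being the
   reflection in F. *)
Inductive mosaic_motion (R : realType) : (point R -> point R) -> Prop :=
| MotionId : mosaic_motion id
| MotionReflect g i b : mosaic_motion g ->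
    mosaic_motion (g \o reflection (facet_normal R i b)).

(* Faces of the mosaic, represented by their vertex sets: vertices (singletons),
   edges, squares, cubes and hypercubes for k = 0, 1, 2, 3, 4. *)
Definition mosaic_face (R : realType) (k : nat) (X : set (point R)) : Prop :=
  exists (g : point R -> point R) (c : {ffun 'I_4 -> option bool}),
    [/\ mosaic_motion g, #|[pred i | c i == None]| = k
      & X = g @` cube_face c].

Definition mosaic_edge (R : realType) (x y : point R) : Prop :=
  mosaic_face 1 [set x; y].

(* A path from x is the sequence of the vertices visited after x. *)
Definition paths (T : Type) (e : T -> T -> Prop) (x y : T) : set (seq T) :=
  [set p | path (fun u v => `[< e u v >]) x p /\ last x p = y].

Definition shortest_paths (T : Type) (e : T -> T -> Prop) (x y : T) :
    set (seq T) :=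
  [set p | paths e x y p /\ forall q, paths e x y q -> (size p <= size q)%N].

Definition value (R : realType) (V0 v : point R) : nat :=
  #|` fset_set (shortest_paths (@mosaic_edge R) V0 v)|.

Definition growth_closed (R : realType) (V0 : point R)
    (S : set (set (point R))) : Prop :=
  forall T x T', S T -> T x ->
    (forall y, T y -> (value V0 y <= value V0 x)%N) ->
    mosaic_face 4 T' -> T' x -> S T'.

Definition convex_part (R : realType) (S : set (set (point R))) : Prop :=
  let region := \bigcup_(T in S) hyp_hull T in
  forall x y, region x -> region y -> hyp_hull [set x; y] `<=` region.

(* The set P of hypercubes: the smallest convex part of the mosaic which
   contains Q0 and, with each of its hypercubes T, all the hypercubes around
   the vertex of T of largest value.  Convexity has to be imposed: iterating
   the last condition alone leaves, at vertices with one incoming edge, reflex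
   notches that are never filled. *)
Definition pascal_simplex (R : realType) (V0 : point R) (Q0 : set (point R)) :
    set (set (point R)) :=
  [set T | forall S : set (set (point R)),
     S `<=` mosaic_face 4 -> S Q0 -> growth_closed V0 S -> convex_part S ->
     S T].

Definition pascal_face (R : realType) (V0 : point R) (Q0 : set (point R))
    (k : nat) (X : set (point R)) : Prop :=
  mosaic_face k X /\ exists2 T, pascal_simplex V0 Q0 T & X `<=` T.

Definition pascal_edge (R : realType) (V0 : point R) (Q0 : set (point R))
    (x y : point R) : Prop :=
  pascal_face V0 Q0 1 [set x; y].

Definition level (R : realType) (V0 : point R) (Q0 : set (point R)) (n : nat) :
    set (point R) :=
  [set x | exists2 p, shortest_paths (pascal_edge V0 Q0) V0 x p & size p = n].

Definition degree (R : realType) (V0 : point R) (Q0 : set (point R))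
    (x : point R) : nat :=
  #|` fset_set [set y | pascal_edge V0 Q0 y x]|.

Definition incoming (R : realType) (V0 : point R) (Q0 : set (point R))
    (x : point R) : nat :=
  #|` fset_set [set y | pascal_edge V0 Q0 y x /\
        exists m, level V0 Q0 m y /\ level V0 Q0 m.+1 x]|.

(* The k-dimensional faces of P, as an infinite simplicial cone (boundary rays
   for k = 1, P itself for k = 4), are composed of the k-dimensional faces of
   the mosaic that lie in exactly one hypercube of P. *)
Definition on_cone_face (R : realType) (V0 : point R) (Q0 : set (point R))
    (k : nat) (x : point R) : Prop :=
  exists X, [/\ mosaic_face k X, X x
              & exists! T, pascal_simplex V0 Q0 T /\ X `<=` T].

Definition in_cone_face_interior (R : realType) (V0 : point R)
    (Q0 : set (point R)) (k : nat) (x : point R) : Prop :=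
  on_cone_face V0 Q0 k x /\ ~ on_cone_face V0 Q0 k.-1 x.

Inductive vertex_type := TA | TB | TC | TD | TE | TF | TG | TH | TK.

Definition type_face_dim (t : vertex_type) : nat :=
  match t with TA | TB => 2 | TC | TD | TE => 3 | TF | TG | TH | TK => 4 end.

Definition type_degree (t : vertex_type) : nat :=
  match t with TA | TB => 7 | TC | TD | TE => 13 | TF | TG | TH | TK => 120 end.

Definition type_incoming (t : vertex_type) : nat :=
  match t with
  | TA => 2 | TB => 1
  | TC => 3 | TD => 2 | TE => 1
  | TF => 4 | TG => 3 | TH => 2 | TK => 1
  end.

Definition of_type (R : realType) (V0 : point R) (Q0 : set (point R))
    (t : vertex_type) : set (point R) :=
  [set x | [/\ in_cone_face_interior V0 Q0 (type_face_dim t) x,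
               degree V0 Q0 x = type_degree t
             & incoming V0 Q0 x = type_incoming t]].

Definition value_sum (R : realType) (V0 : point R) (A : set (point R)) : Z :=
  Z.of_nat (\sum_(x \in A) value V0 x).

Definition type_sum (R : realType) (V0 : point R) (Q0 : set (point R))
    (t : vertex_type) (n : nat) : Z :=
  value_sum V0 (level V0 Q0 n `&` of_type V0 Q0 t).

Definition level_sum (R : realType) (V0 : point R) (Q0 : set (point R))
    (n : nat) : Z :=
  value_sum V0 (level V0 Q0 n).

(* Main.v *)
(* The reflections r_s, s < 120, in the bisectors of the edges at V0 generate a
   right-angled Coxeter group acting simply transitively on the vertices of the
   mosaic; r_s and r_t commute iff the two edges span a square, so the adjacency
   "s and t commute" is the 600-cell graph.  Hence the vertices are the reduced
   words w up to commutations, the neighbours of w are the w s, the k-faces at w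
   are the k-cliques of the 600-cell, the incoming edges of w are its possible
   last letters (a clique D), and the value of w is the number of its reduced
   words, so that sums of values count reduced words.

   Let Q0 be the tetrahedron T0 at the empty word and let A be the set of the
   letters of T0 that commute with all the letters of w.  P consists of the
   hypercubes at w given by the tetrahedra T containing A, for the words w in
   which, for each a in T0, the first letter not commuting with a (if any) is a
   itself, i.e. for the vertices w inside the four half-spaces of height at least
   -1.  This set is closed under growth, and it is convex because the half-spaces
   bounding its region are spanned by facets.  Conversely, a convex union of
   hypercubes containing two nonadjacent ones of the five around a square contains
   all five, and together with growth this percolates through the tetrahedra at w
   containing A, by induction on the length of w.

   The cone face and the incoming edges of w are given by a = #|A| and d = #|D|,
   where a + d <= 4 as A and D span a clique.  The k-cliques of the 600-cell have
   120, 12, 5, 2, 0 common neighbours, so inclusion-exclusion determines the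
   numbers of successors of each of the ten states (a, d) with d > 0.  The
   resulting step is block triangular and the recurrences are given by the
   characteristic polynomials of its leading blocks of sizes 3, 6 and 10. *)
Require Import Defs.
From mathcomp Require Import ssrZ zify ring lra.
From mathcomp Require Import fintype finset.

Set Implicit Arguments.
Unset Strict Implicit.
Unset Printing Implicit Defensive.

Import Order.TTheory GRing.Theory Num.Theory.

(** The definitions generate the mosaic by reflections in facets, the words by reflections in edge
    bisectors. A facet through [corner0] permutes the bisectors by the relation tested in
    [flip_row], so a motion is a word times a symmetry fixing [corner0]; this reconciles the two
    descriptions.

    No Coxeter theory is presupposed. Two distinct bisectors are orthogonal or have product at most
    -1, and this alone forces the signs of the products with the walls to follow the combinatorial
    rule for last letters. It solves the word problem and yields the half-spaces.

    Hypercubes are told apart by their centres: the vertices of a hypercube are exactly the vertices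
    of the mosaic nearest to its centre. A point of the simplex is therefore sought in the hypercube
    with the nearest centre, which gives convexity, and comparing two centres shows which hypercube
    of an unknown convex part holds a given point. The points tested around a square are sums of
    four vertices already in the part: the centre of a missing hypercube, or a point of the facet
    between two missing ones. *)

Local Open Scope Z_scope.

(** * The edges at a vertex and the 600-cell *)

(* The pair (a, b) stands for a + b phi. *)
Definition zphi : Type := (Z * Z)%type.

Definition zphi_add (x y : zphi) : zphi := (Z.add x.1 y.1, Z.add x.2 y.2).

Definition zphi_mul (x y : zphi) : zphi :=
  (Z.add (Z.mul x.1 y.1) (Z.mul x.2 y.2),
   Z.add (Z.add (Z.mul x.1 y.2) (Z.mul x.2 y.1)) (Z.mul x.2 y.2)).

(* The four space coordinates and the time coordinate. *)
Definition zvec : Type := (seq zphi * zphi)%type.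

Definition zvec0 : zvec := (nseq 4 (0, 0), (0, 0)).

Definition zvec_add (x y : zvec) : zvec :=
  ([seq zphi_add p.1 p.2 | p <- zip x.1 y.1], zphi_add x.2 y.2).

Definition zvec_scale (c : zphi) (x : zvec) : zvec :=
  (map (zphi_mul c) x.1, zphi_mul c x.2).

(** The factor (1, -1) is 1 - phi = -1/phi, the coefficient of the time coordinate in
    [minkowski]. *)
Definition zvec_gram (x y : zvec) : zphi :=
  zphi_add (foldr zphi_add (0, 0) [seq zphi_mul p.1 p.2 | p <- zip x.1 y.1])
           (zphi_mul (1, -1) (zphi_mul x.2 y.2)).

Definition zvec_corner : zvec := (nseq 4 (1, 0), (1, 1)).

Definition base_walls : seq zvec :=
  [seq (set_nth (0, 0) (nseq 4 (0, 0)) i (-1, 0), (0, 0)) | i <- iota 0 4].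

(* The edges at the vertex v = (1, 1, 1, 1, phi^2) lead to the points v + 2 w with
   w in this list, taken modulo permutations of the space coordinates, and in
   [base_walls]; the w are the unit normals of the bisectors of the edges. *)
Definition wall_orbits : seq zvec :=
  [:: ([:: (0, 0); (0, 0); (0, 0); (0, 1)], (0, 1));
      ([:: (0, 0); (0, 0); (0, 1); (0, 1)], (1, 1));
      ([:: (0, 0); (0, 1); (0, 1); (1, 1)], (1, 2));
      ([:: (0, 1); (0, 1); (1, 1); (1, 2)], (2, 3));
      ([:: (0, 1); (1, 1); (1, 2); (1, 2)], (2, 4));
      ([:: (0, 1); (1, 2); (1, 2); (1, 2)], (3, 4));
      ([:: (1, 1); (1, 2); (1, 2); (1, 3)], (3, 5));
      ([:: (1, 2); (1, 2); (1, 3); (2, 3)], (4, 6));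
      ([:: (1, 2); (1, 2); (1, 2); (2, 3)], (3, 6));
      ([:: (1, 2); (1, 3); (2, 3); (2, 3)], (4, 7));
      ([:: (1, 3); (2, 3); (2, 3); (2, 4)], (5, 8));
      ([:: (2, 3); (2, 3); (2, 4); (2, 4)], (5, 9));
      ([:: (2, 3); (2, 4); (2, 4); (2, 4)], (6, 9));
      ([:: (2, 4); (2, 4); (2, 4); (3, 4)], (6, 10))].

Definition walls : seq zvec :=
  base_walls ++
  flatten [seq [seq (p, x.2) | p <- permutations x.1] | x <- wall_orbits].

Definition adj_table : seq bitseq :=
  let ws := walls in
  [seq [seq zvec_gram (nth zvec0 ws i) (nth zvec0 ws j) == (0, 0)
          | j <- iota 0 120] | i <- iota 0 120].

Definition meetn (tbl : seq bitseq) (s : seq nat) (i : nat) : seq nat :=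
  let row := nth [::] tbl i in [seq j <- s | nth false row j].

Definition clique_row (tbl : seq bitseq) (u : seq nat) (i : nat) : bool :=
  let ni := meetn tbl u i in (size ni == 12%N) &&
    all (fun j => let nij := meetn tbl ni j in (size nij == 5%N) &&
      all (fun k => let nijk := meetn tbl nij k in (size nijk == 2%N) &&
        all (fun l => nilp (meetn tbl nijk l)) nijk) nij) ni.

(** The two common neighbours of a triangle are the apexes of the two tetrahedra on it. Their walls
    add up to 1/phi = phi - 1 times the corner plus the three walls of the triangle; a facet
    reflection fixing the corner exchanges them for this reason. *)
Definition flip_row (tbl : seq bitseq) (ws : seq zvec) (u : seq nat) (i : nat) :=
  let w := nth zvec0 ws in
  let ni := meetn tbl u i in
    all (fun j => let nij := meetn tbl ni j in
      all (fun k => let nijk := meetn tbl nij k in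
        zvec_add (w (nth 0%N nijk 0)) (w (nth 0%N nijk 1)) ==
        zvec_scale (-1, 1)
          (zvec_add zvec_corner (zvec_add (w i) (zvec_add (w j) (w k))))) nij) ni.

Definition other (s : seq nat) (p : nat) : nat := head 0%N [seq q <- s | q != p].

(** A walk round the link of an edge: the next letter is the neighbour in [nij] other than the
    previous one, and the walk has to close up after five steps. *)
Definition ring_ok (tbl : seq bitseq) (nij : seq nat) (p q : nat) : bool :=
  let r := other (meetn tbl nij q) p in
  let s := other (meetn tbl nij r) q in
  let t := other (meetn tbl nij s) r in
  [&& uniq [:: p; q; r; s; t], all (mem nij) [:: r; s; t],
      nth false (nth [::] tbl q) r, nth false (nth [::] tbl r) s,
      nth false (nth [::] tbl s) t & nth false (nth [::] tbl t) p].

Definition ring_row (tbl : seq bitseq) (u : seq nat) (i : nat) : bool :=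
  let ni := meetn tbl u i in
  all (fun j => let nij := meetn tbl ni j in
    all (fun p => all (ring_ok tbl nij p) (meetn tbl nij p)) nij) ni.

(** One round of breadth-first search inside [s]. The order of [s] is kept, so that saturation can
    be tested by equality of lists. *)
Definition spread (tbl : seq bitseq) (s r : seq nat) : seq nat :=
  [seq x <- s | (x \in r) || (let row := nth [::] tbl x in has (nth false row) r)].

Definition link_row (tbl : seq bitseq) (u : seq nat) (i : nat) : bool :=
  let ni := meetn tbl u i in
  all (fun j => iter 3 (spread tbl ni) [:: j] == ni) ni.

(** The 5 rounds of search here and the 3 in [link_row] are the diameters of the 600-cell graph and
    of the icosahedron. *)
Definition table_ok (tbl : seq bitseq) (ws : seq zvec) (u : seq nat) : bool :=
  [&& all (clique_row tbl u) u, all (flip_row tbl ws u) u,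
      all (ring_row tbl u) u, iter 5 (spread tbl u) [:: 0%N] == u
    & all (link_row tbl u) u].

(** An off-diagonal product a + b phi is 0 or has a <= 0 and b <= -1, hence is at most -phi: two
    bisectors are orthogonal or do not meet at all. *)
Definition gram_row (ws : seq zvec) (u : seq nat) (i : nat) : bool :=
  all (fun j =>
    let g := zvec_gram (nth zvec0 ws i) (nth zvec0 ws j) in
    if i == j then g == (1, 0)
    else (g == (0, 0)) || (Z.leb g.1 0 && Z.leb g.2 (-1))) u.

Definition walls_ok (ws : seq zvec) (u : seq nat) : bool :=
  [&& size ws == 120%N,
      all (fun x => (size x.1 == 4%N) && (zvec_gram x zvec_corner == (-1, 0))) ws,
      all (gram_row ws u) u & take 4 ws == base_walls].

(* The sealed copies keep conversion from evaluating the tables. *)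
Fact sealed_data : {d : seq bitseq * seq zvec * seq nat
  | d = (adj_table, walls, iota 0 120)}.
Proof. by exists (adj_table, walls, iota 0 120). Qed.

Definition adjs : seq bitseq := (sval sealed_data).1.1.
Definition wallz : seq zvec := (sval sealed_data).1.2.
Definition idx : seq nat := (sval sealed_data).2.

Lemma idxE : idx = iota 0 120.
Proof. by rewrite /idx (svalP sealed_data). Qed.

Lemma wallzE : wallz = walls.
Proof. by rewrite /wallz (svalP sealed_data). Qed.

Lemma adjsE : adjs = adj_table.
Proof. by rewrite /adjs (svalP sealed_data). Qed.

Lemma table_okP : table_ok adjs wallz idx.
Proof.
rewrite idxE wallzE adjsE; by vm_cast_no_check (erefl true).
Qed.

Lemma walls_okP : walls_ok wallz idx.
Proof. rewrite idxE wallzE; by vm_cast_no_check (erefl true). Qed.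

Local Open Scope nat_scope.

Definition adj (i j : 'I_120) : bool := nth false (nth [::] adjs i) j.

Definition gramz (i j : 'I_120) : zphi :=
  zvec_gram (nth zvec0 wallz i) (nth zvec0 wallz j).

Lemma mem_idx (i : 'I_120) : val i \in idx.
Proof. by rewrite idxE mem_iota ltn_ord. Qed.

Lemma idx_lt n : n \in idx -> n < 120.
Proof. by rewrite idxE mem_iota. Qed.

Lemma adjE (i j : 'I_120) : adj i j = (gramz i j == (Z0, Z0)).
Proof.
rewrite /adj adjsE /adj_table /gramz wallzE (nth_map 0) ?size_iota //.
by rewrite (nth_map 0) ?size_iota // !nth_iota.
Qed.

Lemma zvec_gramC x y : zvec_gram x y = zvec_gram y x.
Proof.
have mulC a b : zphi_mul a b = zphi_mul b a.
  by rewrite /zphi_mul; congr (_, _); lia.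
rewrite /zvec_gram (mulC x.2); congr zphi_add.
elim: x.1 y.1 => [|a s IH] [|b t] //=.
by rewrite mulC IH.
Qed.

Lemma adj_sym i j : adj i j = adj j i.
Proof. by rewrite !adjE /gramz zvec_gramC. Qed.

Lemma gram_rowP ws u (i j : nat) : all (gram_row ws u) u -> i \in u -> j \in u ->
  if i == j then zvec_gram (nth zvec0 ws i) (nth zvec0 ws j) == (Z.pos 1, Z0)
  else (zvec_gram (nth zvec0 ws i) (nth zvec0 ws j) == (Z0, Z0)) ||
    (Z.leb (zvec_gram (nth zvec0 ws i) (nth zvec0 ws j)).1 Z0 &&
     Z.leb (zvec_gram (nth zvec0 ws i) (nth zvec0 ws j)).2 (Z.neg 1)).
Proof. by move=> /allP H /H{}H ju; move: H => /allP/(_ _ ju). Qed.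

Lemma gramz_diag (i : 'I_120) : gramz i i = (Z.pos 1, Z0).
Proof.
have [_ _ + _] := and4P walls_okP.
by move/gram_rowP => /(_ _ _ (mem_idx i) (mem_idx i)); rewrite eqxx => /eqP.
Qed.

Lemma gramz_neq (i j : 'I_120) : i != j -> ~~ adj i j ->
  Z.le (gramz i j).1 Z0 /\ Z.le (gramz i j).2 (Z.neg 1).
Proof.
move=> ij; have [_ _ + _] := and4P walls_okP.
move/gram_rowP => /(_ _ _ (mem_idx i) (mem_idx j)).
rewrite val_eqE (negPf ij) adjE -/(gramz i j).
by case/orP=> [->//|/andP[/Z.leb_le ? /Z.leb_le ?]].
Qed.

Lemma adjxx i : adj i i = false.
Proof. by rewrite adjE gramz_diag. Qed.

Lemma adj_neq i j : adj i j -> i != j.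
Proof. by apply: contraTneq => ->; rewrite adjxx. Qed.

Lemma mem_meetn s (i j : 'I_120) :
  (val j \in meetn adjs s i) = adj i j && (val j \in s).
Proof. by rewrite mem_filter. Qed.

Lemma card_sub_idx s (P : pred 'I_120) : uniq s -> {subset s <= idx} ->
  (forall j : 'I_120, (val j \in s) = P j) -> #|[set j | P j]| = size s.
Proof.
move=> Us sI sP; rewrite cardsE cardE -(size_map val).
apply: perm_size; apply: uniq_perm => //.
  by rewrite map_inj_uniq ?enum_uniq //; apply: val_inj.
move=> n; apply/mapP/idP => [[j + ->]|ns]; first by rewrite mem_enum sP.
have n120 : n < 120 by apply/idx_lt/sI.
by exists (Ordinal n120); rewrite // mem_enum -[_ \in _]/(P (Ordinal n120)) -sP.
Qed.

Lemma meetn_sub s i : {subset s <= idx} -> {subset meetn adjs s i <= idx}.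
Proof. by move=> sI x; rewrite mem_filter => /andP[_ /sI]. Qed.

Lemma idx_uniq : uniq idx. Proof. by rewrite idxE iota_uniq. Qed.

Lemma meetn_uniq s i : uniq s -> uniq (meetn adjs s i).
Proof. exact: filter_uniq. Qed.

Lemma clique_rowP tbl u i : all (clique_row tbl u) u -> i \in u ->
  let ni := meetn tbl u i in
  size ni = 12 /\ forall j, j \in ni ->
  let nij := meetn tbl ni j in
  size nij = 5 /\ forall k, k \in nij ->
  let nijk := meetn tbl nij k in
  size nijk = 2 /\ forall l, l \in nijk -> meetn tbl nijk l = [::].
Proof.
move=> /allP H /H; rewrite /clique_row => /andP[/eqP-> /allP{}H] /=.
split=> // j /H/andP[/eqP-> /allP{}H]; split=> // k /H/andP[/eqP-> /allP{}H].
by split=> // l /H; rewrite nilpE => /eqP.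
Qed.

Lemma cliques_ok (i : 'I_120) :
  let ni := meetn adjs idx i in
  size ni = 12 /\ forall j, j \in ni ->
  let nij := meetn adjs ni j in
  size nij = 5 /\ forall k, k \in nij ->
  let nijk := meetn adjs nij k in
  size nijk = 2 /\ forall l, l \in nijk -> meetn adjs nijk l = [::].
Proof. by have [+ _ _ _ _] := and5P table_okP; move/clique_rowP/(_ (mem_idx i)). Qed.

Lemma card_adj1 i : #|[set j | adj i j]| = 12.
Proof.
have [M12 _] := cliques_ok i; rewrite -[RHS]M12; apply: card_sub_idx => //.
- exact/meetn_uniq/idx_uniq.
- exact/meetn_sub.
- by move=> j; rewrite mem_meetn mem_idx andbT.
Qed.

Lemma card_adj2 i j : adj i j -> #|[set k | adj i k && adj j k]| = 5.
Proof.
move=> ij; have [_ /(_ (val j))] := cliques_ok i.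
rewrite mem_meetn ij mem_idx => /(_ isT)[Msz _]; rewrite -[RHS]Msz {Msz}.
apply: card_sub_idx => //.
- exact/meetn_uniq/meetn_uniq/idx_uniq.
- exact/meetn_sub/meetn_sub.
- by move=> k; rewrite !mem_meetn mem_idx andbT andbC.
Qed.

Lemma card_adj3 i j k : adj i j -> adj i k -> adj j k ->
  #|[set l | [&& adj i l, adj j l & adj k l]]| = 2.
Proof.
move=> ij ik jk; have [_ /(_ (val j))] := cliques_ok i.
rewrite mem_meetn ij mem_idx => /(_ isT)[_ /(_ (val k))].
rewrite !mem_meetn ik jk mem_idx => /(_ isT)[Msz _]; rewrite -[RHS]Msz {Msz}.
apply: card_sub_idx => //.
- exact/meetn_uniq/meetn_uniq/meetn_uniq/idx_uniq.
- exact/meetn_sub/meetn_sub/meetn_sub.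
- move=> l; rewrite !mem_meetn mem_idx andbT.
  by rewrite [RHS]andbA [RHS]andbC [adj i l && _]andbC.
Qed.

Lemma no_5clique i j k l m : adj i j -> adj i k -> adj j k ->
  adj i l -> adj j l -> adj k l ->
  adj i m -> adj j m -> adj k m -> adj l m -> False.
Proof.
move=> ij ik jk il jl kl im jm km lm; have [_ /(_ (val j))] := cliques_ok i.
rewrite mem_meetn ij mem_idx => /(_ isT)[_ /(_ (val k))].
rewrite !mem_meetn ik jk mem_idx => /(_ isT)[_ /(_ (val l))].
rewrite !mem_meetn il jl kl mem_idx => /(_ isT) E.
have : val m \in [::] by rewrite -E !mem_meetn im jm km lm mem_idx.
by rewrite in_nil.
Qed.

Lemma ring_okP tbl nij p q : ring_ok tbl nij p q ->
  exists r s t, [/\ uniq [:: p; q; r; s; t], {subset [:: r; s; t] <= nij}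
    & [/\ nth false (nth [::] tbl q) r, nth false (nth [::] tbl r) s,
          nth false (nth [::] tbl s) t & nth false (nth [::] tbl t) p]].
Proof.
rewrite /ring_ok; set r := other _ _; set s := other _ _; set t := other _ _.
by case/and5P=> U A qr rs /andP[st tp]; exists r, s, t; split=> //; apply/allP.
Qed.

Lemma ring_rowP tbl u v : all (ring_row tbl u) v ->
  forall i j p q, i \in v -> j \in meetn tbl u i ->
    p \in meetn tbl (meetn tbl u i) j ->
    q \in meetn tbl (meetn tbl (meetn tbl u i) j) p ->
  ring_ok tbl (meetn tbl (meetn tbl u i) j) p q.
Proof.
move=> /allP H i j p q /H; rewrite /ring_row => {}H.
by move: H => /allP H /H/allP{}H /H/allP{}H /H.
Qed.

Lemma ring_adj (i j p q : 'I_120) : adj i j -> adj i p -> adj j p ->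
    adj i q -> adj j q -> adj p q ->
  exists r s t : 'I_120,
    [/\ uniq [:: p; q; r; s; t],
        forall x, (adj i x && adj j x) = (x \in [:: p; q; r; s; t])
      & [/\ adj q r, adj r s, adj s t & adj t p]].
Proof.
move=> ij ip jp iq jq pq.
have jM : val j \in meetn adjs idx i by rewrite mem_meetn ij mem_idx.
have [_ /(_ _ jM)[]] := cliques_ok i; set M := meetn _ _ j => M5 _.
have inM (x : 'I_120) : (val x \in M) = (adj i x && adj j x).
  by rewrite !mem_meetn mem_idx andbT andbC.
have [_ _ H _ _] := and5P table_okP.
have /(ring_rowP H (mem_idx i) jM) : val p \in M by rewrite inM ip jp.
move/(_ (val q)); rewrite -/M mem_meetn inM iq jq pq => /(_ isT).
case/ring_okP=> r [s [t [U sub [qr rs st tp]]]].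
have MI x : x \in M -> x < 120.
  by move=> xM; apply: idx_lt; move: xM; apply: meetn_sub; apply: meetn_sub.
have hr : r < 120 by apply/MI/sub; rewrite !inE eqxx.
have hs : s < 120 by apply/MI/sub; rewrite !inE eqxx orbT.
have ht : t < 120 by apply/MI/sub; rewrite !inE eqxx !orbT.
exists (Ordinal hr), (Ordinal hs), (Ordinal ht); split => //.
have sub' : {subset [:: val p; val q; r; s; t] <= M}.
  move=> x; rewrite 2!inE => /or3P[/eqP->|/eqP->|/sub//]; rewrite inM.
    by rewrite ip jp.
  by rewrite iq jq.
have [_ eqM] := uniq_min_size U sub' (eq_leq M5).
by move=> x; rewrite -inM -eqM -[RHS](mem_map val_inj).
Qed.

Lemma spread_closed (Z : pred 'I_120) (s : seq nat) (x0 : 'I_120) n :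
    {subset s <= idx} -> Z x0 ->
    (forall x y : 'I_120, val y \in s -> Z x -> adj x y -> Z y) ->
    iter n (spread adjs s) [:: val x0] = s ->
  forall x : 'I_120, val x \in s -> Z x.
Proof.
move=> sI Z0 hZ E.
pose Z' m := forall x : 'I_120, val x = m -> Z x.
suff H : forall m, m \in iter n (spread adjs s) [:: val x0] -> Z' m /\ m < 120.
  by move=> x xs; rewrite E in H; have [Zx _] := H _ xs; apply: Zx.
elim: n {E} => [|n IH] m.
  by rewrite inE => /eqP->; split=> [x /ord_inj->//|]; apply: ltn_ord.
rewrite /= mem_filter => /andP[/orP[/IH//|/hasP[k /IH[Zk k120] mk]] ms].
split; last exact/idx_lt/sI.
move=> x xm; apply: (hZ (Ordinal k120)); rewrite ?xm //; first exact: Zk.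
by rewrite adj_sym /adj xm.
Qed.

Lemma adj_connected (Z : pred 'I_120) x0 :
  Z x0 -> (forall x y, Z x -> adj x y -> Z y) -> forall x, Z x.
Proof.
move=> Zx0 hZ; have [_ _ _ /eqP E _] := and5P table_okP.
suff Z0 : Z ord0.
  have H := @spread_closed Z idx ord0 5 (fun _ => id) Z0.
  by move=> x; apply: H (mem_idx x) => // ? ? _; apply: hZ.
(* The search was run from index 0 only. If [Z] failed there, its complement, which is closed under
   the symmetric relation [adj] too, would reach [x0]. *)
apply: contraT => Z0; pose Y := [pred x | ~~ Z x].
have H := @spread_closed Y idx ord0 5 (fun _ => id) Z0.
suff /H/(_ E x0 (mem_idx x0)) : forall x y : 'I_120, val y \in idx -> Y x -> adj x y -> Y y.
  by rewrite /= Zx0.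
by move=> x y _ /= + xy; apply: contra => /hZ; apply; rewrite adj_sym.
Qed.

Lemma link_rowP tbl u i j : all (link_row tbl u) u -> i \in u ->
  j \in meetn tbl u i -> iter 3 (spread tbl (meetn tbl u i)) [:: j] = meetn tbl u i.
Proof. by move=> /allP H /H; rewrite /link_row => /allP{}H /H/eqP. Qed.

Lemma link_connected (a : 'I_120) (Z : pred 'I_120) x0 :
    adj a x0 -> Z x0 -> (forall x y, adj a x -> adj a y -> Z x -> adj x y -> Z y) ->
  forall x, adj a x -> Z x.
Proof.
move=> ax0 Zx0 hZ x ax; have [_ _ _ _ H] := and5P table_okP.
have := link_rowP H (mem_idx a).
move=> /(_ (val x0)); rewrite mem_meetn ax0 mem_idx => /(_ isT) E.
pose Y := [pred x | adj a x && Z x].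
have K := @spread_closed Y _ x0 3 _ _ _ E.
suff /andP[] : Y x by [].
apply: K; rewrite ?mem_meetn /= ?ax ?ax0 ?mem_idx //; first exact: meetn_sub.
move=> y z; rewrite mem_meetn => /andP[az _] /= /andP[ay Zy] yz.
by rewrite az (hZ y).
Qed.

Lemma flip_rowP tbl ws u i j k : all (flip_row tbl ws u) u -> i \in u ->
  j \in meetn tbl u i -> k \in meetn tbl (meetn tbl u i) j ->
  zvec_add (nth zvec0 ws (nth 0%N (meetn tbl (meetn tbl (meetn tbl u i) j) k) 0))
           (nth zvec0 ws (nth 0%N (meetn tbl (meetn tbl (meetn tbl u i) j) k) 1)) =
  zvec_scale (Z.neg 1, Z.pos 1) (zvec_add zvec_corner
    (zvec_add (nth zvec0 ws i) (zvec_add (nth zvec0 ws j) (nth zvec0 ws k)))).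
Proof.
by move=> /allP H /H; rewrite /flip_row => /allP{}H /H/allP{}H /H/eqP.
Qed.

Lemma zvec_addC x y : zvec_add x y = zvec_add y x.
Proof.
have addC a b : zphi_add a b = zphi_add b a.
  by rewrite /zphi_add; congr (_, _); lia.
rewrite /zvec_add (addC x.2); congr (_, _).
elim: x.1 y.1 => [|a s IH] [|b t] //=.
by rewrite addC IH.
Qed.

Lemma flip_adj (i j k s t : 'I_120) : adj i j -> adj i k -> adj j k ->
    adj i s -> adj j s -> adj k s -> adj i t -> adj j t -> adj k t -> s != t ->
  zvec_add (nth zvec0 wallz s) (nth zvec0 wallz t) =
  zvec_scale (Z.neg 1, Z.pos 1) (zvec_add zvec_corner
    (zvec_add (nth zvec0 wallz i)
      (zvec_add (nth zvec0 wallz j) (nth zvec0 wallz k)))).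
Proof.
move=> ij ik jk is_ js ks it jt kt st.
have [_ H _ _ _] := and5P table_okP.
have jM : val j \in meetn adjs idx i by rewrite mem_meetn ij mem_idx.
have kM : val k \in meetn adjs (meetn adjs idx i) j.
  by rewrite !mem_meetn ik jk mem_idx.
rewrite -(flip_rowP H (mem_idx i) jM kM).
have [_ /(_ _ jM)[_ /(_ _ kM)[]]] := cliques_ok i.
set M := meetn _ _ k => M2 _.
have : val s \in M by rewrite !mem_meetn is_ js ks mem_idx.
have : val t \in M by rewrite !mem_meetn it jt kt mem_idx.
case: M M2 => [//|x [//|y []//]] _ /=; rewrite !inE.
move=> /orP[]/eqP tE /orP[]/eqP sE; rewrite -?tE -?sE //.
- by case/eqP: st; apply: val_inj; exact: etrans sE (esym tE).
- by rewrite zvec_addC.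
- by case/eqP: st; apply: val_inj; exact: etrans sE (esym tE).
Qed.

(** * Cliques and tetrahedra of the 600-cell *)

Definition clique (U : {set 'I_120}) : bool :=
  [forall x in U, forall y in U, (x != y) ==> adj x y].

Definition nbs (U : {set 'I_120}) : {set 'I_120} :=
  [set s | [forall u in U, adj u s]].

Definition tet (T : {set 'I_120}) : bool := clique T && (#|T| == 4).

Lemma cliqueP (U : {set 'I_120}) :
  reflect (forall x y, x \in U -> y \in U -> x != y -> adj x y) (clique U).
Proof.
apply: (iffP forall_inP) => [H x y xU yU|H x xU].
  by have /forall_inP/(_ y yU)/implyP := H x xU.
by apply/forall_inP => y yU; apply/implyP/H.
Qed.

Lemma nbsP (U : {set 'I_120}) s :
  reflect (forall u, u \in U -> adj u s) (s \in nbs U).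
Proof. by rewrite inE; apply: forall_inP. Qed.

Lemma cliqueS (U W : {set 'I_120}) : U \subset W -> clique W -> clique U.
Proof.
move=> /subsetP UW /cliqueP H; apply/cliqueP => x y /UW xW /UW yW.
exact: H.
Qed.

Lemma clique0 : clique set0.
Proof. by apply/cliqueP => x y; rewrite inE. Qed.

Lemma clique1 a : clique [set a].
Proof. by apply/cliqueP => x y /set1P-> /set1P->; rewrite eqxx. Qed.

Lemma nbs_notin (U : {set 'I_120}) s : s \in nbs U -> s \notin U.
Proof. by move=> /nbsP H; apply/negP => /H; rewrite adjxx. Qed.

Lemma nbs1 a s : (s \in nbs [set a]) = adj a s.
Proof.
by apply/nbsP/idP => [|as_ u /set1P->//]; apply; rewrite inE.
Qed.

Lemma nbs0 : nbs set0 = setT.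
Proof. by apply/setP => s; rewrite inE in_setT; apply/forall_inP => u; rewrite inE. Qed.

Lemma nbsU1 a U s : (s \in nbs (a |: U)) = adj a s && (s \in nbs U).
Proof.
apply/nbsP/andP => [H|[as_ /nbsP H] u /setU1P[->//|]]; last exact: H.
by split; [apply: H; rewrite setU11 | apply/nbsP => u uU; apply: H; rewrite setU1r].
Qed.

Lemma cliqueU1 (U : {set 'I_120}) s : clique U -> s \in nbs U -> clique (s |: U).
Proof.
move=> /cliqueP cU /nbsP H; apply/cliqueP => x y.
move=> /setU1P[->|xU] /setU1P[->|yU]; rewrite ?eqxx // => xy.
- by rewrite adj_sym H.
- exact: H.
- exact: cU.
Qed.

Lemma clique_nbs (U : {set 'I_120}) s :
  clique (s |: U) -> s \notin U -> s \in nbs U.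
Proof.
move=> /cliqueP cU sU; apply/nbsP => u uU; apply: cU.
- by rewrite setU1r.
- by rewrite setU11.
- by apply: contraNneq sU => <-.
Qed.

(** The clique is listed and the counts read off the table apply case by case. The default value 0
    of [nth] is the count for four letters, which is [no_5clique]. *)
Lemma card_nbs (U : {set 'I_120}) : clique U ->
  #|nbs U| = nth 0 [:: 120; 12; 5; 2] #|U| /\ #|U| <= 4.
Proof.
move=> /cliqueP cU; have := enum_uniq (mem U); rewrite [#|U|]cardE.
have El x : (x \in enum U) = (x \in U) by rewrite mem_enum.
have -> : #|nbs U| = #|[set s | all (adj^~ s) (enum U)]|.
  apply: eq_card => s; rewrite [RHS]inE; apply/nbsP/allP => H u.
    by rewrite El; apply: H.
  by move=> uU; apply: H; rewrite El.
have : forall x y, x \in enum U -> y \in enum U -> x != y -> adj x y.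
  by move=> x y; rewrite !El; apply: cU.
move: (enum _) => l {El cU}.
case: l => [|i [|j [|k [|l [|m s]]]]] H /=.
- by split=> //; rewrite -[RHS]card_ord; apply: eq_card => s; rewrite inE.
- split=> //; rewrite -[RHS](card_adj1 i); apply: eq_card => s.
  by rewrite !inE andbT.
- rewrite /= !inE andbT => ij; have aij : adj i j by apply: H; rewrite ?inE ?eqxx ?orbT.
  split=> //; rewrite -[RHS](card_adj2 aij); apply: eq_card => s.
  by rewrite !inE andbT.
- rewrite /= !inE !negb_or -!andbA andbT => /and3P[ij ik jk].
  have aij : adj i j by apply: H; rewrite ?inE ?eqxx ?orbT.
  have aik : adj i k by apply: H; rewrite ?inE ?eqxx ?orbT.
  have ajk : adj j k by apply: H; rewrite ?inE ?eqxx ?orbT.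
  split=> //; rewrite -[RHS](card_adj3 aij aik ajk); apply: eq_card => s.
  by rewrite !inE andbT.
- rewrite /= !inE !negb_or -!andbA andbT => /and5P[ij ik il jk /andP[jl kl]].
  split=> //; apply/eqP; rewrite cards_eq0; apply/eqP/setP => s; rewrite !inE.
  apply/negP => /and5P[is_ js ks ls _].
  by apply: (@no_5clique i j k l s) => //; apply: H; rewrite ?inE ?eqxx ?orbT.
- rewrite /= !inE !negb_or -!andbA => /and5P[ij ik il im].
  move=> /and5P[_ jk jl jm] /and5P[_ kl km _] /andP[lm _].
  by exfalso; apply: (@no_5clique i j k l m); apply: H; rewrite ?inE ?eqxx ?orbT.
Qed.

Lemma clique_le4 (U : {set 'I_120}) : clique U -> #|U| <= 4.
Proof. by case/card_nbs. Qed.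

Lemma tet_clique T : tet T -> clique T.
Proof. by case/andP. Qed.

Lemma tet_card T : tet T -> #|T| = 4.
Proof. by case/andP=> _ /eqP. Qed.

Lemma tet_sub_eq (T T' : {set 'I_120}) : tet T -> tet T' -> T \subset T' -> T = T'.
Proof.
move=> /tet_card cT /tet_card cT' TT'; apply/eqP.
by rewrite eqEcard TT' cT cT'.
Qed.

Lemma tet_nbs0 T s : tet T -> (s \in nbs T) = false.
Proof.
move=> tT; have [+ _] := card_nbs (tet_clique tT); rewrite (tet_card tT) /=.
by move=> /eqP; rewrite cards_eq0 => /eqP->; rewrite inE.
Qed.

Lemma tet_extend U : clique U -> exists2 T, tet T & U \subset T.
Proof.
move=> cU; have [n En] : exists n, #|U| + n = 4.
  by exists (4 - #|U|); rewrite subnKC // clique_le4.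
elim: n U cU En => [|n IH] U cU.
  by rewrite addn0 => /eqP U4; exists U; rewrite // /tet cU.
move=> En; have [N _] := card_nbs cU.
have : 0 < #|nbs U| by rewrite N; move: En; case: #|U| => [|[|[|[|k]]]] //=; lia.
rewrite card_gt0 => /set0Pn[s sU]; have [|T tT sT] := IH _ (cliqueU1 cU sU).
  by rewrite cardsU1 (nbs_notin sU) add1n addSnnS.
by exists T => //; apply: subset_trans sT; rewrite subsetUr.
Qed.

Lemma tet_cardD1 T s : tet T -> s \in T -> #|T :\ s| = 3.
Proof. by move=> tT sT; move: (cardsD1 s T); rewrite (tet_card tT) sT; lia. Qed.

(** A triangle has exactly two common neighbours, so besides [s] there is one other apex: two
    hypercubes meet along each facet. *)
Lemma flip_exists T s : tet T -> s \in T ->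
  exists s', [/\ s' != s, s' \notin T, nbs (T :\ s) = [set s; s']
    & tet (s' |: T :\ s)].
Proof.
move=> tT sT; have c3 : clique (T :\ s) := cliqueS (subsetDl _ _) (tet_clique tT).
have [N _] := card_nbs c3.
have E3 := tet_cardD1 tT sT.
rewrite E3 /= in N; have sN : s \in nbs (T :\ s).
  by apply: clique_nbs; rewrite ?setD1K ?setD11 ?tet_clique.
have /card_gt0P[s' /setD1P[s's s'N]] : 0 < #|nbs (T :\ s) :\ s|.
  by move: (cardsD1 s (nbs (T :\ s))); rewrite N sN; lia.
exists s'; have NE : nbs (T :\ s) = [set s; s'].
  apply/esym/eqP; rewrite eqEcard N cards2 eq_sym s's andbT.
  by apply/subsetP => x /set2P[]->.
have s'T : s' \notin T.
  by apply: contra (nbs_notin s'N) => s'T; rewrite !inE s's.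
split=> //; rewrite /tet cliqueU1 //=.
by rewrite cardsU1 E3 (nbs_notin s'N).
Qed.

Local Open Scope ring_scope.

(** * Reflections of the hyperboloid *)

Section Minkowski.
Variable R : realType.
Local Notation B := (@minkowski R).
Local Notation phi := (phi R).
Implicit Types (x y z u : point R) (us : seq (point R)).

Lemma phi_sqr : phi * phi = phi + 1.
Proof.
rewrite /Defs.phi; set s := Num.sqrt 5.
have : s * s = 5 by rewrite -expr2 sqr_sqrtr.
by move: s => s; lra.
Qed.

Lemma phi_gt32 : 3 / 2 < phi.
Proof.
rewrite /Defs.phi; set s := Num.sqrt 5.
have s5 : s * s = 5 by rewrite -expr2 sqr_sqrtr.
have s0 : 0 <= s := sqrtr_ge0 _.
by move: s s5 s0 => s; nra.
Qed.

Lemma phi_gt1 : 1 < phi.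
Proof. by have := phi_gt32; lra. Qed.

Lemma phi_gt0 : 0 < phi. Proof. by have := phi_gt32; lra. Qed.

Lemma phi_inv : phi^-1 = phi - 1.
Proof.
have p0 : phi != 0 by rewrite gt_eqF ?phi_gt0.
by apply: (mulfI p0); rewrite divff // mulrBr mulr1 phi_sqr; lra.
Qed.

Lemma mkC x y : B x y = B y x.
Proof.
rewrite /minkowski; congr (_ - _); last by rewrite mulrCA mulrC mulrA mulrAC -!mulrA; congr (_ * _); rewrite mulrC.
by apply: eq_bigr => i _; rewrite mulrC.
Qed.

Lemma mkDl x y z : B (x + y) z = B x z + B y z.
Proof.
rewrite /minkowski !mxE; under eq_bigr do rewrite !mxE mulrDl.
by rewrite big_split /=; ring.
Qed.

Lemma mkZl a x z : B (a *: x) z = a * B x z.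
Proof.
rewrite /minkowski !mxE; under eq_bigr do rewrite !mxE -mulrA.
by rewrite -mulr_sumr; ring.
Qed.

Lemma mkDr x y z : B z (x + y) = B z x + B z y.
Proof. by rewrite mkC mkDl !(mkC z). Qed.

Lemma mkZr a x z : B z (a *: x) = a * B z x.
Proof. by rewrite mkC mkZl (mkC z). Qed.

Lemma mkNl x z : B (- x) z = - B x z.
Proof. by rewrite -scaleN1r mkZl mulN1r. Qed.

Lemma mkNr x z : B z (- x) = - B z x.
Proof. by rewrite mkC mkNl (mkC z). Qed.

Lemma mkBl x y z : B (x - y) z = B x z - B y z.
Proof. by rewrite mkDl mkNl. Qed.

Lemma mkBr x y z : B z (x - y) = B z x - B z y.
Proof. by rewrite mkDr mkNr. Qed.

Lemma mk0l z : B 0 z = 0.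
Proof. by rewrite -(scale0r z) mkZl mul0r. Qed.

Lemma mk0r z : B z 0 = 0.
Proof. by rewrite mkC mk0l. Qed.

Lemma mk_suml (I : Type) (s : seq I) (P : pred I) (F : I -> point R) z :
  B (\sum_(i <- s | P i) F i) z = \sum_(i <- s | P i) B (F i) z.
Proof. by apply: (big_morph (B^~ z)) => [x y|]; rewrite ?mkDl ?mk0l. Qed.

Lemma mk_sumr (I : Type) (s : seq I) (P : pred I) (F : I -> point R) z :
  B z (\sum_(i <- s | P i) F i) = \sum_(i <- s | P i) B z (F i).
Proof. by apply: (big_morph (B z)) => [x y|]; rewrite ?mkDr ?mk0r. Qed.

Definition mkE := (mkDl, mkDr, mkBl, mkBr, mkZl, mkZr, mkNl, mkNr, mk0l, mk0r).

Lemma reflectionD u x y :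
  reflection u (x + y) = reflection u x + reflection u y.
Proof.
by rewrite /reflection mkDl mulrDr mulrDl scalerDl opprD addrACA.
Qed.

Lemma reflectionZ u a x : reflection u (a *: x) = a *: reflection u x.
Proof.
rewrite /reflection mkZl scalerBr scalerA; congr (_ - _ *: _).
by rewrite mulrCA -!mulrA.
Qed.

Lemma reflection_mkl u x y :
  B (reflection u x) y = B x y - 2 * B x u / B u u * B u y.
Proof. by rewrite /reflection !mkE. Qed.

Lemma reflection_mk u x y : 0 < B u u ->
  B (reflection u x) (reflection u y) = B x y.
Proof.
move=> u0; rewrite reflection_mkl !(mkC _ (reflection u y)) !reflection_mkl.
rewrite !(mkC y) (mkC u x); field.
by rewrite gt_eqF.
Qed.

Lemma reflectionK u : 0 < B u u -> involutive (reflection u).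
Proof.
move=> u0 x; rewrite {1}/reflection reflection_mkl /reflection -addrA -opprD -scalerDl.
rewrite [X in X *: u](_ : _ = 0) ?scale0r ?subr0 //; field.
by rewrite gt_eqF.
Qed.

Lemma reflection_fix u x : B x u = 0 -> reflection u x = x.
Proof. by rewrite /reflection => ->; rewrite mulr0 mul0r scale0r subr0. Qed.

Lemma mk_coord x y : B x y =
  x 0 (lshift 1 0) * y 0 (lshift 1 0) + x 0 (lshift 1 1) * y 0 (lshift 1 1) +
  x 0 (lshift 1 2) * y 0 (lshift 1 2) + x 0 (lshift 1 3) * y 0 (lshift 1 3)
  - (phi - 1) * (x 0 (rshift 4 0) * y 0 (rshift 4 0)).
Proof.
rewrite /minkowski phi_inv !big_ord_recl big_ord0 addr0 !addrA.
by congr (_ * _ + _ * _ + _ * _ + _ * _ - _); congr (_ 0 _); apply: val_inj.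
Qed.

Lemma cauchy4 (a b c d t a' b' c' d' t' p : R) : 0 < p -> 0 < t -> t' <= 0 ->
  a * a + b * b + c * c + d * d - p * (t * t) < 0 ->
  a' * a' + b' * b' + c' * c' + d' * d' - p * (t' * t') < 0 ->
  0 <= a * a' + b * b' + c * c' + d * d' - p * (t * t').
Proof.
move=> p0 t0 t0'.
set A := a * a + b * b + c * c + d * d; set C := a' * a' + b' * b' + c' * c' + d' * d'.
set E := a * a' + b * b' + c * c' + d * d'; rewrite !subr_lt0 => h1 h2.
have AC : E ^+ 2 <= A * C.
  rewrite -subr_ge0 (_ : _ - _ = (a * b' - b * a') ^+ 2 + (a * c' - c * a') ^+ 2 +
    (a * d' - d * a') ^+ 2 + (b * c' - c * b') ^+ 2 + (b * d' - d * b') ^+ 2 +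
    (c * d' - d * c') ^+ 2); last by rewrite /A /C /E; ring.
  by rewrite !addr_ge0 ?sqr_ge0.
have A0 : 0 <= A by rewrite /A -!expr2 !addr_ge0 ?sqr_ge0.
have C0 : 0 <= C by rewrite /C -!expr2 !addr_ge0 ?sqr_ge0.
have F0 : 0 <= - (p * (t * t')).
  by rewrite oppr_ge0 pmulr_rle0 // pmulr_rle0.
have : E ^+ 2 <= (- (p * (t * t'))) ^+ 2.
  apply: le_trans AC _; rewrite (_ : _ ^+ 2 = (p * (t * t)) * (p * (t' * t'))); last by ring.
  by apply: ler_pM => //; apply: ltW.
rewrite -(real_normK (num_real E)) ler_sqr ?nnegrE ?normr_ge0 // => le_E.
by have := ler_norm (- E); rewrite normrN; lra.
Qed.

Lemma timelike_same_side x y : B x x < 0 -> B y y < 0 ->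
  0 < x 0 (rshift 4 0) -> y 0 (rshift 4 0) <= 0 -> 0 <= B x y.
Proof.
rewrite !mk_coord => hx hy x0 y0; apply: cauchy4 => //.
by have := phi_gt32; lra.
Qed.

Lemma level_lt0 : 3 - 2 * phi < 0.
Proof. by have := phi_gt32; lra. Qed.

(** On the other sheet the image would have a nonnegative product with [x]; but that product is the
    negative level minus twice a square divided by <u, u>. *)
Lemma hyp4_reflection u x : 0 < B u u -> hyp4 x -> hyp4 (reflection u x).
Proof.
move=> u0 [x1 x0]; split; first by rewrite reflection_mk.
rewrite ltNge; apply/negP => t0.
have := @timelike_same_side x (reflection u x).
rewrite reflection_mk // x1 mkC reflection_mkl x1 (mkC u x) => /(_ level_lt0 level_lt0 x0 t0).
apply/negP; rewrite -ltNge.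
have : 0 <= 2 * B x u / B u u * B x u.
  rewrite (_ : _ / _ * _ = 2 * (B x u ^+ 2 / B u u)); last by ring.
  by rewrite mulr_ge0 // divr_ge0 ?sqr_ge0 // ltW.
by have := level_lt0; lra.
Qed.

Definition refls us x : point R := foldr (@reflection R) x us.

Definition spacelike us : bool := all (fun u => 0 < B u u) us.

Lemma refls_cat us us' x : refls (us ++ us') x = refls us (refls us' x).
Proof. by rewrite /refls foldr_cat. Qed.

Lemma reflsD us x y : refls us (x + y) = refls us x + refls us y.
Proof. by elim: us => //= u us ->; rewrite reflectionD. Qed.

Lemma reflsZ us a x : refls us (a *: x) = a *: refls us x.
Proof. by elim: us => //= u us ->; rewrite reflectionZ. Qed.

Lemma refls0 us : refls us 0 = 0.
Proof. by rewrite -(scale0r 0) reflsZ !scale0r. Qed.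

Lemma reflsN us x : refls us (- x) = - refls us x.
Proof. by rewrite -scaleN1r reflsZ scaleN1r. Qed.

Lemma reflsB us x y : refls us (x - y) = refls us x - refls us y.
Proof. by rewrite reflsD reflsN. Qed.

Lemma refls_sum us (I : Type) (s : seq I) (P : pred I) (F : I -> point R) :
  refls us (\sum_(i <- s | P i) F i) = \sum_(i <- s | P i) refls us (F i).
Proof. by apply: (big_morph (refls us)) => [x y|]; rewrite ?reflsD ?refls0. Qed.

Lemma refls_mk us x y : spacelike us -> B (refls us x) (refls us y) = B x y.
Proof. by elim: us => //= u us IH /andP[u0 /IH]; rewrite reflection_mk. Qed.

Lemma spacelike_rev us : spacelike (rev us) = spacelike us.
Proof. exact: all_rev. Qed.

Lemma reflsK us : spacelike us -> cancel (refls us) (refls (rev us)).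
Proof.
elim: us => [|u us IH] //= /andP[u0 su] x.
by rewrite rev_cons -cats1 refls_cat /= reflectionK ?IH.
Qed.

Lemma reflsVK us : spacelike us -> cancel (refls (rev us)) (refls us).
Proof. by move=> su x; rewrite -{1}(revK us) reflsK // spacelike_rev. Qed.

Lemma refls_inj us : spacelike us -> injective (refls us).
Proof. by move=> su; apply: can_inj (reflsK su). Qed.

Lemma refls_mkV us x y : spacelike us -> B (refls us x) y = B x (refls (rev us) y).
Proof. by move=> su; rewrite -{1}(reflsVK su y) refls_mk. Qed.

Lemma hyp4_refls us x : spacelike us -> hyp4 x -> hyp4 (refls us x).
Proof. by elim: us => //= u us IH /andP[u0 su] hx; apply: hyp4_reflection => //; apply: IH. Qed.

Lemma reflection_conj us u x : spacelike us ->
  reflection (refls us u) (refls us x) = refls us (reflection u x).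
Proof. by move=> su; rewrite /reflection !refls_mk // reflsB reflsZ. Qed.

End Minkowski.

(** * The walls as real vectors *)

Section Walls.
Variable R : realType.
Local Notation B := (@minkowski R).
Local Notation phi := (phi R).

Definition zr (x : zphi) : R :=
  (int_of_Z x.1)%:~R + (int_of_Z x.2)%:~R * phi.

Lemma zr_add x y : zr (zphi_add x y) = zr x + zr y.
Proof.
rewrite /zr /zphi_add /= -[Z.add x.1 _]/(x.1 + y.1) -[Z.add x.2 _]/(x.2 + y.2).
by rewrite !rmorphD /=; ring.
Qed.

Lemma zr_mul x y : zr (zphi_mul x y) = zr x * zr y.
Proof.
rewrite /zr /zphi_mul /=.
rewrite -[Z.add (Z.mul x.1 y.1) _]/(x.1 * y.1 + x.2 * y.2).
rewrite -[Z.add (Z.add _ _) _]/(x.1 * y.2 + x.2 * y.1 + x.2 * y.2).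
rewrite !(rmorphD, rmorphM) /=.
set a := (int_of_Z x.1)%:~R; set b := (int_of_Z x.2)%:~R.
set c := (int_of_Z y.1)%:~R; set d := (int_of_Z y.2)%:~R.
have : b * d * (phi * phi - (phi + 1)) = 0 by rewrite phi_sqr subrr mulr0.
move: a b c d => a b c d E; rewrite -[LHS]addr0 -E; ring.
Qed.

Lemma zr0 : zr (Z0, Z0) = 0.
Proof. by rewrite /zr /= mul0r addr0. Qed.

Lemma zr1 : zr (Z.pos 1, Z0) = 1.
Proof. by rewrite /zr /= mul0r addr0. Qed.

Lemma zrN1 : zr (Z.neg 1, Z0) = -1.
Proof. by rewrite /zr /= mul0r addr0. Qed.

Lemma zr_phi_inv : zr (Z.neg 1, Z.pos 1) = phi - 1.
Proof. by rewrite /zr /= mul1r addrC. Qed.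

Lemma zr_le_N1 x : Z.le x.1 Z0 -> Z.le x.2 (Z.neg 1) -> zr x <= -1.
Proof.
move=> h1 h2; have h1' : (int_of_Z x.1 <= 0) by lia.
have h2' : (int_of_Z x.2 <= -1) by lia.
have k1 : (int_of_Z x.1)%:~R <= (0 : R) by rewrite -[0]/(0%:~R) ler_int.
have k2 : (int_of_Z x.2)%:~R <= (-1 : R) by rewrite -[-1]/((-1)%:~R) ler_int.
by rewrite /zr; have := phi_gt32 R; nra.
Qed.

Definition zpt (x : zvec) : point R :=
  row_mx (\row_i zr (nth (Z0, Z0) x.1 i)) (const_mx (zr x.2)).

Lemma zpt_space x i : zpt x 0 (lshift 1 i) = zr (nth (Z0, Z0) x.1 i).
Proof. by rewrite row_mxEl mxE. Qed.

Lemma zpt_time x : zpt x 0 (rshift 4 0) = zr x.2.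
Proof. by rewrite row_mxEr mxE. Qed.

Lemma zpt_gram x y : size x.1 = 4%N -> size y.1 = 4%N ->
  B (zpt x) (zpt y) = zr (zvec_gram x y).
Proof.
case: x y => [[|x0 [|x1 [|x2 [|x3 [|? ?]]]]] xt] [[|y0 [|y1 [|y2 [|y3 [|? ?]]]]] yt] //= _ _.
rewrite mk_coord !zpt_space !zpt_time /= /zvec_gram /=.
have zc : zr (Z.pos 1, Z.neg 1) = 1 - phi by rewrite /zr /= mulN1r.
by rewrite !(zr_add, zr_mul) zr0 zc; ring.
Qed.

Lemma zvec_add_size x y : size x.1 = 4%N -> size y.1 = 4%N ->
  size (zvec_add x y).1 = 4%N.
Proof. by rewrite size_map size_zip => -> ->. Qed.

Lemma zpt_add x y : size x.1 = 4%N -> size y.1 = 4%N ->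
  zpt (zvec_add x y) = zpt x + zpt y.
Proof.
case: x y => [[|x0 [|x1 [|x2 [|x3 [|? ?]]]]] xt] [[|y0 [|y1 [|y2 [|y3 [|? ?]]]]] yt] //= _ _.
apply/rowP => j; rewrite !mxE; case: splitP => k _; rewrite !mxE ?zr_add //.
by case: k => [[|[|[|[|k]]]] hk] //=; rewrite zr_add.
Qed.

Lemma zpt_scale c x : size x.1 = 4%N -> zpt (zvec_scale c x) = zr c *: zpt x.
Proof.
case: x => [[|x0 [|x1 [|x2 [|x3 [|? ?]]]]] xt] //= _.
apply/rowP => j; rewrite !mxE; case: splitP => k _; rewrite !mxE ?zr_mul //.
by case: k => [[|[|[|[|k]]]] hk] //=; rewrite zr_mul.
Qed.

Definition wall (i : 'I_120) : point R := zpt (nth zvec0 wallz i).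

Definition corner0 : point R := zpt zvec_corner.

Lemma wallz_nth (i : 'I_120) : size (nth zvec0 wallz i).1 = 4%N /\
  zvec_gram (nth zvec0 wallz i) zvec_corner = (Z.neg 1, Z0).
Proof.
have [/eqP sz /all_nthP H _ _] := and4P walls_okP.
by have /andP[/eqP-> /eqP->] := H zvec0 i ltac:(by rewrite sz ltn_ord).
Qed.

Lemma wall_gram i j : B (wall i) (wall j) = zr (gramz i j).
Proof. by rewrite zpt_gram // (wallz_nth _).1. Qed.

Lemma wall_norm i : B (wall i) (wall i) = 1.
Proof. by rewrite wall_gram gramz_diag zr1. Qed.

Lemma wall_corner i : B (wall i) corner0 = -1.
Proof. by rewrite zpt_gram ?(wallz_nth _).1 // (wallz_nth _).2 zrN1. Qed.

Lemma wall_adj i j : adj i j -> B (wall i) (wall j) = 0.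
Proof. by rewrite adjE wall_gram => /eqP->; rewrite zr0. Qed.

Lemma wall_nonadj i j : i != j -> ~~ adj i j -> B (wall i) (wall j) <= -1.
Proof. by rewrite wall_gram => ij /(gramz_neq ij)[]; apply: zr_le_N1. Qed.

Lemma wall_le0 i j : i != j -> B (wall i) (wall j) <= 0.
Proof.
move=> ij; case: (boolP (adj i j)) => [/wall_adj->//|/(wall_nonadj ij)].
by move=> h; apply: le_trans h _; rewrite oppr_le0.
Qed.

Lemma corner_norm : B corner0 corner0 = 3 - 2 * phi.
Proof.
rewrite zpt_gram // (_ : zvec_gram _ _ = (Z.pos 3, Z.neg 2)) //.
by rewrite /zr (_ : int_of_Z _ = 3) // (_ : int_of_Z _ = -2) //; ring.
Qed.

Lemma corner0_time : corner0 0 (rshift 4 0) = phi ^+ 2.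
Proof. by rewrite zpt_time /zr /= expr2 phi_sqr addrC mul1r. Qed.

Lemma corner0_space i : corner0 0 (lshift 1 i) = 1.
Proof. by rewrite zpt_space; case: i => [[|[|[|[|i]]]] hi] //=; rewrite zr1. Qed.

Lemma corner0_hyp4 : hyp4 corner0.
Proof.
by split; [rewrite corner_norm | rewrite corner0_time exprn_gt0 ?phi_gt0].
Qed.

Lemma wall_flip T s s' : tet T -> s \in T -> s' != s -> s' \in nbs (T :\ s) ->
  wall s + wall s' = (phi - 1) *: (corner0 + \sum_(t in T :\ s) wall t).
Proof.
move=> tT sT s's s'N.
have cT := cliqueS (subsetDl T [set s]) (tet_clique tT).
have sN : s \in nbs (T :\ s).
  by apply: clique_nbs; rewrite ?setD1K ?setD11 ?tet_clique.
have E3 := tet_cardD1 tT sT.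
move: (T :\ s) E3 cT sN s'N => U E3 /cliqueP cU /nbsP sN /nbsP s'N.
have := enum_uniq (mem U); rewrite -big_enum /=.
have El x : (x \in enum U) = (x \in U) by rewrite mem_enum.
move: E3; rewrite cardE; case: (enum _) El => [|i [|j [|k [|? ?]]]] //= El _.
rewrite !inE negb_or andbT => /andP[/andP[ij ik] jk].
have [iU jU kU] : [/\ i \in U, j \in U & k \in U].
  by rewrite -!El !inE !eqxx !orbT.
have ss' : s != s' by rewrite eq_sym.
have E := flip_adj (cU _ _ iU jU ij) (cU _ _ iU kU ik) (cU _ _ jU kU jk)
  (sN _ iU) (sN _ jU) (sN _ kU) (s'N _ iU) (s'N _ jU) (s'N _ kU) ss'.
have sz x := (wallz_nth x).1; have sc : size zvec_corner.1 = 4%N by [].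
rewrite /wall -zpt_add ?sz // E zpt_scale ?zvec_add_size ?sz //.
rewrite zr_phi_inv zpt_add ?zvec_add_size ?sz // zpt_add ?zvec_add_size ?sz //.
rewrite zpt_add ?sz //.
by rewrite !big_cons big_nil addr0.
Qed.

Definition base (i : 'I_4) : 'I_120 := widen_ord (isT : (4 <= 120)%N) i.

Lemma wall_base i : wall (base i) = - row_mx (delta_mx 0 i) 0.
Proof.
have [_ _ _ /eqP E] := and4P walls_okP.
have -> : wall (base i) = zpt (nth zvec0 base_walls i).
  by rewrite /wall -E nth_take.
apply/rowP => j; rewrite !mxE; case: splitP => k _; rewrite !mxE.
  by case: i k => [[|[|[|[|i]]]] hi] [[|[|[|[|k]]]] hk] //=; rewrite ?zr0 ?zrN1 ?oppr0.
by case: i => [[|[|[|[|i]]]] hi] //=; rewrite zr0 oppr0.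
Qed.

End Walls.

(** After the letter [s] a word can end in [s], or in an earlier possible last letter that commutes
    with [s]. *)
Definition dstep (D : {set 'I_120}) s : {set 'I_120} := s |: [set t in D | adj s t].

Definition descents (w : seq 'I_120) : {set 'I_120} := foldl dstep set0 w.

(** The set [D] stands for the descents of what precedes, so that a word can be cut and its suffix
    tested separately. *)
Fixpoint reduced_from (D : {set 'I_120}) (w : seq 'I_120) : bool :=
  if w is s :: w' then (s \notin D) && reduced_from (dstep D s) w' else true.

Definition reduced : seq 'I_120 -> bool := reduced_from set0.

Lemma reduced_from_cat D w w' : reduced_from D (w ++ w') =
  reduced_from D w && reduced_from (foldl dstep D w) w'.
Proof. by elim: w D => //= s w IH D; rewrite IH andbA. Qed.

Lemma descents_rcons w s : descents (rcons w s) = dstep (descents w) s.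
Proof. by rewrite /descents foldl_rcons. Qed.

Lemma reduced_rcons w s : reduced (rcons w s) = reduced w && (s \notin descents w).
Proof. by rewrite /reduced -cats1 reduced_from_cat /= andbT. Qed.

Lemma in_dstep D s t : (t \in dstep D s) = (t == s) || (t \in D) && adj s t.
Proof. by rewrite !inE. Qed.

Lemma clique_dstep D s : clique D -> s \notin D -> clique (dstep D s).
Proof.
move=> /cliqueP cD sD; apply/cliqueP => x y; rewrite !in_dstep.
move=> /orP[/eqP->|/andP[xD sx]] /orP[/eqP->|/andP[yD sy]]; rewrite ?eqxx //.
- by rewrite adj_sym.
- exact: cD.
Qed.

Lemma clique_descents w : reduced w -> clique (descents w).
Proof.
elim/last_ind: w => [|w s IH]; first by rewrite clique0.
by rewrite reduced_rcons descents_rcons => /andP[/IH]; apply: clique_dstep.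
Qed.

(** * Words and descents *)

Section Words.
Variable R : realType.
Local Notation B := (@minkowski R).
Local Notation wall := (wall R).
Local Notation corner0 := (corner0 R).
Implicit Types (w : seq 'I_120) (D : {set 'I_120}) (x y : point R).

Definition act w : point R -> point R := refls (map wall w).

Lemma spacelike_walls w : spacelike (map wall w).
Proof. by apply/allP => _ /mapP[i _ ->]; rewrite wall_norm. Qed.

Lemma reflection_wall s x : reflection (wall s) x = x - (2 * B x (wall s)) *: wall s.
Proof. by rewrite /reflection wall_norm divr1. Qed.

Lemma act_cat w w' x : act (w ++ w') x = act w (act w' x).
Proof. by rewrite /act map_cat refls_cat. Qed.

Lemma act_rcons w s x : act (rcons w s) x = act w (reflection (wall s) x).
Proof. by rewrite -cats1 act_cat. Qed.

Lemma act_mk w x y : B (act w x) (act w y) = B x y.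
Proof. by rewrite refls_mk ?spacelike_walls. Qed.

Lemma act_mkV w x y : B (act w x) y = B x (act (rev w) y).
Proof. by rewrite refls_mkV ?spacelike_walls // /act map_rev. Qed.

Lemma actK w : cancel (act w) (act (rev w)).
Proof. by move=> x; rewrite /act map_rev reflsK ?spacelike_walls. Qed.

Lemma actVK w : cancel (act (rev w)) (act w).
Proof. by move=> x; rewrite -{1}(revK w) actK. Qed.

Lemma act_inj w : injective (act w). Proof. exact: can_inj (actK w). Qed.

(* For [c = 1] and [y = w^-1 corner0] this says on which side of every wall at
   the vertex [w] the origin lies; [c = 0] is the limiting case of points of the
   closed chamber of the origin. *)
Definition chamber_inv (c : R) D y : Prop :=
  [/\ forall s, s \in D -> c <= B (wall s) y,
      forall s, s \notin D -> B (wall s) y <= - c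
    & forall s t, s != t -> ~~ adj s t -> B (wall s) y + B (wall t) y <= - (2 * c)].

(** Let -b be the product of [y] with the wall [s], so b >= c. The reflection leaves the product
    with a wall [t] commuting with [s] unchanged and lowers the others by at least 2b. The third
    clause of the invariant is what handles an old descent [t] not commuting with [s]: its product
    was at most b - 2c and drops to at most -b - 2c. *)
Lemma chamber_inv_step c D y s : 0 <= c -> chamber_inv c D y -> s \notin D ->
  chamber_inv c (dstep D s) (reflection (wall s) y).
Proof.
move=> c0 [inD outD pairs] sD.
have [b bE] : exists b, B (wall s) y = - b by exists (- B (wall s) y); rewrite opprK.
have b0 : c <= b by have := outD _ sD; rewrite bE; lra.
have E t : B (wall t) (reflection (wall s) y) = B (wall t) y + 2 * b * B (wall t) (wall s).
  by rewrite reflection_wall !mkE (mkC y) bE; ring.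
have Es : B (wall s) (reflection (wall s) y) = b by rewrite E wall_norm bE; ring.
have le t : t != s -> B (wall t) (reflection (wall s) y) <= B (wall t) y.
  move=> ts; rewrite E gerDl mulr_ge0_le0 ?wall_le0 //.
  by rewrite mulr_ge0 //; lra.
have far t : t != s -> ~~ adj t s ->
    B (wall t) (reflection (wall s) y) <= B (wall t) y - 2 * b.
  move=> ts nts; rewrite E; have wts := wall_nonadj R ts nts.
  have : b * (B (wall t) (wall s) + 1) <= 0 by apply: mulr_ge0_le0; lra.
  by rewrite lerD2l -mulrA -mulrN ler_pM2l // mulrDr mulr1; lra.
split=> [t|t|t t' tt' ntt'].
- rewrite in_dstep => /orP[/eqP->|/andP[tD st]]; first by rewrite Es.
  by rewrite E (@wall_adj R t s) ?mulr0 ?addr0 ?inD // adj_sym.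
- rewrite in_dstep negb_or negb_and => /andP[ts].
  case: (boolP (adj s t)) => [st|nst _].
    by rewrite orbF => tD; apply: le_trans (le _ ts) (outD _ tD).
  have := far t ts; rewrite adj_sym => /(_ nst) h; apply: le_trans h _.
  case: (boolP (t \in D)) => [tD|/outD]; last by lra.
  by have := pairs t s ts; rewrite adj_sym => /(_ nst); rewrite bE; lra.
- wlog: t t' tt' ntt' / t' != s.
    move=> H; case: (eqVneq t' s) => [t's|]; last exact: H.
    by rewrite addrC H // ?(eq_sym t') // ?(adj_sym t') // -t's.
  move=> t's; case: (eqVneq t s) => [ts|ts]; last first.
    by apply: le_trans (pairs _ _ tt' ntt'); rewrite lerD ?le.
  subst t; rewrite Es; have := far t' t's; rewrite adj_sym => /(_ ntt').
  by have := pairs _ _ tt' ntt'; rewrite bE; lra.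
Qed.

Lemma chamber_inv_word c D w y : 0 <= c -> chamber_inv c D y -> reduced_from D w ->
  chamber_inv c (foldl dstep D w) (act (rev w) y).
Proof.
move=> c0; elim: w D y => //= s w IH D y inv /andP[sD rw].
rewrite rev_cons -cats1 act_cat /=.
exact: IH (chamber_inv_step _ _ _) rw.
Qed.

Lemma chamber_inv_corner0 : chamber_inv 1 set0 corner0.
Proof.
split=> [s|s _|s t _ _]; first by rewrite inE.
  by rewrite wall_corner.
by rewrite !wall_corner; lra.
Qed.

Lemma reduced_inv w : reduced w -> chamber_inv 1 (descents w) (act (rev w) corner0).
Proof. by apply: chamber_inv_word chamber_inv_corner0 => //; apply: ler01. Qed.

Lemma descentsP w s : reduced w ->
  (s \in descents w) = (0 < B (wall s) (act (rev w) corner0)).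
Proof.
move=> /reduced_inv[inD outD _]; apply/idP/idP => [/inD|]; first by lra.
by apply: contraTT => /outD; rewrite -leNgt; lra.
Qed.

Lemma reflection_corner0 s : reflection (wall s) corner0 = corner0 + 2 *: wall s.
Proof.
rewrite reflection_wall (mkC corner0) wall_corner.
by rewrite mulrN1 scaleNr opprK.
Qed.

Lemma vertex_rcons w s y : B (act (rcons w s) corner0) y =
  B (act w corner0) y + 2 * B (wall s) (act (rev w) y).
Proof.
by rewrite act_rcons reflection_corner0 !act_mkV mkDl mkZl.
Qed.

(** Each letter outside the descents lowers the product by at least 2. In particular a nonempty
    reduced word moves the corner, which makes the action on vertices free. *)
Lemma vertex_dist w : reduced w ->
  B (act w corner0) corner0 <= B corner0 corner0 - 2 * (size w)%:R.
Proof.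
elim/last_ind: w => [_|w s IH]; first by rewrite mulr0 subr0.
rewrite reduced_rcons => /andP[rw sD].
rewrite vertex_rcons size_rcons -[(size w).+1%:R]natr1; have := IH rw.
by have [_ /(_ _ sD) + _] := reduced_inv rw; lra.
Qed.

Lemma eq_act_descents w w' : reduced w -> reduced w' -> act w =1 act w' ->
  descents w = descents w'.
Proof.
move=> rw rw' E; apply/setP => s; rewrite !descentsP //.
congr (0 < B _ _); apply: (@act_inj w).
by rewrite actVK E actVK.
Qed.

Lemma reflection_comm s t x : adj s t ->
  reflection (wall s) (reflection (wall t) x) =
  reflection (wall t) (reflection (wall s) x).
Proof.
move=> st; have ts : adj t s by rewrite adj_sym.
rewrite !reflection_wall !mkE (wall_adj R st) (wall_adj R ts).
by rewrite !mulr0 !subr0 addrAC.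
Qed.

(** A descent other than the last letter commutes with the last letter, so the copy of it brought to
    the end of the shorter word can be moved one place further. *)
Lemma exchange w s : reduced w -> s \in descents w -> exists w',
  [/\ reduced (rcons w' s), size w = (size w').+1 & act w =1 act (rcons w' s)].
Proof.
elim/last_ind: w s => [|w t IH] s; first by rewrite inE.
rewrite reduced_rcons descents_rcons in_dstep => /andP[rw tD].
case/orP=> [/eqP->|/andP[sD ts]].
  by exists w; rewrite reduced_rcons rw tD size_rcons.
have [w' [rw' szw Ew]] := IH s rw sD.
have Ew't x : act (rcons w t) x = act (rcons (rcons w' t) s) x.
  rewrite !act_rcons Ew act_rcons; congr (act w' _).
  by rewrite reflection_comm // adj_sym.
have /andP[rw'0 sw'] : reduced w' && (s \notin descents w') by rewrite -reduced_rcons.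
(* Since [t] commutes with [s], as a descent of [w'] it would survive the letter [s] and be a
   descent of [w]. *)
have tw' : t \notin descents w'.
  have := eq_act_descents rw rw' Ew; rewrite descents_rcons => DE.
  move: tD; rewrite DE in_dstep negb_or negb_and (adj_sym s) ts orbF.
  by case/andP.
exists (rcons w' t); rewrite !size_rcons szw; split=> //.
rewrite !reduced_rcons rw'0 tw' descents_rcons in_dstep negb_or (negPf sw') andbT /=.
by rewrite (adj_neq _) // adj_sym.
Qed.

(** A letter that is already a descent cancels against its copy brought to the end by [exchange]. *)
Lemma reduce_word w : exists w', [/\ reduced w', act w' =1 act w &
  (size w' <= size w)%N /\ (~~ reduced w -> (size w' < size w)%N)].
Proof.
elim/last_ind: w => [|w s [w' [rw' Ew' [sz lt_sz]]]]; first by exists [::].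
case: (boolP (s \in descents w')) => sD; last first.
  exists (rcons w' s); split; first by rewrite reduced_rcons rw'.
    by move=> x; rewrite !act_rcons Ew'.
  rewrite !size_rcons; split=> // nr; rewrite ltnS; apply: lt_sz.
  apply: contra nr => rw; rewrite reduced_rcons rw.
  by rewrite (eq_act_descents rw rw') // => x; rewrite Ew'.
have [w2 [rw2 szw Ew]] := exchange rw' sD.
exists w2; rewrite size_rcons; split.
- by move: rw2; rewrite reduced_rcons => /andP[].
- by move=> x; rewrite act_rcons -Ew' Ew act_rcons reflectionK // wall_norm.
- by split; [apply: ltnW | move=> _]; rewrite ltnS -?szw; lia.
Qed.

(** The quotient of the two words, once reduced, fixes [corner0] and is empty by [vertex_dist].
    Hence vertices can be identified with elements of the group. *)
Lemma vertex_act w w' : act w corner0 = act w' corner0 -> act w =1 act w'.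
Proof.
move=> E; have [u [ru Eu _]] := reduce_word (rev w' ++ w).
have u0 : act u corner0 = corner0 by rewrite Eu act_cat E actK.
have : size u = 0%N.
  have := vertex_dist ru; rewrite u0 => h.
  have : (size u)%:R <= (0 : R) by lra.
  by rewrite lern0 => /eqP.
move=> /size0nil un x; rewrite un in Eu.
by apply: (@act_inj (rev w')); rewrite actK -act_cat -Eu.
Qed.

(** The last letter of [w] is also a descent of the reduced form of [w'], because descents depend
    only on the motion, so it can be cancelled on both sides. *)
Lemma reduced_size_le w w' : reduced w -> act w =1 act w' -> (size w <= size w')%N.
Proof.
move=> rw E; have [u [ru Eu [szu _]]] := reduce_word w'.
apply: leq_trans szu; have {E Eu w'} : act w =1 act u by move=> x; rewrite E Eu.
elim/last_ind: w u ru rw => [|w s IH] u ru //; rewrite reduced_rcons => /andP[rw sD] E.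
have su : s \in descents u.
  rewrite -(eq_act_descents _ ru E) ?reduced_rcons ?rw //.
  by rewrite descents_rcons in_dstep eqxx.
have [u' [ru' -> Eu']] := exchange ru su.
rewrite size_rcons ltnS; apply: IH => //.
  by move: ru'; rewrite reduced_rcons => /andP[].
move=> x; have := E (reflection (wall s) x); rewrite Eu' !act_rcons.
by rewrite reflectionK ?wall_norm.
Qed.

Lemma reduced_size_eq w w' : reduced w -> reduced w' -> act w =1 act w' ->
  size w = size w'.
Proof.
by move=> rw rw' E; apply/eqP; rewrite eqn_leq !reduced_size_le.
Qed.

Lemma shortest_reduced w w' : reduced w -> act w =1 act w' ->
  size w = size w' -> reduced w'.
Proof.
move=> rw E sz; apply: contraT => nr; have [u [ru Eu [_ /(_ nr)]]] := reduce_word w'.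
by rewrite -sz ltnNge reduced_size_le // => x; rewrite Eu E.
Qed.

End Words.

Lemma reduced_from_clique (D : {set 'I_120}) (l : seq 'I_120) : uniq l ->
    (forall x y, x \in l -> y \in l -> x != y -> adj x y) ->
    (forall x, x \in l -> x \notin D) ->
  reduced_from D l /\
  foldl dstep D l = [set x in l] :|: [set t in D | all (adj^~ t) l].
Proof.
elim: l D => [|s l IH] D /=.
  split=> //; apply/setP => t; rewrite !inE andbT; by [].
move=> /andP[sl Ul] adjl Dl.
have sD : s \notin D by apply: Dl; rewrite inE eqxx.
have al t : t \in l -> adj s t.
  move=> tl; apply: adjl; rewrite ?inE ?eqxx ?tl ?orbT //.
  by apply: contraNneq sl => ->.
have [|x xl|rl ->] := IH (dstep D s) Ul.
- by move=> x y xl yl; apply: adjl; rewrite inE ?xl ?yl orbT.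
- rewrite in_dstep negb_or negb_and Dl ?inE ?xl ?orbT //= andbT.
  by rewrite eq_sym adj_neq // al.
rewrite sD rl; split=> //; apply/setP => t; rewrite !inE.
case: (eqVneq t s) => [->|ts] /=; last first.
  by rewrite andbA; case: (t \in l).
rewrite orbC; case: (boolP (all _ _)) => //= /allPn[x xl].
by rewrite adj_sym al.
Qed.

Definition near (a : 'I_120) (w : seq 'I_120) : bool := all (adj a) w.

(* In terms of heights above the bisector [a]: the vertex of a reduced word [w] is
   at the height -1 of the origin iff [near a w], below it iff [out a w]. *)
Fixpoint out (a : 'I_120) (w : seq 'I_120) : bool :=
  if w is s :: w' then if adj a s then out a w' else s != a else false.

Lemma near_rcons a w s : near a (rcons w s) = adj a s && near a w.
Proof. exact: all_rcons. Qed.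

Lemma out_rcons a w s :
  out a (rcons w s) = out a w || [&& near a w, ~~ adj a s & s != a].
Proof.
elim: w => [|t w IH] /=; first by case: (adj a s).
by case: (adj a t) => //=; rewrite orbF.
Qed.

Lemma near_outN a w : near a w -> ~~ out a w.
Proof. by elim: w => //= s w IH /andP[-> /IH]. Qed.

Lemma near_split a w : ~~ near a w -> exists u s v,
  [/\ w = u ++ s :: v, near a u, ~~ adj a s & out a w = (s != a)].
Proof.
elim: w => //= t w IH; case: (boolP (adj a t)) => [at_|nat_] /=; last first.
  by move=> _; exists [::], t, w.
move=> /IH[u [s [v [-> nu nas ->]]]]; exists (t :: u), s, v.
by rewrite /= at_.
Qed.

(** * Half-spaces, corners and centres at a vertex *)

Section Cubes.
Variable R : realType.
Local Notation B := (@minkowski R).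
Local Notation phi := (phi R).
Local Notation wall := (wall R).
Local Notation corner0 := (corner0 R).
Implicit Types (w : seq 'I_120) (D U T tau : {set 'I_120}) (x y : point R).

(** Every letter of a reduced continuation adds a nonpositive amount to the product with [y]. *)
Lemma chamber_inv_mono c D y v : 0 <= c -> chamber_inv c D y -> reduced_from D v ->
  B (act v corner0) y <= B corner0 y.
Proof.
move=> c0 inv; elim/last_ind: v => [//|v s IH].
rewrite -cats1 reduced_from_cat /= andbT => /andP[rv sD].
have [_ /(_ _ sD) h _] := chamber_inv_word c0 inv rv.
by rewrite cats1 vertex_rcons; apply: le_trans (IH rv); lra.
Qed.

Lemma act_near a w : near a w -> act w (wall a) = wall a.
Proof.
elim: w => //= s w IH /andP[as_ /IH nw].
rewrite -[act _ _]/(reflection (wall s) (act w (wall a))) nw.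
by rewrite reflection_fix ?wall_adj.
Qed.

Lemma act_rev_near a w : near a w -> act (rev w) (wall a) = wall a.
Proof. by move=> nw; apply: act_near; rewrite /near all_rev. Qed.

Lemma vertex_near a w : near a w -> B (act w corner0) (wall a) = -1.
Proof. by move=> nw; rewrite act_mkV act_rev_near // mkC wall_corner. Qed.

Lemma near_descents a u s : near a u -> s \in descents u -> adj a s.
Proof.
elim/last_ind: u s => [|u t IH] s; first by rewrite inE.
rewrite near_rcons descents_rcons in_dstep => /andP[at_ nu].
by case/orP=> [/eqP->//|/andP[sD _]]; apply: IH.
Qed.

Lemma chamber_inv_in a u : near a u ->
  chamber_inv 0 (dstep (descents u) a) (wall a).
Proof.
move=> nu; have inD s : s \in dstep (descents u) a -> s = a \/ adj s a.
  rewrite in_dstep => /orP[/eqP->|/andP[_ as_]]; first by left.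
  by right; rewrite adj_sym.
split=> [s /inD[->|sa]|s|s t st nst].
- by rewrite wall_norm.
- by rewrite wall_adj.
- rewrite in_dstep negb_or oppr0 => /andP[sa _].
  exact: wall_le0.
- rewrite mulr0 oppr0; case: (eqVneq s a) => [sa|sa].
    have := wall_nonadj R st nst; rewrite sa wall_norm mkC; lra.
  case: (eqVneq t a) => [ta|ta].
    have := wall_nonadj R st nst; rewrite ta wall_norm; lra.
  by have := wall_le0 R sa; have := wall_le0 R ta; lra.
Qed.

(** Past a first letter [s] that neither equals nor commutes with [a], the wall [a] appears
    reflected in [s]. As the two walls have product at most -1, the reflection leaves no positive
    product with any wall other than [s]. *)
Lemma chamber_inv_out a u s : near a u -> ~~ adj a s -> s != a ->
  chamber_inv 0 (dstep (descents u) s) (reflection (wall s) (wall a)).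
Proof.
move=> nu nas sa; have asB : B (wall a) (wall s) <= -1 by rewrite wall_nonadj // eq_sym.
have [k kE] : exists k, B (wall a) (wall s) = - k by exists (- B (wall a) (wall s)); rewrite opprK.
have k1 : 1 <= k by move: asB; rewrite kE; lra.
have E t : B (wall t) (reflection (wall s) (wall a)) =
    B (wall t) (wall a) + 2 * k * B (wall t) (wall s).
  by rewrite reflection_wall !mkE kE; ring.
have Es : B (wall s) (reflection (wall s) (wall a)) = k.
  by rewrite E wall_norm mkC kE; ring.
have le t : t != s -> B (wall t) (reflection (wall s) (wall a)) <= B (wall t) (wall a).
  move=> ts; rewrite E gerDl mulr_ge0_le0 ?wall_le0 //.
  by rewrite mulr_ge0 //; lra.
have inD t : t \in descents u -> B (wall t) (wall a) = 0.
  by move=> /(near_descents nu) at_; rewrite mkC wall_adj.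
have le0 t : t != s -> B (wall t) (reflection (wall s) (wall a)) <= 0.
  move=> ts; case: (eqVneq t a) => [->|ta]; last first.
    by apply: le_trans (le t ts) (wall_le0 R ta).
  by rewrite E wall_norm kE; nra.
split=> [t|t|t t' tt' ntt'].
- rewrite in_dstep => /orP[/eqP->|/andP[tD st]]; first by rewrite Es; lra.
  by rewrite E inD // (@wall_adj R t s) ?mulr0 ?addr0 // adj_sym.
- by rewrite in_dstep negb_or oppr0 => /andP[ts _]; apply: le0.
- rewrite mulr0 oppr0; wlog: t t' tt' ntt' / t' != s.
    move=> H; case: (eqVneq t' s) => [t's|]; last exact: H.
    by rewrite addrC H // ?(eq_sym t') // ?(adj_sym t') // -t's.
  move=> t's; case: (eqVneq t s) => [ts|ts]; last first.
    by have := le0 t ts; have := le0 t' t's; lra.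
  subst t; rewrite Es E; have h : B (wall t') (wall s) <= -1.
    by apply: wall_nonadj; rewrite // adj_sym.
  have h2 : k * (B (wall t') (wall s) + 1) <= 0 by apply: mulr_ge0_le0; lra.
  rewrite mulrDr mulr1 in h2; rewrite -mulrA.
  case: (eqVneq t' a) => [t'a|t'a].
    by rewrite t'a wall_norm kE; nra.
  by have := wall_le0 R t'a; lra.
Qed.

(** The prefix commuting with [a] fixes the wall, so only the first other letter [s] and the rest
    count. If [s] is [a], the wall changes sign; otherwise its product with [corner0] falls to at
    most -3. By [chamber_inv_mono] the rest of the word only moves further the same way. *)
Lemma vertex_wall a w : reduced w ->
  (out a w -> B (act w corner0) (wall a) <= -3) /\
  (~~ near a w -> ~~ out a w -> 1 <= B (act w corner0) (wall a)).
Proof.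
move=> rw; case: (boolP (near a w)) => [nw|].
  by rewrite (negPf (near_outN nw)).
move=> /near_split[u [s [v [wE nu nas ->]]]].
have : reduced_from (dstep (descents u) s) v.
  by move: rw; rewrite wE /reduced reduced_from_cat /= => /and3P[].
have E : B (act w corner0) (wall a) =
    B (act v corner0) (reflection (wall s) (wall a)).
  by rewrite wE -cat1s catA act_cat act_mkV rev_cat act_cat act_rev_near.
rewrite E; split=> [sa|_]; last first.
  rewrite negbK => /eqP sa; subst s.
  have -> : reflection (wall a) (wall a) = - wall a.
    rewrite reflection_wall wall_norm mulr1 -[X in X - _]scale1r -scalerBl.
    by rewrite (_ : 1 - 2 = -1) ?scaleN1r //; ring.
  have := chamber_inv_mono (lexx 0) (chamber_inv_in nu) H.
  by rewrite mkNr (mkC corner0) wall_corner; lra.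
have := chamber_inv_mono (lexx 0) (chamber_inv_out nu nas sa) H.
have -> : B corner0 (reflection (wall s) (wall a)) = -1 + 2 * B (wall a) (wall s).
  by rewrite mkC reflection_wall !mkE !wall_corner; ring.
have as_ : a != s by rewrite eq_sym.
by have := wall_nonadj R as_ nas; lra.
Qed.

(** The walls of a clique are orthogonal, so the product of their reflections adds twice their sum
    to [corner0]. The subsets of a tetrahedron give the sixteen vertices of a hypercube. *)
Definition corner tau : point R := corner0 + 2 *: \sum_(s in tau) wall s.

Lemma cornerE tau : corner tau = corner0 + 2 *: \sum_(s in tau) wall s.
Proof. by []. Qed.

Lemma corner_set0 : corner set0 = corner0.
Proof. by rewrite /corner big_set0 scaler0 addr0. Qed.

Lemma mk_wall_sum tau s : clique tau -> s \in tau ->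
  B (wall s) (\sum_(t in tau) wall t) = 1.
Proof.
move=> /cliqueP ct st; rewrite mk_sumr (bigD1 s) //= wall_norm big1 ?addr0 //.
by move=> t /andP[tt ts]; apply: wall_adj; apply: ct; rewrite // eq_sym.
Qed.

Lemma mk_wall_sum_nbs tau s : s \in nbs tau ->
  B (wall s) (\sum_(t in tau) wall t) = 0.
Proof.
move=> /nbsP sn; rewrite mk_sumr big1 // => t /sn ts.
by rewrite wall_adj // adj_sym.
Qed.

Lemma mk_wall_sum_le0 tau s : s \notin tau ->
  B (wall s) (\sum_(t in tau) wall t) <= 0.
Proof.
move=> st; rewrite mk_sumr -oppr_ge0 -sumrN sumr_ge0 // => t tt.
by rewrite oppr_ge0 wall_le0 //; apply: contraNneq st => ->.
Qed.

Lemma reflection_corner U tau s : clique U -> s \in U -> tau \subset U ->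
  reflection (wall s) (corner tau) =
  corner (if s \in tau then tau :\ s else s |: tau).
Proof.
move=> cU sU tU; rewrite reflection_wall mkC /corner mkDr wall_corner mkZr.
have ct := cliqueS tU cU.
case: ifPn => st.
  rewrite mk_wall_sum // (big_setD1 s) //= -addrA; congr (_ + _).
  have -> : 2 * (-1 + 2 * 1) = 2 :> R by ring.
  by rewrite scalerDr addrAC subrr add0r.
rewrite mk_wall_sum_nbs; last first.
  by apply: clique_nbs st; apply: cliqueS cU; rewrite subUset sub1set sU.
rewrite big_setU1 //= mulr0 addr0 mulrN1 scaleNr opprK scalerDr -addrA.
by congr (corner0 + _); rewrite addrC.
Qed.

Lemma act_clique_word (l : seq 'I_120) : uniq l ->
    (forall i j, i \in l -> j \in l -> i != j -> adj i j) ->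
  act l corner0 = corner [set x in l].
Proof.
elim: l => [|s l IH] /=; first by move=> _ _; rewrite set_nil corner_set0.
move=> /andP[sl Ul] adjl.
rewrite -[act _ _]/(reflection (wall s) (act l corner0)) IH //; last first.
  by move=> x y xl yl; apply: adjl; rewrite inE ?xl ?yl orbT.
have cU : clique [set x in s :: l].
  by apply/cliqueP => x y; rewrite [x \in _]inE [y \in _]inE; apply: adjl.
rewrite (reflection_corner cU) ?inE ?eqxx // ?(negPf sl) ?set_cons //.
by apply/fintype.subsetP => x; rewrite !inE => ->; rewrite orbT.
Qed.

Lemma act_enum tau : clique tau -> act (enum tau) corner0 = corner tau.
Proof.
move=> /cliqueP ct; rewrite act_clique_word ?enum_uniq //.
  by congr corner; apply/setP => x; rewrite !inE mem_enum.
by move=> x y; rewrite !mem_enum; apply: ct.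
Qed.

Lemma reduced_enum w tau : reduced w -> clique tau -> [disjoint tau & descents w] ->
  reduced (w ++ enum tau) /\
  descents (w ++ enum tau) = tau :|: (descents w :&: nbs tau).
Proof.
move=> rw /cliqueP ct dt.
have [||x|rl E] := @reduced_from_clique (descents w) (enum tau).
- exact: enum_uniq.
- by move=> x y; rewrite !mem_enum; apply: ct.
- by rewrite mem_enum => xt; rewrite (disjointFr dt xt).
rewrite /reduced reduced_from_cat -/reduced -/(descents w) rl andbT rw; split=> //.
rewrite /descents foldl_cat E; apply/setP => t; rewrite !inE mem_enum.
congr (_ || (_ && _)); apply/allP/forall_inP => H x.
  by move=> xt; apply: H; rewrite mem_enum.
by rewrite mem_enum; apply: H.
Qed.

(** Half the sum of the opposite vertices [corner0] and [corner T]. The vector points to the centre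
    of the hypercube and is not scaled to the hyperboloid. *)
Definition ctr T : point R := corner0 + \sum_(s in T) wall s.

Lemma mk_wall_ctr T s : clique T -> s \in T -> B (wall s) (ctr T) = 0.
Proof. by move=> cT sT; rewrite mkDr wall_corner mk_wall_sum // addNr. Qed.

Lemma mk_wall_ctr_lt0 T s : s \notin T -> B (wall s) (ctr T) <= -1.
Proof. by move=> sT; rewrite mkDr wall_corner; have := mk_wall_sum_le0 sT; lra. Qed.

Lemma mk_corner0_ctr T : tet T -> B corner0 (ctr T) = - (1 + 2 * phi).
Proof.
move=> tT; rewrite mkDr corner_norm mk_sumr.
rewrite (eq_bigr (fun _ => -1)) => [|s _]; last by rewrite mkC wall_corner.
by rewrite sumr_const (tet_card tT); lra.
Qed.

Lemma mk_corner_ctr T tau : clique T -> tau \subset T ->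
  B (corner tau) (ctr T) = B corner0 (ctr T).
Proof.
move=> cT /fintype.subsetP tT; rewrite mkDl mkZl mk_suml big1 ?mulr0 ?addr0 // => s /tT sT.
exact: mk_wall_ctr.
Qed.

Lemma chamber_inv_ctr T : clique T -> chamber_inv 0 set0 (ctr T).
Proof.
move=> cT; have le0 s : B (wall s) (ctr T) <= 0.
  case: (boolP (s \in T)) => [/(mk_wall_ctr cT)->//|/mk_wall_ctr_lt0]; lra.
split=> [s|s _|s t _ _]; first by rewrite inE.
  by rewrite oppr0.
by have := le0 s; have := le0 t; lra.
Qed.

Lemma act_ctr T w : clique T -> all (mem T) w -> act w (ctr T) = ctr T.
Proof.
move=> cT; elim: w => //= s w IH /andP[sT /IH E].
rewrite -[act _ _]/(reflection (wall s) (act w (ctr T))) E.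
by rewrite reflection_fix // mkC mk_wall_ctr.
Qed.

Lemma act_letters T w : clique T -> all (mem T) w ->
  exists2 tau : {set 'I_120}, tau \subset T & act w corner0 = corner tau.
Proof.
move=> cT; elim: w => [_|s w IH /= /andP[sT /IH[tau tT E]]].
  by exists set0; rewrite ?sub0set ?corner_set0.
rewrite -[act _ _]/(reflection (wall s) (act w corner0)) E.
rewrite (reflection_corner cT) //.
exists (if s \in tau then tau :\ s else s |: tau) => //.
case: ifP => _; first by apply: subset_trans tT; apply: subsetDl.
by rewrite subUset sub1set sT.
Qed.

(** Letters in [T] fix the centre; the first letter outside [T] lowers the product by at least 2,
    and no letter raises it. A larger product means a smaller distance, so the vertices of a
    hypercube are the ones nearest to its centre. *)
Lemma ctr_le T w : clique T -> reduced w ->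
  B (act w corner0) (ctr T) < B corner0 (ctr T) \/ all (mem T) w.
Proof.
move=> cT; elim/last_ind: w => [|w s IH]; first by right.
rewrite reduced_rcons => /andP[rw sD].
have [_ /(_ _ sD) h _] := chamber_inv_word (lexx 0) (chamber_inv_ctr cT) rw.
rewrite oppr0 in h; rewrite vertex_rcons.
have [lt|wT] := IH rw; first by left; lra.
case: (boolP (s \in T)) => sT; first by right; rewrite all_rcons wT andbT.
left; have rwT : all (mem T) (rev w) by rewrite all_rev.
rewrite (act_ctr cT rwT); have := mk_wall_ctr_lt0 sT.
by have := chamber_inv_mono (lexx 0) (chamber_inv_ctr cT) rw; lra.
Qed.

Lemma wall_in_corner tau s : corner [set s] = corner tau -> clique tau -> s \in tau.
Proof.
move=> E ct; apply: contraT => st; have := congr1 (B (wall s)) E.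
rewrite /corner !mkDr !mkZr big_set1 wall_norm; have := mk_wall_sum_le0 st; lra.
Qed.

End Cubes.

(** * Connectivity of links and of tetrahedra under flips *)

Lemma adj_set1U (U : {set 'I_120}) x y : x \in nbs U -> adj x y -> y \in nbs U ->
  y \in nbs (x |: U).
Proof. by move=> xU xy yU; rewrite nbsU1 xy. Qed.

(** The common neighbours of two, one or no letters form a pentagon, an icosahedron or the whole
    600-cell graph. *)
Lemma nbs_connected (U : {set 'I_120}) (Y : pred 'I_120) x0 :
    clique U -> (#|U| <= 2)%N -> x0 \in nbs U -> Y x0 ->
    (forall x y, x \in nbs U -> y \in nbs U -> Y x -> adj x y -> Y y) ->
  forall x, x \in nbs U -> Y x.
Proof.
move=> cU; rewrite leq_eqVlt ltnS leq_eqVlt ltnS leqn0.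
move=> /orP[/cards2P[a [b [ab UE]]]|/orP[/cards1P[a ->]|]].
- have adjab : adj a b by apply: (cliqueP _ cU); rewrite // UE !inE eqxx ?orbT.
  have inU x : (x \in nbs U) = adj a x && adj b x by rewrite UE nbsU1 nbs1.
  move=> x0U Y0 hY; have cx0 : clique (x0 |: U) := cliqueU1 cU x0U.
  have [N _] := card_nbs cx0.
  rewrite cardsU1 (nbs_notin x0U) UE cards2 ab /= -UE in N.
  have /card_gt0P[q] : (0 < #|nbs (x0 |: U)|)%N by rewrite N.
  rewrite nbsU1 inU => /andP[x0q /andP[aq bq]].
  move: (x0U); rewrite inU => /andP[ax0 bx0].
  have [r [s [t [_ inR [qr rs st tp]]]]] := ring_adj adjab ax0 bx0 aq bq x0q.
  have iU x : x \in [:: x0; q; r; s; t] -> x \in nbs U by rewrite inU inR.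
  have step x y : x \in [:: x0; q; r; s; t] -> y \in [:: x0; q; r; s; t] ->
      adj x y -> Y x -> Y y.
    by move=> xR yR xy Yx; apply: (hY x y) => //; apply: iU.
  have Yq : Y q by apply: (step x0) Y0; rewrite ?inE ?eqxx ?orbT.
  have Yr : Y r by apply: (step q) Yq; rewrite ?inE ?eqxx ?orbT.
  have Ys : Y s by apply: (step r) Yr; rewrite ?inE ?eqxx ?orbT.
  have Yt : Y t by apply: (step s) Ys; rewrite ?inE ?eqxx ?orbT.
  move=> x; rewrite inU inR !inE.
  by case/or4P=> [|||/orP[]] /eqP->.
- rewrite nbs1 => ax0 Y0 hY x; rewrite nbs1.
  apply: link_connected ax0 Y0 _ _ => y z ay az; apply: hY; by rewrite nbs1.
- rewrite cards_eq0 => /eqP->; rewrite nbs0 => _ Y0 hY x _.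
  by apply: adj_connected Y0 _ x => y z Yy; apply: hY; rewrite ?in_setT.
Qed.

Lemma card_setD (U T : {set 'I_120}) : U \subset T -> (#|U| < #|T|)%N ->
  exists2 v, v \in T & v \notin U.
Proof.
move=> UT lt; have /set0Pn[v] : T :\: U != set0.
  by rewrite -card_gt0 cardsD (setIidPr UT) subn_gt0.
by rewrite inE => /andP[vU vT]; exists v.
Qed.

Lemma tet_sub_nbs (U T : {set 'I_120}) v : tet T -> U \subset T -> v \in T ->
  v \notin U -> v \in nbs U.
Proof.
move=> tT UT vT; apply: clique_nbs; apply: cliqueS (tet_clique tT).
by rewrite subUset sub1set vT.
Qed.

Lemma tet_3sub (U T : {set 'I_120}) : tet T -> U \subset T -> #|U| = 3%N ->
  exists2 s, s \in T & U = T :\ s.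
Proof.
move=> tT UT U3; have [|s sT sU] := card_setD UT; first by rewrite U3 tet_card.
exists s => //; apply/eqP; rewrite eqEcard U3 subsetD1 UT sU /=.
by rewrite tet_cardD1.
Qed.

(** Induction on the number of letters not yet shared by the two tetrahedra. With three common
    letters a single flip is enough; with fewer, one goes through the connected graph of common
    neighbours of the shared letters. *)
Lemma tets_flip_connected (Z : {set 'I_120} -> Prop) :
    (forall T s s', Z T -> tet T -> s \in T -> s' != s -> s' \in nbs (T :\ s) ->
      Z (s' |: T :\ s)) ->
  forall T0, tet T0 -> Z T0 -> forall T, tet T -> Z T.
Proof.
move=> hZ; suff H n (U : {set 'I_120}) : (#|U| + n = 4)%N -> forall T0 T : {set 'I_120}, U \subset T0 ->
    U \subset T -> tet T0 -> tet T -> Z T0 -> Z T.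
  move=> T0 t0 z0 T tT.
  by apply: (H 4%N set0 _ T0); rewrite ?cards0 ?sub0set.
elim: n U => [|n IH] U.
  rewrite addn0 => U4 T0 T UT0 UT t0 tT.
  have tU : tet U by rewrite /tet U4 eqxx andbT (cliqueS UT) ?tet_clique.
  by rewrite -(tet_sub_eq tU t0 UT0) (tet_sub_eq tU tT UT).
move=> Un T0 T UT0 UT t0 tT z0; have cU := cliqueS UT (tet_clique tT).
case: n IH Un => [|n] IH Un.
  have U3 : #|U| = 3%N by move: Un; rewrite addn1 => -[].
  have [s sT0 UE] := tet_3sub t0 UT0 U3.
  have [s2 s2T UE2] := tet_3sub tT UT U3.
  have s2N : s2 \in nbs (T0 :\ s).
    by rewrite -UE UE2 clique_nbs ?setD11 // setD1K ?tet_clique.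
  case: (eqVneq s2 s) => [E|ne].
    by rewrite -(setD1K s2T) -UE2 UE E setD1K.
  by rewrite -(setD1K s2T) -UE2 UE; apply: hZ.
have U2 : (#|U| <= 2)%N by move: Un; move: #|U| => m; lia.
have [v vT vU] : exists2 v, v \in T & v \notin U.
  by apply: card_setD; rewrite // (tet_card tT); apply: leq_ltn_trans U2 _.
have [v0 vT0 vU0] : exists2 v, v \in T0 & v \notin U.
  by apply: card_setD; rewrite // (tet_card t0); apply: leq_ltn_trans U2 _.
(* The property passes from [x] to an adjacent [y] through a tetrahedron containing both, where the
   induction hypothesis applies with [y] added to [U]. *)
pose Y v := `[< forall T : {set 'I_120}, U \subset T -> v \in T -> tet T -> Z T >].
have cardU x : x \in nbs U -> (#|x |: U| + n.+1 = 4)%N.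
  by move=> xU; rewrite cardsU1 (nbs_notin xU) add1n addSnnS.
have sub x (T' : {set 'I_120}) : U \subset T' -> x \in T' -> x |: U \subset T'.
  by move=> UT' xT'; rewrite subUset sub1set xT'.
have : Y v.
  apply: (nbs_connected cU U2 (tet_sub_nbs t0 UT0 vT0 vU0)).
  - apply/asboolP => T1 UT1 v1 t1.
    apply: (IH (v0 |: U) _ T0 T1) => //; try exact: sub.
    exact/cardU/(tet_sub_nbs t0).
  - move=> x y xU yU /asboolP Yx xy; apply/asboolP => T1 UT1 yT1 t1.
    have [T2 t2] := tet_extend (cliqueU1 (cliqueU1 cU xU) (adj_set1U xU xy yU)).
    rewrite !subUset !sub1set => /andP[yT2 /andP[xT2 UT2]].
    apply: (IH (y |: U) _ T2 T1) => //; try exact: sub; first exact: cardU.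
    exact: Yx.
  - exact: tet_sub_nbs vT vU.
by move/asboolP; apply.
Qed.

Definition cell0 : {set 'I_120} := [set base i | i : 'I_4].

Lemma mem_codom_set (s : 'I_4 -> 'I_120) i : s i \in [set s i | i : 'I_4].
Proof. exact: imset_f. Qed.

Lemma base_inj : injective base.
Proof. by move=> i j /(congr1 val) /= /ord_inj. Qed.

(** * Symmetries and faces of the mosaic *)

Section Frames.
Variable R : realType.
Local Notation B := (@minkowski R).
Local Notation phi := (phi R).
Local Notation wall := (wall R).
Local Notation corner0 := (corner0 R).
Local Notation fn := (facet_normal R).
Implicit Types (w : seq 'I_120) (U T tau : {set 'I_120}).

Lemma base_gram i j : B (wall (base i)) (wall (base j)) = (i == j)%:R.
Proof.
rewrite !wall_base mkNl mkNr opprK mk_coord !row_mxEl !row_mxEr !mxE.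
case: i j => [[|[|[|[|i]]]] hi] [[|[|[|[|j]]]] hj] //=; ring.
Qed.

Lemma adj_gram i j : B (wall i) (wall j) = 0 -> adj i j.
Proof.
move=> E; apply: contraT => nij; case: (eqVneq i j) => [ij|/(wall_nonadj R)/(_ nij)].
  by move: E; rewrite ij wall_norm => /eqP; rewrite oner_eq0.
rewrite E; lra.
Qed.

(** A symmetry fixing [corner0] that carries the base walls to the walls [s i], and so the base
    hypercube to another hypercube at the same vertex. *)
Definition frame (fs : seq ('I_4 * bool)) (s : 'I_4 -> 'I_120) : Prop :=
  refls [seq fn f.1 f.2 | f <- fs] corner0 = corner0 /\
  forall i, refls [seq fn f.1 f.2 | f <- fs] (wall (base i)) = wall (s i).

Lemma facet_normal_norm i b : B (fn i b) (fn i b) = 2.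
Proof.
rewrite mk_coord /facet_normal !row_mxEl !row_mxEr !mxE.
have E : ((-1) ^+ b * phi) * ((-1) ^+ b * phi) = phi + 1.
  by rewrite mulrACA -expr2 sqrr_sign mul1r phi_sqr.
case: i => [[|[|[|[|i]]]] hi] //=; rewrite E; ring.
Qed.

Lemma spacelike_facets (fs : seq ('I_4 * bool)) : spacelike [seq fn f.1 f.2 | f <- fs].
Proof. by apply/allP => _ /mapP[f _ ->]; rewrite facet_normal_norm. Qed.

Lemma point_ext (x y : point R) : (forall i, x 0 (lshift 1 i) = y 0 (lshift 1 i)) ->
  x 0 (rshift 4 0) = y 0 (rshift 4 0) -> x = y.
Proof.
move=> hs ht; apply/rowP => j; case: (splitP j) => k jk.
  by rewrite (_ : j = lshift 1 k) //; apply: val_inj.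
by rewrite (_ : j = rshift 4 0) //; apply: val_inj; rewrite /= jk ord1.
Qed.

Lemma wall_base_space i j : wall (base i) 0 (lshift 1 j) = - (i == j)%:R.
Proof. by rewrite wall_base mxE row_mxEl mxE eqxx /= eq_sym. Qed.

Lemma wall_base_time i : wall (base i) 0 (rshift 4 0) = 0.
Proof. by rewrite wall_base mxE row_mxEr mxE oppr0. Qed.

Lemma ctr_cell0 : ctr R cell0 = row_mx 0 (const_mx (phi ^+ 2)).
Proof.
rewrite /ctr big_imset /=; last by move=> i j _ _; apply: base_inj.
apply: point_ext => [k|]; rewrite [LHS]mxE summxE.
  rewrite row_mxEl (bigD1 k) //= wall_base_space eqxx big1 => [|i ik]; last first.
    by rewrite wall_base_space (negPf ik) oppr0.
  by rewrite addr0 corner0_space subrr mxE.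
rewrite row_mxEr big1 => [|i _]; last exact: wall_base_time.
by rewrite addr0 corner0_time mxE.
Qed.

(** The coefficient 2 - phi is the inverse of phi^2, the time coordinate of the centre of the base
    hypercube. *)
Lemma facet_normalE i b :
  fn i b = (2 - phi) *: ctr R cell0 - ((-1) ^+ b * phi) *: wall (base i).
Proof.
rewrite ctr_cell0 wall_base scalerN opprK scale_row_mx scaler0.
rewrite scale_row_mx scaler0 add_row_mx add0r addr0 /facet_normal; congr row_mx.
  apply/rowP => j; rewrite !mxE eqxx /= eq_sym.
  by case: eqP => _; rewrite ?mulr1 ?mulr0.
apply/rowP => j; rewrite !mxE.
by rewrite expr2 phi_sqr mulrBl !mulrDr phi_sqr; ring.
Qed.

Lemma cell0_clique : clique cell0.
Proof.
apply/cliqueP => _ _ /imsetP[i _ ->] /imsetP[j _ ->] ij.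
by apply: adj_gram; rewrite base_gram -(inj_eq base_inj) (negPf ij).
Qed.

Lemma cell0_tet : tet cell0.
Proof. by rewrite /tet cell0_clique card_imset ?card_ord //; apply: base_inj. Qed.

Lemma base_cell0 i : base i \in cell0.
Proof. exact: imset_f. Qed.

Lemma facet_normal_corner0 i : B corner0 (fn i false) = 0.
Proof.
rewrite facet_normalE mkBr !mkZr mk_corner0_ctr ?cell0_tet // mkC wall_corner.
rewrite expr0 mul1r (_ : _ - _ = 2 * (phi * phi) - 2 * phi - 2); last by ring.
by rewrite phi_sqr; ring.
Qed.

Lemma facet_normal_base i j b :
  B (wall (base i)) (fn j b) = - ((-1) ^+ b * phi * (i == j)%:R).
Proof.
rewrite facet_normalE mkBr !mkZr mk_wall_ctr ?cell0_clique ?base_cell0 //.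
by rewrite mulr0 sub0r base_gram.
Qed.

Lemma sign_facet i j b :
  reflection (wall (base i)) (fn j b) = fn j (b (+) (i == j)).
Proof.
rewrite reflection_wall mkC facet_normal_base !facet_normalE -addrA; congr (_ + _).
case: (eqVneq i j) => [->|_]; last by rewrite !mulr0 oppr0 mulr0 scale0r subr0 addbF.
rewrite mulr1 -!scaleNr -scalerDl; congr (_ *: _).
by case: b; rewrite ?expr0 ?expr1; ring.
Qed.

(** In the form of [wall_flip]: the facet through [corner0] sends the base wall to the wall of the
    opposite apex. *)
Lemma reflection_facet_base i :
  reflection (fn i false) (wall (base i)) =
  (phi - 1) *: (corner0 + \sum_(j | j != i) wall (base j)) - wall (base i).
Proof.
rewrite /reflection facet_normal_norm facet_normal_base eqxx expr0 mul1r mulr1.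
rewrite facet_normalE expr0 mul1r.
have -> : ctr R cell0 = corner0 + \sum_(j | j != i) wall (base j) + wall (base i).
  rewrite /ctr big_imset /=; last by move=> j k _ _; apply: base_inj.
  by rewrite (bigD1 i) //= addrA addrAC.
move: (corner0 + \sum_(j | _) _) => c.
have -> : 2 * - phi / 2 = - phi :> R by field.
rewrite scaleNr opprK.
rewrite scalerBr !scalerA scalerDr phi_sqr.
have -> : phi * (2 - phi) = phi - 1 by rewrite mulrBr phi_sqr; ring.
rewrite -[_ + _ - _]addrA [LHS]addrCA; congr (_ + _).
rewrite -scalerBl -[X in X + _]scale1r -scalerDl.
have -> : 1 + (phi - 1 - (phi + 1)) = -1 by ring.
by rewrite scaleN1r.
Qed.

Lemma frame_inj fs s : frame fs s -> injective s.
Proof.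
move=> [_ h] i j /(congr1 wall); rewrite -!h => /(refls_inj (spacelike_facets fs)) E.
have := base_gram i j; rewrite E base_gram eqxx => /eqP.
by case: (eqVneq i j) => // _; rewrite mulr0n oner_eq0.
Qed.

Lemma frame_tet fs s : frame fs s -> tet [set s i | i : 'I_4].
Proof.
move=> fr; rewrite /tet card_imset ?card_ord; last exact: frame_inj fr.
rewrite eqxx andbT; apply/cliqueP => _ _ /imsetP[i _ ->] /imsetP[j _ ->] ij.
rewrite (inj_eq (frame_inj fr)) in ij; case: fr => _ h.
by apply: adj_gram; rewrite -!h refls_mk ?spacelike_facets // base_gram (negPf ij).
Qed.

Lemma frame_rcons fs s i s' : frame fs s -> s' != s i ->
    s' \in nbs ([set s i | i : 'I_4] :\ s i) ->
  frame (rcons fs (i, false)) (fun j => if j == i then s' else s j).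
Proof.
move=> fr s's s'N; have tT := frame_tet fr; have inj := frame_inj fr.
case: (fr) => [f0 f1].
rewrite /frame map_rcons -cats1 refls_cat /= reflection_fix ?facet_normal_corner0 //.
split=> // j; rewrite refls_cat /=; case: eqP => [->|/eqP ji]; last first.
  by rewrite reflection_fix ?f1 // facet_normal_base (negPf ji) mulr0 oppr0.
rewrite reflection_facet_base reflsB reflsZ reflsD f0 f1 refls_sum.
under eq_bigr do rewrite f1.
have := wall_flip R tT (mem_codom_set s i) s's s'N.
rewrite (_ : \sum_(t in _) _ = \sum_(j | j != i) wall (s j)).
  by move=> <-; rewrite addrAC subrr add0r.
rewrite (_ : _ :\ s i = [set s j | j in [pred j | j != i]]); last first.
  apply/setP => t; rewrite !inE; apply/andP/imsetP.
    move=> [ts /imsetP[k _ tE]]; exists k => //.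
    by rewrite inE; apply: contraNneq ts => <-; rewrite tE.
  move=> [k]; rewrite inE => ki ->; rewrite (inj_eq inj) ki; split=> //.
  exact: imset_f.
by rewrite big_imset //= => ? ? _ _; apply: inj.
Qed.

Lemma frame_exists T : tet T -> exists fs s, frame fs s /\ T = [set s i | i : 'I_4].
Proof.
pose Z (T : {set 'I_120}) := exists fs s, frame fs s /\ T = [set s i | i : 'I_4].
apply: (@tets_flip_connected Z _ cell0 cell0_tet); last first.
  by exists [::], base; split=> //; split.
move=> {}T s s' [fs [f [fr ->]]] tT /imsetP[i _ ->] s's s'N.
exists (rcons fs (i, false)), (fun j => if j == i then s' else f j).
split; first exact: frame_rcons.
apply/setP => t; rewrite !inE; apply/idP/imsetP.
  case/orP=> [/eqP->|/andP[ts /imsetP[k _ tE]]]; first by exists i; rewrite ?eqxx.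
  by exists k => //; case: eqVneq => // ki; move: ts; rewrite tE ki eqxx.
move=> [k _ ->]; case: (eqVneq k i) => [_|ki]; first by rewrite eqxx.
by rewrite (inj_eq (frame_inj fr)) ki imset_f ?orbT.
Qed.

Lemma frame_through t : exists fs s i, frame fs s /\ s i = t.
Proof.
have [T tT] := tet_extend (clique1 t); rewrite sub1set => tinT.
have [fs [s [fr TE]]] := frame_exists tT.
by move: tinT; rewrite TE => /imsetP[i _ ->]; exists fs, s, i.
Qed.

(* The reflections generating the symmetries of the mosaic that matter here:
   facet reflections and sign changes of the base hypercube. *)
Definition cube_mirror (u : point R) : Prop :=
  (exists i b, u = fn i b) \/ (exists i, u = wall (base i)).

Lemma cube_mirrors_spacelike us : (forall u, u \in us -> cube_mirror u) -> spacelike us.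
Proof.
move=> h; apply/allP => u /h[[i [b ->]]|[i ->]].
  by rewrite facet_normal_norm.
by rewrite wall_norm.
Qed.

(** A sign change of the base hypercube is conjugated by the frame to a wall and adds a letter. A
    facet through [corner0] extends the frame. The opposite facet is its conjugate by a sign change
    and does both, adding two letters. *)
Lemma mirrors_frame us : (forall u, u \in us -> cube_mirror u) ->
  exists w fs s, frame fs s /\
    refls us =1 (fun x => act w (refls [seq fn f.1 f.2 | f <- fs] x)).
Proof.
elim/last_ind: us => [_|us u IH h].
  by exists [::], [::], base; split.
have [w [fs [s [fr E]]]] := IH (fun v vus => h v ltac:(by rewrite mem_rcons inE vus orbT)).
have conj i x : refls [seq fn f.1 f.2 | f <- fs] (reflection (wall (base i)) x) =
    reflection (wall (s i)) (refls [seq fn f.1 f.2 | f <- fs] x).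
  by rewrite -reflection_conj ?spacelike_facets // fr.2.
have flip i : exists s', frame (rcons fs (i, false)) s'.
  have [s' [s's _ N _]] := flip_exists (frame_tet fr) (mem_codom_set s i).
  exists (fun j => if j == i then s' else s j); apply: frame_rcons => //.
  by rewrite N !inE eqxx orbT.
have [[i [b uE]]|[i uE]] := h u ltac:(by rewrite mem_rcons inE eqxx); last first.
  exists (rcons w (s i)), fs, s; split=> // x.
  by rewrite -cats1 refls_cat E act_rcons uE /= conj.
have [s' fr'] := flip i.
case: b uE => uE; last first.
  exists w, (rcons fs (i, false)), s'; split=> // x.
  by rewrite -cats1 refls_cat E uE map_rcons -cats1 refls_cat.
exists (rcons (rcons w (s i)) (s' i)), (rcons fs (i, false)), s'; split=> // x.
have -> : u = reflection (wall (base i)) (fn i false).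
  by rewrite sign_facet eqxx uE.
have sw : spacelike [:: wall (base i)] by rewrite /= wall_norm ltr01.
rewrite -cats1 refls_cat E /=.
have -> : reflection (reflection (wall (base i)) (fn i false)) x =
    reflection (wall (base i)) (reflection (fn i false) (reflection (wall (base i)) x)).
  have := reflection_conj (fn i false) (reflection (wall (base i)) x) sw.
  by rewrite /= reflectionK ?wall_norm.
rewrite conj !act_rcons; congr (act w (reflection _ _)).
rewrite -fr'.2 reflection_conj ?spacelike_facets //.
by rewrite map_rcons -cats1 refls_cat.
Qed.

(** Each letter is the conjugate of a base wall by a frame that reaches it, so the letters are
    replaced one by one from the end. *)
Lemma word_mirrors w fs s : frame fs s -> exists us, (forall u, u \in us -> cube_mirror u) /\
  (fun x => act w (refls [seq fn f.1 f.2 | f <- fs] x)) =1 refls us.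
Proof.
have facet_ok gs u : u \in [seq fn f.1 f.2 | f <- gs] -> cube_mirror u.
  by move=> /mapP[[i b] _ ->]; left; exists i, b.
elim/last_ind: w fs s => [|w t IH] fs s fr.
  by exists [seq fn f.1 f.2 | f <- fs]; split=> // u; apply: facet_ok.
have [gs [s1 [i [fr1 <-]]]] := frame_through t.
have [us [usP E]] := IH _ _ fr1.
exists (us ++ wall (base i) :: rev [seq fn f.1 f.2 | f <- gs] ++ [seq fn f.1 f.2 | f <- fs]).
split=> [u|x].
  rewrite mem_cat inE mem_cat mem_rev => /or4P[/usP//|/eqP->|/facet_ok//|/facet_ok//].
  by right; exists i.
rewrite refls_cat -E /= refls_cat -reflection_conj ?spacelike_facets // fr1.2.
by rewrite reflsVK ?spacelike_facets // act_rcons.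
Qed.

End Frames.

Section Mosaic.
Variable R : realType.
Local Notation B := (@minkowski R).
Local Notation phi := (phi R).
Local Notation wall := (wall R).
Local Notation corner0 := (corner0 R).
Local Notation corner := (corner R).
Local Notation fn := (facet_normal R).
Local Notation facets fs := [seq fn f.1 f.2 | f <- fs].
Local Notation signs es := [seq wall (base i) | i <- es].
Implicit Types (w : seq 'I_120) (U T tau : {set 'I_120}).
Implicit Types (us : seq (point R)) (fs : seq ('I_4 * bool)) (es : seq 'I_4).
Implicit Types (c : {ffun 'I_4 -> option bool}) (e : {ffun 'I_4 -> bool}).

(** The face at the vertex [w] in the directions of the clique [U]; the isometry [us] is meant to
    bring [corner0] to the chosen origin. *)
Definition cube us w U : set (point R) :=
  [set x | exists2 tau : {set 'I_120}, tau \subset U & x = refls us (act w (corner tau))]%classic.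

Lemma act_enum_corner tau0 tau : clique (tau0 :|: tau) -> [disjoint tau0 & tau] ->
  act (enum tau0) (corner tau) = corner (tau0 :|: tau).
Proof.
move=> cU dis; have ct0 : clique tau0 := cliqueS (finset.subsetUl _ _) cU.
rewrite {1}cornerE /act reflsD reflsZ refls_sum -/(act _ _) act_enum // !cornerE.
rewrite -addrA -scalerDr; congr (_ + _ *: _).
rewrite [RHS](big_setID tau0) /=.
rewrite (setIidPr _) ?finset.subsetUl // finset.setDUl finset.setDv finset.set0U.
have -> : tau :\: tau0 = tau by apply/setDidPl; rewrite disjoint_sym.
congr (_ + _); apply: eq_bigr => t tt; apply: act_near; apply/allP => s.
rewrite mem_enum => st; apply: (cliqueP _ cU); rewrite ?inE ?tt ?st ?orbT //.
by apply: contraTneq tt => ->; rewrite (disjointFr dis).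
Qed.

Lemma cube_vertexE e :
  cube_vertex R e = corner [set base i | i in [pred i | e i]].
Proof.
rewrite !cornerE big_imset /=; last by move=> i j _ _; apply: base_inj.
apply: point_ext => [j|]; rewrite ?row_mxEl ?row_mxEr [RHS]mxE [X in _ + X]mxE summxE.
  rewrite mxE corner0_space (eq_bigr (fun i => - (i == j)%:R)) => [|i _]; last first.
    exact: wall_base_space.
  rewrite big_mkcond (bigD1 j) //= big1 => [|i ij]; last first.
    by case: ifP => // _; rewrite (negPf ij) oppr0.
  by rewrite inE eqxx; case: (e j); rewrite ?expr1 ?expr0 ?mulr1n; ring.
rewrite big1 => [|i _]; last exact: wall_base_time.
by rewrite mulr0 addr0 corner0_time mxE.
Qed.

Lemma frame_vertex fs s e : frame R fs s ->
  refls (facets fs) (cube_vertex R e) = corner [set s i | i in [pred i | e i]].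
Proof.
move=> fr; rewrite cube_vertexE !cornerE reflsD reflsZ refls_sum fr.1.
rewrite big_imset /=; last by move=> i j _ _; apply: base_inj.
rewrite big_imset /=; last by move=> i j _ _; apply: (frame_inj fr).
by congr (_ + _ *: _); apply: eq_bigr => i _; rewrite fr.2.
Qed.

(** Signs prescribed negative shift the base vertex along their letters, free signs supply the
    clique, and signs prescribed positive contribute nothing. *)
Lemma frame_face us w fs s c : frame R fs s ->
  ((fun x => refls us (act w (refls (facets fs) x))) @` cube_face c)%classic =
  cube us (w ++ enum [set s i | i in [pred i | c i == Some true]])
    [set s i | i in [pred i | c i == None]].
Proof.
move=> fr; have inj := frame_inj fr; have ct := tet_clique (frame_tet fr).
set tau0 := [set s i | i in [pred i | c i == Some true]].
set U := [set s i | i in [pred i | c i == None]].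
have key tau : tau \subset U ->
    act (w ++ enum tau0) (corner tau) = act w (corner (tau0 :|: tau)).
  move=> tU; rewrite act_cat act_enum_corner //.
    apply: cliqueS ct; rewrite finset.subUset; apply/andP; split.
      by apply/fintype.subsetP => _ /imsetP[i _ ->]; apply: mem_codom_set.
    apply: fintype.subset_trans tU _.
    by apply/fintype.subsetP => _ /imsetP[i _ ->]; apply: mem_codom_set.
  apply: disjointWr tU _; rewrite -setI_eq0; apply/eqP/finset.setP => t; rewrite !inE.
  apply/negP => /andP[/imsetP[i + ->] /imsetP[j + /inj ij]].
  by rewrite -ij !inE => /eqP->.
apply/seteqP; split=> x /=.
- move=> [_ [e ec <-] <-]; rewrite (frame_vertex _ fr) //.
  exists [set s i | i in [pred i | e i && (c i == None)]].
    apply/fintype.subsetP => _ /imsetP[i + ->]; rewrite inE => /andP[_ ci].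
    exact: imset_f.
  rewrite key; last first.
    apply/fintype.subsetP => _ /imsetP[i + ->]; rewrite inE => /andP[_ ci].
    exact: imset_f.
  congr (refls us (act w (corner _))); apply/finset.setP => t.
  rewrite finset.in_setU; apply/imsetP/orP.
    move=> [i ei ->]; rewrite inE in ei.
    case E: (c i) => [b|]; last by right; apply: imset_f; rewrite inE ei E.
    by left; apply: imset_f; rewrite inE E; rewrite (ec _ _ E) in ei; rewrite ei.
  move=> [] /imsetP[i + ->]; rewrite inE => ci; exists i => //; rewrite inE.
    by rewrite (ec _ _ (eqP ci)).
  by case/andP: ci.
- move=> [tau tU ->]; rewrite key //.
  pose e := [ffun i => (c i == Some true) || (s i \in tau)].
  have sU i : s i \in tau -> c i == None.
    by move/(fintype.subsetP tU)/imsetP=> [j + /inj->]; rewrite inE.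
  exists (cube_vertex R e).
    exists e => //= i b ci; rewrite ffunE ci.
    by case: b ci => // ci; apply/negP => /sU; rewrite ci.
  rewrite (frame_vertex _ fr) //; congr (refls us (act w (corner _))).
  apply/finset.setP => t; rewrite finset.in_setU; apply/imsetP/orP.
    move=> [i + ->]; rewrite inE ffunE => /orP[ci|]; last by right.
    by left; apply: imset_f.
  case=> [/imsetP[i + ->]|tt]; first by rewrite inE => ci; exists i; rewrite // inE ffunE ci.
  move: (fintype.subsetP tU _ tt) => /imsetP[i _ tE].
  by exists i; rewrite // inE ffunE -tE tt orbT.
Qed.

Lemma sign_vertex i e : reflection (wall (base i)) (cube_vertex R e) =
  cube_vertex R [ffun j => e j (+) (j == i)].
Proof.
rewrite !cube_vertexE (reflection_corner _ (cell0_clique R)) ?base_cell0 //; last first.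
  by apply/fintype.subsetP => _ /imsetP[j _ ->]; apply: base_cell0.
congr corner; apply/finset.setP => t.
have inE' (P : pred 'I_4) j : (base j \in [set base i | i in P]) = P j.
  by rewrite mem_imset //; apply: base_inj.
case: ifPn; rewrite inE' inE => ei.
  rewrite !inE; apply/andP/imsetP.
    move=> [ti /imsetP[j ej tE]]; exists j => //; rewrite inE ffunE.
    by case: eqP => [ji|_]; [rewrite tE ji eqxx in ti | rewrite addbF].
  move=> [j]; rewrite inE ffunE => ej ->; rewrite (inj_eq base_inj).
  case: eqP ej => [->|_]; first by rewrite ei.
  by rewrite addbF => ej; rewrite imset_f.
rewrite !inE; apply/orP/imsetP.
  case=> [/eqP->|/imsetP[j ej ->]]; first by exists i; rewrite // inE ffunE eqxx addbT.
  exists j => //; rewrite inE ffunE; case: eqP => [ji|_]; last by rewrite addbF.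
  by rewrite inE ji (negPf ei) in ej.
move=> [j]; rewrite inE ffunE => ej ->; rewrite (inj_eq base_inj).
by case: eqP ej => [->|_]; [left | rewrite addbF => ej; right; apply: imset_f].
Qed.

Lemma sign_face i c : (reflection (wall (base i)) @` cube_face c)%classic =
  cube_face [ffun j => omap (addb (j == i)) (c j)].
Proof.
have sw : 0 < B (wall (base i)) (wall (base i)) by rewrite wall_norm.
apply/seteqP; split=> x /=.
  move=> [_ [e ec <-] <-]; rewrite sign_vertex; eexists; last by [].
  move=> j b; rewrite !ffunE; case E: (c j) => [b'|] //= [<-].
  by rewrite (ec _ _ E) addbC.
move=> [e ec <-]; exists (reflection (wall (base i)) (cube_vertex R e)).
  rewrite sign_vertex; eexists; last by [].
  move=> j b cj; rewrite ffunE (ec j ((j == i) (+) b)) ?ffunE ?cj //.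
  by rewrite addbC addKb.
by rewrite reflectionK.
Qed.

Lemma motion_facets g : mosaic_motion g -> exists fs, g = refls (facets fs).
Proof.
elim=> [|{}g i b _ [fs ->]]; first by exists [::].
exists (rcons fs (i, b)); apply/funext => x.
by rewrite map_rcons -cats1 refls_cat.
Qed.

Lemma facets_motion fs : mosaic_motion (refls (facets fs)).
Proof.
elim/last_ind: fs => [|fs [i b] IH]; first exact: MotionId.
rewrite (_ : refls _ = refls (facets fs) \o reflection (fn i b)); last first.
  by apply/funext => x; rewrite map_rcons -cats1 refls_cat.
exact: MotionReflect.
Qed.

Lemma signs_facet es i b : exists b', forall x,
  refls (signs es) (reflection (fn i b) x) = reflection (fn i b') (refls (signs es) x).
Proof.
elim: es => [|j es [b' IH]] /=; first by exists b.
exists (b' (+) (j == i)) => x; rewrite IH -sign_facet.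
have sw : spacelike [:: wall (base j)] by rewrite /= wall_norm ltr01.
exact: (esym (reflection_conj (fn i b') _ sw)).
Qed.

(** A sign change permutes the facet normals and can be pushed to the right past the facet
    reflections, where it only relabels the faces of the base hypercube. *)
Lemma mirrors_split us : (forall u, u \in us -> cube_mirror u) ->
  exists fs es, refls us =1 (fun x => refls (facets fs) (refls (signs es) x)).
Proof.
elim/last_ind: us => [_|us u IH h]; first by exists [::], [::].
have [v vus|fs [es E]] := IH; first by apply: h; rewrite mem_rcons inE vus orbT.
have [[i [b uE]]|[i uE]] := h u ltac:(by rewrite mem_rcons inE eqxx); last first.
  exists fs, (rcons es i) => x.
  by rewrite -cats1 refls_cat E uE map_rcons -[rcons (signs _) _]cats1 refls_cat.
have [b' sE] := signs_facet es i b.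
exists (rcons fs (i, b')), es => x.
by rewrite -cats1 refls_cat E uE /= sE map_rcons -[rcons (facets _) _]cats1 refls_cat.
Qed.

Lemma mirrors_face us c : (forall u, u \in us -> cube_mirror u) ->
  mosaic_face #|[pred i | c i == None]| (refls us @` cube_face c)%classic.
Proof.
move=> /mirrors_split[fs [es E]].
pose n (c : {ffun 'I_4 -> option bool}) := #|[pred i | c i == None]|.
have [c' cE fE] : exists2 c', n c = n c' &
    (refls (signs es) @` @cube_face R c)%classic = cube_face c'.
  elim: es {E} => [|i es [c' -> IH]].
    by exists c => //; rewrite image_id.
  exists [ffun j => omap (addb (j == i)) (c' j)].
    by apply: eq_card => j; rewrite !inE ffunE; case: (c' j).
  by rewrite -sign_face -IH image_comp.
exists (refls (facets fs)), c'; split=> //; first exact: facets_motion.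
by rewrite -/(n c) -fE image_comp; apply: eq_imagel => x _; rewrite E.
Qed.

(** The coordinates of all that follows: [V0] becomes the empty word and faces become pairs of a
    word and a clique. The isometry [us] is the motion of [Q0] composed with the sign changes that
    take [corner0] to the vertex corresponding to [V0]. *)
Lemma mosaic_frame V0 Q0 : mosaic_face 4 Q0 -> Q0 V0 -> exists us,
  [/\ spacelike us, V0 = refls us corner0 &
    forall k X, mosaic_face k X <->
      exists w U, [/\ clique U, #|U| = k & X = cube us w U]].
Proof.
move=> [g [c [/motion_facets[fs0 ->] _ ->]]] [_ [e _ <-] <-].
pose us := facets fs0 ++ signs (enum [pred i | e i]).
have facet_ok fs u : u \in facets fs -> cube_mirror u.
  by move=> /mapP[[i b] _ ->]; left; exists i, b.
have usP u : u \in us -> cube_mirror u.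
  rewrite mem_cat => /orP[/facet_ok//|/mapP[i _ ->]]; by right; exists i.
have sus : spacelike us := cube_mirrors_spacelike usP.
exists us; split=> // [|k X].
  rewrite /us refls_cat; congr refls.
  rewrite (map_comp wall base) -/(act _ _) act_clique_word.
  - rewrite cube_vertexE; congr corner; apply/finset.setP => t; rewrite inE.
    apply/imsetP/mapP => [[i ei ->]|[i ei ->]]; exists i => //.
      by rewrite mem_enum.
    by rewrite mem_enum in ei.
  - by rewrite map_inj_uniq ?enum_uniq //; apply: base_inj.
  - move=> _ _ /mapP[i _ ->] /mapP[j _ ->].
    by apply: (cliqueP _ (cell0_clique R)); apply: base_cell0.
split=> [[g' [c' [/motion_facets[fs ->] ck ->]]]|[w [U [cU Uk ->]]]].
  have [u|w [fs' [s [fr E]]]] := @mirrors_frame R (rev us ++ facets fs).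
    by rewrite mem_cat mem_rev => /orP[/usP|/facet_ok].
  exists (w ++ enum [set s i | i in [pred i | c' i == Some true]]).
  exists [set s i | i in [pred i | c' i == None]]; split.
  - apply: cliqueS (tet_clique (frame_tet fr)).
    by apply/fintype.subsetP => _ /imsetP[i _ ->]; apply: mem_codom_set.
  - by rewrite card_imset //; apply: frame_inj fr.
  - rewrite -(frame_face _ _ _ fr); apply: eq_imagel => x _ /=.
    by rewrite -E refls_cat reflsVK.
have [T tT UT] := tet_extend cU; have [fs [s [fr TE]]] := frame_exists R tT.
have [us' [us'P E]] := word_mirrors w fr.
(* No sign is prescribed negative, so that the face given by [frame_face] is based at [w] itself. *)
pose c' : {ffun 'I_4 -> option bool} := [ffun i => if s i \in U then None else Some false].
have UE : U = [set s i | i in [pred i | c' i == None]].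
  apply/finset.setP => t; apply/idP/imsetP => [tU|[i + ->]]; last first.
    by rewrite inE ffunE; case: ifP.
  have := fintype.subsetP UT _ tU; rewrite TE => /imsetP[i _ tE].
  by exists i; rewrite // inE ffunE -tE tU.
have := @mirrors_face (us ++ us') c'.
have -> : (refls (us ++ us') @` cube_face c')%classic = cube us w U.
  have wE : w = w ++ enum [set s i | i in [pred i | c' i == Some true]].
    rewrite (_ : [set s i | i in _] = finset.set0) ?enum_set0 ?cats0 //.
    apply/finset.setP => t; rewrite inE; apply/negP => /imsetP[i + _].
    by rewrite inE ffunE; case: ifP.
  rewrite wE UE -(frame_face _ _ _ fr); apply: eq_imagel => x _ /=.
  by rewrite refls_cat -E.
rewrite -Uk UE card_imset; last exact: frame_inj fr.
apply=> u; rewrite mem_cat => /orP[/usP//|/us'P//].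
Qed.
End Mosaic.

Lemma card_fset_set_image (T : finType) (K : choiceType) (f : T -> K) (P : pred T) :
  {in P &, injective f} -> #|` fset_set [set f t | t in [set t | P t]%classic]%classic| = #|P|.
Proof.
move=> injf; pose X := [fset f t | t in enum P]%fset.
have -> : [set f t | t in [set t | P t]%classic]%classic = [set` X]%classic.
  apply/seteqP; split=> x /=.
    by move=> [t Pt <-]; apply/imfsetP; exists t; rewrite //= mem_enum.
  by move/imfsetP => [t /=]; rewrite mem_enum => Pt ->; exists t.
rewrite set_fsetK card_in_imfset /= ?cardE; last first.
  by move=> x y; rewrite !mem_enum; apply: injf.
by rewrite undup_id ?enum_uniq.
Qed.

(** * Vertices and faces in terms of words *)

Section Vertices.
Variable R : realType.
Local Notation B := (@minkowski R).
Local Notation phi := (phi R).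
Local Notation wall := (wall R).
Local Notation corner0 := (corner0 R).
Local Notation corner := (corner R).
Variable us : seq (point R).
Hypothesis sus : spacelike us.
Implicit Types (w u : seq 'I_120) (U T tau : {set 'I_120}) (x y : point R).

Definition vert w : point R := refls us (act w corner0).

Lemma vertE w : vert w = refls us (act w corner0).
Proof. by []. Qed.

Lemma vert_act w w' : vert w = vert w' -> act w =1 @act R w'.
Proof. by move/(refls_inj sus)/vertex_act. Qed.

Lemma eq_vert w w' : act w =1 @act R w' -> vert w = vert w'.
Proof. by move=> E; rewrite /vert E. Qed.

Lemma wall_inj : injective wall.
Proof.
move=> s t E; apply/eqP; apply: contraT => /(wall_le0 R).
by rewrite E wall_norm; lra.
Qed.

Lemma vert_rcons w s : vert (rcons w s) = vert w + 2 *: refls us (act w (wall s)).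
Proof.
by rewrite /vert act_rcons reflection_corner0 /act !reflsD !reflsZ.
Qed.

Lemma vert_rcons_inj w s t : vert (rcons w s) = vert (rcons w t) -> s = t.
Proof.
have n2 : (2 : R) != 0 by rewrite pnatr_eq0.
rewrite !vert_rcons => /addrI/(scalerI n2) E; apply: wall_inj.
by apply: (@act_inj R w); apply: (refls_inj sus); apply: E.
Qed.

Lemma vert_rcons_neq w s : vert (rcons w s) != vert w.
Proof.
rewrite vert_rcons; apply/eqP => E.
have : B (refls us (act w (wall s))) (2 *: refls us (act w (wall s))) = 0.
  by rewrite (_ : _ *: _ = 0) ?mk0r //; apply: (addrI (vert w)); rewrite E addr0.
rewrite mkZr refls_mk // act_mk wall_norm; lra.
Qed.

Lemma act_rcons_eq w w' s : act w =1 @act R w' -> act (rcons w s) =1 @act R (rcons w' s).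
Proof. by move=> E x; rewrite !act_rcons E. Qed.

Lemma act_rconsK w s : act (rcons (rcons w s) s) =1 @act R w.
Proof. by move=> x; rewrite !act_rcons reflectionK ?wall_norm. Qed.

Lemma reduced_vert w : exists2 w', reduced w' & vert w' = vert w.
Proof. by have [w' [rw' E _]] := reduce_word R w; exists w'; rewrite // (eq_vert E). Qed.

Lemma cube_ext w w' U : act w =1 @act R w' -> cube us w U = cube us w' U.
Proof.
by move=> E; apply/seteqP; split=> x [tau tU ->]; exists tau; rewrite ?E.
Qed.

Lemma cube_rcons w U s : clique U -> s \in U -> cube us (rcons w s) U = cube us w U.
Proof.
move=> cU sU.
have sub w' : (cube us (rcons w' s) U `<=` cube us w' U)%classic.
  move=> x [tau tU ->]; rewrite act_rcons (reflection_corner _ cU sU tU).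
  exists (if s \in tau then tau :\ s else s |: tau) => //.
  case: ifP => _; first by apply: fintype.subset_trans tU; apply: subsetDl.
  by rewrite finset.subUset finset.sub1set sU.
apply/seteqP; split; first exact: sub.
by rewrite -(cube_ext U (act_rconsK w s)); apply: sub.
Qed.

Lemma vert_cube w U : cube us w U (vert w).
Proof. by exists finset.set0; rewrite ?finset.sub0set // corner_set0. Qed.

Lemma cube_cat w v U : clique U -> all (mem U) v -> cube us (w ++ v) U = cube us w U.
Proof.
move=> cU; elim/last_ind: v => [|v s IH]; first by rewrite cats0.
rewrite all_rcons => /andP[sU vU]; rewrite -rcons_cat cube_rcons //.
exact: IH.
Qed.

Lemma corner_vert w tau : clique tau ->
  refls us (act w (corner tau)) = vert (w ++ enum tau).
Proof. by move=> ct; rewrite /vert act_cat act_enum. Qed.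

Lemma cube_verts w U x : clique U -> cube us w U x ->
  exists2 tau : {set 'I_120}, tau \subset U & x = vert (w ++ enum tau).
Proof.
move=> cU [tau tU ->]; exists tau => //.
by rewrite corner_vert // (cliqueS tU).
Qed.

Lemma enum_sub tau U : tau \subset U -> all (mem U) (enum tau).
Proof.
by move=> /fintype.subsetP tU; apply/allP => s; rewrite mem_enum; apply: tU.
Qed.

(** The letters of [U] move the base of a face among its own vertices, so any vertex on the face may
    serve as its base. *)
Lemma cube_at w w' U : clique U -> cube us w U (vert w') ->
  cube us w' U = cube us w U.
Proof.
move=> cU /(cube_verts cU)[tau tU /vert_act/(cube_ext U)->].
by rewrite cube_cat // enum_sub.
Qed.

Lemma cube_rep w U x : clique U -> cube us w U x ->
  exists2 w', x = vert w' & cube us w' U = cube us w U.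
Proof.
move=> cU h; have [tau _ xE] := cube_verts cU h.
by exists (w ++ enum tau) => //; apply: cube_at => //; rewrite -xE.
Qed.

Lemma vert_cube_rcons w U s : clique U -> cube us w U (vert (rcons w s)) <-> s \in U.
Proof.
move=> cU; split=> [[tau tU]|sU].
  move=> E; apply: (fintype.subsetP tU); apply: (@wall_in_corner R); last exact: cliqueS cU.
  apply: (@act_inj R w); apply: (refls_inj sus); rewrite -E.
  by rewrite vert_rcons !cornerE big_set1 /act !reflsD !reflsZ.
by rewrite -(cube_rcons w cU sU); apply: vert_cube.
Qed.

Lemma cube_subset w U U' : clique U -> clique U' ->
  (cube us w U `<=` cube us w U')%classic <-> U \subset U'.
Proof.
move=> cU cU'; split=> [h|UU'].
  apply/fintype.subsetP => s sU; apply/(vert_cube_rcons w s cU')/h.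
  exact/vert_cube_rcons.
by move=> x [tau tU ->]; exists tau => //; apply: fintype.subset_trans UU'.
Qed.

Lemma cube_inj w U U' : clique U -> clique U' -> cube us w U = cube us w U' -> U = U'.
Proof.
move=> cU cU' E; apply/eqP; rewrite finset.eqEsubset.
by apply/andP; split; apply/(cube_subset w) => //; rewrite E.
Qed.

(** While a letter of [U] is a descent of the base, stepping back along it stays in the face and
    shortens the word. *)
Lemma cube_nearest w U : clique U -> exists w',
  [/\ reduced w', [disjoint U & descents w'] & cube us w' U = cube us w U].
Proof.
move=> cU; have [w1 rw1 /vert_act/(cube_ext U)<-] := reduced_vert w.
have [n] := ubnP (size w1); elim: n w1 rw1 => // n IH w1 rw1 szw.
case: (boolP [disjoint U & descents w1]) => [d|]; first by exists w1.
move/pred0Pn => [s /andP[/= sU sD]].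
have [w2 [rw2 szE Ew]] := exchange R rw1 sD.
have [||w' [rw' dw' E]] := IH w2.
- by move: rw2; rewrite reduced_rcons => /andP[].
- by rewrite szE ltnS in szw.
by exists w'; split; rewrite // E (cube_ext U Ew) cube_rcons.
Qed.

Lemma cube1 w s : cube us w [set s] = [set vert w; vert (rcons w s)]%classic.
Proof.
apply/seteqP; split=> x /=.
  move=> /(cube_verts (clique1 s))[tau]; rewrite finset.subset1 => /orP[]/eqP-> ->.
    by right; rewrite enum_set1 cats1.
  by left; rewrite enum_set0 cats0.
move=> [->|->]; first exact: vert_cube.
by apply/vert_cube_rcons; rewrite ?clique1 ?inE.
Qed.

End Vertices.

Lemma near_cat a w v : near a (w ++ v) = near a w && near a v.
Proof. exact: all_cat. Qed.

Lemma out_cat a w v : out a (w ++ v) = out a w || near a w && out a v.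
Proof.
elim: w => //= s w ->; case: (adj a s) => //=; by rewrite orbF.
Qed.

Lemma out_near_mem a v : ~~ near a v -> ~~ out a v -> a \in v.
Proof.
move=> /near_split[u [s [v' [-> _ _ ->]]]]; rewrite negbK => /eqP->.
by rewrite mem_cat inE eqxx orbT.
Qed.

Lemma out_commN a v : (forall s, s \in v -> s = a \/ adj a s) -> ~~ out a v.
Proof.
elim: v => //= s v IH h; case: ifP => [_|nas].
  by apply: IH => t tv; apply: h; rewrite inE tv orbT.
by have [->|] := h s ltac:(by rewrite inE eqxx); rewrite ?eqxx // nas.
Qed.

(** * The simplex: growth and convexity *)

Section SimplexWords.
Variable T0 : {set 'I_120}.

Definition apexes w : {set 'I_120} := [set a in T0 | near a w].

Definition valid w : bool := reduced w && [forall a in T0, ~~ out a w].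

Lemma validP w : reflect (reduced w /\ forall a, a \in T0 -> ~~ out a w) (valid w).
Proof.
apply: (iffP andP) => [[rw /forall_inP h]|[rw h]]; first by split.
by split=> //; apply/forall_inP.
Qed.

Lemma apexes_rcons w s : apexes (rcons w s) = [set a in apexes w | adj a s].
Proof. by apply/setP => a; rewrite !inE near_rcons [adj a s && _]andbC andbA. Qed.

Lemma valid_rcons w s : valid (rcons w s) =
  [&& valid w, s \notin descents w & [forall a in apexes w, (s == a) || adj a s]].
Proof.
apply/validP/and3P => [[]|[/validP[rw nw] sD /forall_inP h]].
  rewrite reduced_rcons => /andP[rw sD] h; split=> //.
    by apply/validP; split=> // a /h; rewrite out_rcons => /norP[].
  apply/forall_inP => a; rewrite inE => /andP[/h + na].
  rewrite out_rcons na /= => /norP[_]; rewrite negb_and !negbK.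
  by rewrite orbC.
split=> [|a aT]; first by rewrite reduced_rcons rw.
rewrite out_rcons negb_or nw //= !negb_and !negbK.
case: (boolP (near a w)) => //= na; rewrite orbC h //.
by rewrite inE aT.
Qed.

Lemma valid_reduced w : valid w -> reduced w.
Proof. by case/validP. Qed.

Lemma valid_cat w v : valid (w ++ v) -> valid w.
Proof.
elim/last_ind: v => [|v s IH]; first by rewrite cats0.
by rewrite -rcons_cat valid_rcons => /and3P[/IH].
Qed.

Lemma apexes_descents w a s : a \in apexes w -> s \in descents w -> adj a s.
Proof. by rewrite inE => /andP[_]; apply: near_descents. Qed.

End SimplexWords.

Section Simplex.
Variable R : realType.
Local Notation B := (@minkowski R).
Local Notation phi := (phi R).
Local Notation wall := (wall R).
Local Notation corner0 := (corner0 R).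
Local Notation corner := (corner R).
Variable us : seq (point R).
Hypothesis sus : spacelike us.
Variable T0 : {set 'I_120}.
Hypothesis tT0 : tet T0.
Local Notation vert := (vert us).
Local Notation cube := (cube us).
Local Notation valid := (valid T0).
Local Notation apexes := (apexes T0).
Implicit Types (w u : seq 'I_120) (U T tau : {set 'I_120}) (x y z : point R).

Definition height a x : R := B x (refls us (wall a)).

Lemma height_vert a w : height a (vert w) = B (act w corner0) (wall a).
Proof. by rewrite /height refls_mk. Qed.

Lemma near_height a w : reduced w -> near a w = (height a (vert w) == -1).
Proof.
move=> rw; rewrite height_vert; have [h1 h2] := vertex_wall R a rw.
case: (boolP (near a w)) => [/(vertex_near R)->|na]; first by rewrite eqxx.
apply/esym/negP => /eqP E; rewrite E in h1 h2.
case: (boolP (out a w)) => [/h1|/(h2 na)]; lra.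
Qed.

Lemma out_height a w : reduced w -> out a w = (height a (vert w) < -1).
Proof.
move=> rw; rewrite height_vert; have [h1 h2] := vertex_wall R a rw.
case: (boolP (out a w)) => [/h1 h|no]; first by apply/esym; lra.
apply/esym/negbTE; rewrite -leNgt.
case: (boolP (near a w)) => [/(vertex_near R)->//|/h2/(_ no)]; lra.
Qed.

Definition in_simplex x : Prop := forall a, a \in T0 -> -1 <= height a x.

Lemma in_simplexP w : reduced w -> in_simplex (vert w) <-> valid w.
Proof.
move=> rw; split=> [h|/validP[_ h] a /h].
  by apply/validP; split=> // a /h; rewrite out_height // -leNgt.
by rewrite out_height // -leNgt.
Qed.

Lemma valid_eq w w' : reduced w' -> vert w = vert w' -> valid w -> valid w'.
Proof.
move=> rw' E vw; apply/in_simplexP => //; rewrite -E.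
by apply/in_simplexP => //; case/validP: vw.
Qed.

Lemma apexes_eq w w' : reduced w -> reduced w' -> vert w = vert w' ->
  apexes w = apexes w'.
Proof. by move=> rw rw' E; apply/setP => a; rewrite !inE !near_height // E. Qed.

Definition simplex_cube (X : set (point R)) : Prop :=
  exists w T, [/\ valid w, tet T, apexes w \subset T & X = cube w T].

(** The given base is the nearest vertex followed by letters of [T]. An apex of the nearest vertex
    is either still an apex of the given base, hence in [T], or is stopped by one of these letters;
    validity says that this letter is the apex itself. *)
Lemma simplex_cube_nearest X : simplex_cube X -> exists w T,
  [/\ valid w, tet T, apexes w \subset T, [disjoint T & descents w] & X = cube w T].
Proof.
move=> [w [T [vw tT AT ->]]]; have cT := tet_clique tT.
have [w0 [rw0 dis E]] := cube_nearest sus w cT.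
have [tau tauT vE] : exists2 tau : {set 'I_120}, tau \subset T &
    vert w = vert (w0 ++ enum tau).
  by apply: (cube_verts cT); rewrite E; apply: vert_cube.
have ct := cliqueS tauT cT.
have [rw1 _] := reduced_enum rw0 ct (disjointWl tauT dis).
have vw1 := valid_eq rw1 vE vw.
exists w0, T; split=> //; first exact: valid_cat vw1.
apply/fintype.subsetP => a; rewrite inE => /andP[aT na].
have [_ /(_ a aT)] := validP _ _ vw1; rewrite out_cat negb_or na /= => /andP[_ no].
case: (boolP (near a (enum tau))) => na'.
  apply: (fintype.subsetP AT); rewrite (apexes_eq _ rw1 vE) ?(valid_reduced vw) //.
  by rewrite inE aT near_cat na na'.
by apply: (fintype.subsetP tauT); rewrite -mem_enum; apply: out_near_mem.
Qed.

Lemma simplex_cube_in X x : simplex_cube X -> X x -> in_simplex x.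
Proof.
move=> /simplex_cube_nearest[w [T [vw tT AT dis ->]]] /(cube_verts (tet_clique tT)).
move=> [tau tauT ->]; have ct := cliqueS tauT (tet_clique tT).
have [rw1 _] := reduced_enum (valid_reduced vw) ct (disjointWl tauT dis).
apply/in_simplexP => //; apply/validP; split=> // a aT.
have [_ /(_ a aT) no] := validP _ _ vw; rewrite out_cat negb_or no negb_and.
case: (boolP (near a w)) => //= na; apply: out_commN => s; rewrite mem_enum => st.
have aT' : a \in T by apply: (fintype.subsetP AT); rewrite inE aT.
case: (eqVneq s a) => [|sa]; [by left | right].
apply: (cliqueP _ (tet_clique tT)) => //; last by rewrite eq_sym.
exact: (fintype.subsetP tauT).
Qed.

(** An apex [a] outside [T] fails to commute with some letter of [T], and the neighbour of [w] along
    that letter would lie at a height of at most -3 above the bisector [a]. *)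
Lemma simplex_cube_at w T : tet T -> reduced w -> simplex_cube (cube w T) ->
  valid w /\ apexes w \subset T.
Proof.
move=> tT rw /simplex_cube_in h.
have vw : valid w by apply/in_simplexP => //; apply/h/vert_cube.
split=> //; apply/fintype.subsetP => a; rewrite inE => /andP[aT na].
apply: contraT => naT; rewrite -(tet_nbs0 a tT); apply/nbsP => s sT.
have : -1 <= height a (vert (rcons w s)).
  by apply: h aT; apply/vert_cube_rcons => //; apply: tet_clique.
rewrite height_vert vertex_rcons -height_vert.
move: (na); rewrite near_height // => /eqP->; rewrite act_rev_near //.
have sa : s != a by apply: contraNneq naT => <-.
case: (boolP (adj s a)) => // nsa; have := wall_nonadj R sa nsa; lra.
Qed.

End Simplex.

(** * Values as numbers of reduced words *)

Section Values.
Variable R : realType.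
Local Notation corner0 := (corner0 R).
Variable us : seq (point R).
Hypothesis sus : spacelike us.
Hypothesis mosaicP : forall k X, mosaic_face k X <->
  exists w U, [/\ clique U, #|U| = k & X = cube us w U].
Local Notation vert := (vert us).
Local Notation cube := (cube us).
Implicit Types (w u : seq 'I_120) (U T tau : {set 'I_120}) (x y z : point R).

Lemma mosaic_edgeP x y : mosaic_edge x y <->
  exists w s, x = vert w /\ y = vert (rcons w s).
Proof.
split=> [/mosaicP[w [U [cU /eqP/cards1P[s ->]]]]|[w [s [-> ->]]]]; last first.
  by apply/mosaicP; exists w, [set s]; rewrite clique1 cards1 cube1.
rewrite cube1 // => E.
have xE : [set vert w; vert (rcons w s)]%classic x by rewrite -E; left.
have yE : [set vert w; vert (rcons w s)]%classic y by rewrite -E; right.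
have wE : [set x; y]%classic (vert w) by rewrite E; left.
have sE : [set x; y]%classic (vert (rcons w s)) by rewrite E; right.
have ne := vert_rcons_neq sus w s.
case: xE yE => [xw|xs] [yw|ys].
- by case: sE => sE; rewrite sE ?xw ?yw eqxx in ne.
- by exists w, s.
- exists (rcons w s), s; split=> //; rewrite yw.
  exact/esym/eq_vert/act_rconsK.
- by case: wE => wE; rewrite wE ?xs ?ys eqxx in ne.
Qed.

Fixpoint track w u : seq (point R) :=
  if u is s :: u' then vert (rcons w s) :: track (rcons w s) u' else [::].

Lemma size_track w u : size (track w u) = size u.
Proof. by elim: u w => //= s u IH w; rewrite IH. Qed.

Lemma last_track w u : last (vert w) (track w u) = vert (w ++ u).
Proof. by elim: u w => [|s u IH] w /=; rewrite ?cats0 // IH cat_rcons. Qed.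

Lemma track_inj w u u' : track w u = track w u' -> u = u'.
Proof.
elim: u u' w => [|s u IH] [|s' u'] w //= [/(vert_rcons_inj sus)-> /IH->].
by [].
Qed.

Lemma track_path w u :
  path (fun x y => `[< mosaic_edge x y >]) (vert w) (track w u).
Proof.
elim: u w => //= s u IH w; rewrite IH andbT.
by apply/asboolP/mosaic_edgeP; exists w, s.
Qed.

Lemma path_track (e : point R -> point R -> Prop) w p :
  (forall x y, e x y -> mosaic_edge x y) ->
  path (fun x y => `[< e x y >]) (vert w) p -> exists u, p = track w u.
Proof.
move=> sub; elim: p w => [|x p IH] w /=; first by exists [::].
move=> /andP[/asboolP/sub/mosaic_edgeP[w' [s [/(vert_act sus) E ->]]]].
rewrite (eq_vert us (act_rcons_eq s (fun x => esym (E x)))) => /IH[u ->].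
by exists (s :: u).
Qed.

Lemma shortest_mosaic w p : reduced w ->
  shortest_paths (@mosaic_edge R) (vert [::]) (vert w) p <->
  exists2 u, p = track [::] u & reduced u /\ vert u = vert w.
Proof.
move=> rw; split=> [[[pp lp] hp]|[u -> [ru uw]]].
  have [u pE] := path_track (fun x y => id) pp; subst p.
  rewrite last_track /= in lp; exists u => //; split=> //.
  have E := vert_act sus (esym lp).
  apply: (shortest_reduced rw E); apply/eqP; rewrite eqn_leq (reduced_size_le rw E) /=.
  have := hp (track [::] w); rewrite !size_track; apply.
  by split; [apply: track_path | rewrite last_track].
split; first by split; [apply: track_path | rewrite last_track].
move=> q [/(path_track (fun x y => id))[u' ->]]; rewrite last_track !size_track /= => E.
apply: (reduced_size_le (R := R)) => //; apply: (vert_act sus).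
by rewrite E uw.
Qed.

Definition geodesics n x : {set n.-tuple 'I_120} :=
  [set u : n.-tuple 'I_120 | reduced u && (vert u == x)].

Lemma value_geodesics n w : reduced w -> size w = n ->
  value (vert [::]) (vert w) = #|geodesics n (vert w)|.
Proof.
move=> rw <-; rewrite /value.
have -> : shortest_paths (@mosaic_edge R) (vert [::]) (vert w) =
    [set track [::] (tval u) | u in
      [set u : (size w).-tuple 'I_120 | u \in geodesics (size w) (vert w)]%classic]%classic.
  apply/seteqP; split=> p; rewrite shortest_mosaic //.
    move=> [u -> [ru uw]]; have szu : size u == size w.
      by apply/eqP; apply: (reduced_size_eq ru rw); apply: (vert_act sus).
    by exists (Tuple szu); rewrite //= inE ru uw eqxx.
  by move=> [u /=]; rewrite inE => /andP[ru /eqP uw] <-; exists u.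
rewrite card_fset_set_image // => u v _ _ /track_inj.
exact: val_inj.
Qed.

(** Appending a fixed list of letters maps the reduced words of [w] injectively to those of the top
    vertex, and not onto them. *)
Lemma value_lt_top w T : reduced w -> tet T -> ~~ (T \subset descents w) ->
  (value (vert [::]) (vert w) <
   value (vert [::]) (vert (w ++ enum (T :\: descents w))))%N.
Proof.
move=> rw tT nsub; have cT := tet_clique tT.
pose tau := T :\: descents w; have tauT : tau \subset T := subsetDl _ _.
have ct := cliqueS tauT cT.
have dis : [disjoint tau & descents w].
  rewrite -setI_eq0; apply/eqP/finset.setP => t; rewrite !inE.
  by case: (t \in descents w); rewrite ?andbF.
have [rtop Dtop] := reduced_enum rw ct dis.
set top := w ++ enum tau in rtop Dtop.
rewrite -/tau -/top.
have szt : size top = (size w + #|tau|)%N by rewrite size_cat -cardE.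
rewrite (value_geodesics rw erefl) (value_geodesics rtop szt).
pose f (u : (size w).-tuple 'I_120) := [tuple of u ++ enum tau].
have injf : injective f.
  move=> u v /(congr1 val) /= /eqP; rewrite eqseq_cat ?size_tuple // => /andP[/eqP E _].
  exact: val_inj.
rewrite -(card_imset _ injf); apply: proper_card; apply/properP; split.
  apply/fintype.subsetP => _ /imsetP[u + ->]; rewrite !inE => /andP[ru /eqP uw].
  have E := vert_act sus uw.
  have uD : descents u = descents w := eq_act_descents ru rw E.
  rewrite -uD in dis; have [-> _] := reduced_enum ru ct dis; rewrite /=.
  by apply/eqP/eq_vert => x; rewrite !act_cat E.
(* All the words obtained by appending end in [s], whereas any other letter [t] of [T] is also a
   possible last letter of the top vertex. *)
have [l [s lE]] : exists l s, enum tau = rcons l s.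
  case: (lastP (enum tau)) (mem_enum tau) => [E|l s _]; last by exists l, s.
  case/negP: nsub; rewrite -finset.setD_eq0; apply/eqP/finset.setP => t.
  by rewrite -[t \in _]E inE in_nil.
have [|t tinT ts] := @card_setD (T :&: [set s]) T (finset.subsetIl _ _).
  by rewrite (leq_ltn_trans (subset_leq_card (finset.subsetIr _ _))) // cards1 tet_card.
have {}ts : t != s by move: ts; rewrite !inE tinT.
have tD : t \in descents top.
  rewrite Dtop !inE tinT andbT; case: (boolP (t \in descents w)) => //= tDw.
  apply/forall_inP => r; rewrite inE => /andP[rD rT].
  by apply: (cliqueP _ cT) => //; apply: contraNneq rD => ->.
have [w' [rw' szE Ew']] := exchange R rtop tD.
have sz : size (rcons w' t) == (size w + #|tau|)%N by rewrite size_rcons -szE szt.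
exists (Tuple sz); first by rewrite inE /= rw' (eq_vert us Ew') eqxx.
apply/imsetP => -[u _ /(congr1 val) /=]; rewrite lE -rcons_cat => /rcons_inj[_ E].
by rewrite E eqxx in ts.
Qed.

End Values.

(** * Linear cones and hyperbolic hulls *)

Section Cones.
Variable R : realType.
Local Notation B := (@minkowski R).
Local Notation phi := (phi R).
Implicit Types (x y z : point R) (X Y : set (point R)).

(** A hyperbolic hull is the intersection of this cone with the hyperboloid, so hulls can be handled
    linearly, without normalising. *)
Definition cone X z : Prop := exists n (p : 'I_n -> point R) (c : 'I_n -> R),
  [/\ forall i, X (p i), forall i, 0 <= c i & z = \sum_i c i *: p i].

Lemma cone_in X x : X x -> cone X x.
Proof.
by move=> Xx; exists 1%N, (fun=> x), (fun=> 1); split; rewrite ?big_ord1 ?scale1r.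
Qed.

Lemma coneD X x y : cone X x -> cone X y -> cone X (x + y).
Proof.
move=> [n [p [c [Xp c0 ->]]]] [m [q [d [Xq d0 ->]]]].
exists (n + m)%N, (fun i => match split i with inl j => p j | inr j => q j end).
exists (fun i => match split i with inl j => c j | inr j => d j end); split.
- by move=> i; case: split.
- by move=> i; case: split.
rewrite big_split_ord /=; congr (_ + _); apply: eq_bigr => i _.
  by rewrite (unsplitK (inl i)).
by rewrite (unsplitK (inr i)).
Qed.

Lemma coneZ X a x : 0 <= a -> cone X x -> cone X (a *: x).
Proof.
move=> a0 [n [p [c [Xp c0 ->]]]]; exists n, p, (fun i => a * c i); split=> //.
  by move=> i; rewrite mulr_ge0.
by rewrite scaler_sumr; apply: eq_bigr => i _; rewrite scalerA.
Qed.

Lemma cone_le0 X y z : (forall x, X x -> B x y <= 0) -> cone X z -> B z y <= 0.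
Proof.
move=> h [n [p [c [Xp c0 ->]]]]; rewrite mk_suml -oppr_ge0 -sumrN sumr_ge0 // => i _.
by rewrite mkZl -mulrN mulr_ge0 // oppr_ge0 h.
Qed.

Lemma cone_map (f : point R -> point R) X Y z :
  (forall a x y, f (a *: x + y) = a *: f x + f y) ->
  (forall x, X x -> Y (f x)) -> cone X z -> cone Y (f z).
Proof.
move=> lin h [n [p [c [Xp c0 ->]]]].
have f0 : f 0 = 0 by have := lin (-1) 0 0; rewrite scaler0 addr0 scaleN1r addNr.
exists n, (fun i => f (p i)), c; split=> // [i|]; first exact: h.
apply: (big_rec2 (fun x y => f x = y)) => // i y x _ <-.
by rewrite lin.
Qed.

Definition box_point (v : 'I_4 -> R) : point R :=
  row_mx (\row_i v i) (const_mx (phi ^+ 2)).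

(** Induction on the number of coordinates that need not be 1 or -1: a point of the box lies on the
    segment joining its two projections to opposite facets. *)
Lemma box_cone k (v : 'I_4 -> R) : (forall i, `|v i| <= 1) ->
    (forall i : 'I_4, (k <= i)%N -> v i = 1 \/ v i = -1) ->
  cone [set x | exists e, x = cube_vertex R e]%classic (box_point v).
Proof.
elim: k v => [|k IH] v v1 vk.
  apply: cone_in; exists [ffun i => v i == -1]; rewrite /cube_vertex.
  congr row_mx; apply/rowP => i; rewrite !mxE ffunE.
  have [->|->] := vk i isT; rewrite ?eqxx ?expr1 //.
  by case: eqP => [E|_]; rewrite ?expr0 // expr1.
case: (ltnP k 4) => [k4|k4]; last first.
  by apply: IH => // i ki; have := leq_ltn_trans ki (ltn_ord i); rewrite ltnNge k4.
pose j := Ordinal k4; pose v' (b : bool) i := if i == j then (-1) ^+ b else v i : R.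
have vj := v1 j; rewrite ler_norml in vj.
have h b : cone [set x | exists e, x = cube_vertex R e]%classic (box_point (v' b)).
  apply: IH => i; rewrite /v'; case: eqVneq => [_|ij].
  - by rewrite normr_sign.
  - exact: v1.
  - by move=> _; case: b; [right; exact: expr1 | left; exact: expr0].
  - move=> ki; apply: vk; rewrite ltn_neqAle ki andbT.
    by apply: contraNneq ij => E; apply/eqP/val_inj.
have -> : box_point v = ((1 + v j) / 2) *: box_point (v' false) +
    ((1 - v j) / 2) *: box_point (v' true).
  rewrite /box_point !scale_row_mx add_row_mx; congr row_mx; apply/rowP => i.
    by rewrite !mxE /v'; case: eqVneq => [->|_] /=; rewrite ?expr0 ?expr1; field.
  by rewrite !mxE; field.
by apply: coneD; apply: coneZ (h _); apply: divr_ge0; lra.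
Qed.

Lemma box_hull z : 0 < z 0 (rshift 4 0) ->
    (forall i, `|z 0 (lshift 1 i)| * phi ^+ 2 <= z 0 (rshift 4 0)) ->
  cone [set x | exists e, x = cube_vertex R e]%classic z.
Proof.
set t := z 0 (rshift 4 0) => t0 h; have p0 : 0 < phi ^+ 2 by rewrite exprn_gt0 ?phi_gt0.
have -> : z = (t / phi ^+ 2) *: box_point (fun i => z 0 (lshift 1 i) * phi ^+ 2 / t).
  apply: point_ext => [i|]; rewrite mxE ?row_mxEl ?row_mxEr mxE.
    by field; rewrite !gt_eqF ?phi_gt0.
  by rewrite -/t; field; rewrite gt_eqF ?phi_gt0.
apply: coneZ; first by rewrite divr_ge0 ?ltW.
apply: (@box_cone 4) => i; last by rewrite leqNgt ltn_ord.
by rewrite normrM (@gtr0_norm _ t^-1) ?invr_gt0 // normrM (gtr0_norm p0) ler_pdivrMr // mul1r.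
Qed.

Lemma hyp4_mk_le0 x y : hyp4 x -> hyp4 y -> B x y <= 0.
Proof.
move=> [x1 x0] [y1 y0]; have := @timelike_same_side R x (- y).
rewrite !mkE opprK x1 y1 mxE oppr_le0 oppr_ge0; apply=> //; first exact: level_lt0.
  exact: level_lt0.
exact: ltW.
Qed.

(** For small k the vector z - k v is still timelike and future-pointing. This transfers growth
    estimates from a vertex [v] to an arbitrary point [z]. *)
Lemma hyp4_dominates z v : hyp4 z -> hyp4 v ->
  exists2 k, 0 < k & forall x, hyp4 x -> k * - B v x <= - B z x.
Proof.
move=> hz hv; have [z1 z0] := hz; have [v1 v0] := hv.
have bzv := hyp4_mk_le0 hz hv; have L0 := level_lt0 R.
set L := 3 - 2 * phi in z1 v1 L0.
set zt := z 0 (rshift 4 0) in z0; set vt := v 0 (rshift 4 0) in v0.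
have [b bE] : exists b, B z v = - b by exists (- B z v); rewrite opprK.
rewrite bE in bzv; have b0 : 0 <= b by lra.
pose k := Num.min (zt / (2 * vt)) (- L / (1 + 2 * b)).
have d0 : 0 < 1 + 2 * b by lra.
(* The first bound in [k] keeps the time coordinate of z - k v positive, the second keeps its norm
   negative. *)
have k0 : 0 < k.
  by rewrite lt_min !divr_gt0 // ?mulr_gt0 ?oppr_gt0.
have k1 : k * (2 * vt) <= zt by rewrite -ler_pdivlMr ?mulr_gt0 // ge_min lexx.
have k2 : k * (1 + 2 * b) <= - L by rewrite -ler_pdivlMr // ge_min lexx orbT.
exists k => // x [x1 x0]; rewrite mulrN lerN2 -subr_le0 -mkZl -mkBl mkC.
rewrite -oppr_ge0 -mkNr; apply: timelike_same_side => //.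
- by rewrite x1.
- rewrite !mkE z1 v1 (mkC v) bE.
  have : k * (k * L) <= 0 by rewrite mulr_ge0_le0 ?mulr_ge0_le0 // ltW.
  by nra.
- rewrite !mxE -/zt -/vt; nra.
Qed.

End Cones.

(** * Centres and facet normals of hypercubes *)

Section Centres.
Variable R : realType.
Local Notation B := (@minkowski R).
Local Notation phi := (phi R).
Local Notation wall := (wall R).
Local Notation corner0 := (corner0 R).
Local Notation corner := (corner R).
Variable us : seq (point R).
Hypothesis sus : spacelike us.
Local Notation vert := (vert us).
Local Notation cube := (cube us).
Implicit Types (w u : seq 'I_120) (U T tau : {set 'I_120}) (x y z : point R).

Definition centre w T : point R := refls us (act w (ctr R T)).

Lemma centreE w T : centre w T = refls us (act w (ctr R T)).
Proof. by []. Qed.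

Lemma phi3 : phi ^+ 3 = 1 + 2 * phi.
Proof. by rewrite exprS expr2 phi_sqr mulrDr phi_sqr; ring. Qed.

Lemma vert_centre_lt w w' T : tet T ->
  B (vert w') (centre w T) < - (1 + 2 * phi) \/ cube w T (vert w').
Proof.
move=> tT; have cT := tet_clique tT.
have [u [ru Eu _]] := reduce_word R (rev w ++ w').
have -> : B (vert w') (centre w T) = B (act u corner0) (ctr R T).
  by rewrite refls_mk // mkC act_mkV Eu act_cat mkC.
have [lt|uT] := ctr_le R cT ru; first by left; rewrite -(mk_corner0_ctr R tT).
right; have [tau tauT tE] := act_letters R cT uT; exists tau => //.
by rewrite -tE Eu act_cat actVK.
Qed.

Lemma vert_centre w T x : tet T -> cube w T x -> B x (centre w T) = - (1 + 2 * phi).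
Proof.
move=> tT [tau tauT ->]; rewrite refls_mk // act_mk.
by rewrite mk_corner_ctr ?tet_clique // mk_corner0_ctr.
Qed.

Lemma vert_centre_le w w' T : tet T -> B (vert w') (centre w T) <= - (1 + 2 * phi).
Proof.
move=> tT; have [/ltW//|/(vert_centre tT)->//] := vert_centre_lt w w' tT.
Qed.

Lemma hyp4_vert w : hyp4 (vert w).
Proof.
apply: hyp4_refls => //; apply: hyp4_refls; last exact: corner0_hyp4.
exact: spacelike_walls.
Qed.

Lemma cube_hyp4 w U x : clique U -> cube w U x -> hyp4 x.
Proof. by move=> cU /(cube_verts cU)[tau _ ->]; apply: hyp4_vert. Qed.

Lemma centre_cube w w' T : tet T -> cube w' T = cube w T -> centre w' T = centre w T.
Proof.
move=> tT E; have cT := tet_clique tT.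
have : cube w T (vert w') by rewrite -E; apply: vert_cube.
move=> /(cube_verts cT)[tau tauT /(vert_act sus) Ew].
rewrite /centre Ew act_cat; congr (refls us (act w _)).
by apply: act_ctr => //; apply: enum_sub.
Qed.

(** Outer normal of the facet that contains [w] and misses the direction [s]: its product is 0 with
    the vertices on this facet and -2 phi^3 with the opposite ones. *)
Definition normal w T s : point R :=
  centre w T - phi ^+ 3 *: refls us (act w (wall s)).

Lemma normalE w T s : normal w T s = centre w T - phi ^+ 3 *: refls us (act w (wall s)).
Proof. by []. Qed.

Lemma normal_ext w w' T s : act w =1 @act R w' -> normal w T s = normal w' T s.
Proof. by move=> E; rewrite /normal /centre !E. Qed.

Lemma normal_rcons w T s : tet T -> s \in T ->
  normal (rcons w s) T s = centre w T + phi ^+ 3 *: refls us (act w (wall s)).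
Proof.
move=> tT sT; rewrite /normal (centre_cube (w := w)) ?cube_rcons ?tet_clique //.
have -> : act (rcons w s) (wall s) = - act w (wall s).
  rewrite act_rcons reflection_wall wall_norm mulr1 -[X in X - _]scale1r -scalerBl.
  have -> : 1 - 2 = -1 :> R by ring.
  by rewrite scaleN1r /act reflsN.
by rewrite reflsN scalerN opprK.
Qed.

(** As [w'] runs through the vertices, both facets in each direction occur. Pulled back to the base
    hypercube by a frame, the inequalities say that every space coordinate times phi^2 is bounded by
    the time coordinate, as in [box_hull]. *)
Lemma hull_of_normals w T z : tet T -> hyp4 z ->
    (forall w' s, reduced w' -> cube w' T = cube w T -> s \in T ->
      B z (normal w' T s) <= 0) ->
  hyp_hull (cube w T) z.
Proof.
move=> tT hz h; split=> //; have cT := tet_clique tT.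
have {}h w' s : cube w' T = cube w T -> s \in T -> B z (normal w' T s) <= 0.
  move=> E sT; have [w1 rw1 /(vert_act sus) E1] := reduced_vert us w'.
  rewrite -(normal_ext T s E1); apply: h => //.
  by rewrite (cube_ext us T E1).
have [fs [f [fr TE]]] := frame_exists R tT.
set F := [seq facet_normal R g.1 g.2 | g <- fs] in fr.
have sF : spacelike F := spacelike_facets R fs.
pose g x := refls us (act w (refls F x)).
pose z' := refls (rev F) (act (rev w) (refls (rev us) z)).
have zE : z = g z' by rewrite /g /z' reflsVK // actVK reflsVK.
have gB x y : B (g x) (g y) = B x y by rewrite /g refls_mk // act_mk refls_mk.
have gwall i : g (wall (base i)) = refls us (act w (wall (f i))) by rewrite /g fr.2.
have gctr : g (ctr R cell0) = centre w T.
  rewrite /g /centre /ctr reflsD fr.1 refls_sum TE !big_imset /=.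
  - by congr (refls us (act w (_ + _))); apply: eq_bigr => i _; rewrite fr.2.
  - by move=> i j _ _; apply: (frame_inj fr).
  - by move=> i j _ _; apply: base_inj.
have ctrz : B z' (ctr R cell0) = - (phi * z' 0 (rshift 4 0)).
  rewrite ctr_cell0 mk_coord !row_mxEl row_mxEr !mxE.
  have : (phi - 1) * phi ^+ 2 = phi by rewrite expr2 mulrBl phi_sqr !mulrDr phi_sqr; ring.
  by move=> E; rewrite -[in RHS]E; ring.
have wallz i : B z' (wall (base i)) = - z' 0 (lshift 1 i).
  rewrite mk_coord !wall_base_space wall_base_time.
  case: i => [[|[|[|[|i]]]] hi] //=; rewrite ?mulr0n ?mulr1n.
  - by rewrite (_ : Ordinal hi = 0); [ring | apply: val_inj].
  - by rewrite (_ : Ordinal hi = 1); [ring | apply: val_inj].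
  - by rewrite (_ : Ordinal hi = 2); [ring | apply: val_inj].
  - by rewrite (_ : Ordinal hi = 3); [ring | apply: val_inj].
have ineq i : `|z' 0 (lshift 1 i)| * phi ^+ 2 <= z' 0 (rshift 4 0).
  have fT : f i \in T by rewrite TE mem_codom_set.
  have := h w (f i) erefl fT; have := h (rcons w (f i)) (f i) (cube_rcons us w cT fT) fT.
  rewrite normal_rcons // /normal -gwall -gctr !mkE {1 2 3 4}zE !gB ctrz wallz.
  move=> h1 h2; have p0 := phi_gt0 R.
  rewrite -[X in _ <= X](mulKf (lt0r_neq0 p0)) -ler_pdivrMl ?invr_gt0 // invrK.
  by rewrite mulrCA -exprS; case: ger0P => _; lra.
have hz' : hyp4 z'.
  apply: hyp4_refls; rewrite ?spacelike_rev //; apply: hyp4_refls.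
    exact: spacelike_walls.
  by apply: hyp4_refls; rewrite ?spacelike_rev.
rewrite zE; apply: (cone_map (X := [set x | exists e, x = cube_vertex R e]%classic)).
- by move=> a x y; rewrite /g /act !(reflsD, reflsZ).
- move=> _ [e ->]; rewrite /g (frame_vertex _ fr).
  exists [set f i | i in [pred i | e i]] => //.
  by apply/fintype.subsetP => _ /imsetP[i _ ->]; rewrite TE mem_codom_set.
- by apply: box_hull => //; case: hz'.
Qed.

(** Crossing a facet adds a positive multiple of its normal to the centre, so a point beyond the
    facet has a larger product with the centre of the neighbouring hypercube. *)
Lemma centre_flip w T s s' : tet T -> s \in T -> s' != s -> s' \in nbs (T :\ s) ->
  centre w (s' |: T :\ s) = centre w T + (phi - 1) *: normal w T s.
Proof.
move=> tT sT s's s'N; have E := wall_flip R tT sT s's s'N.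
have key : ctr R (s' |: T :\ s) = ctr R T + (phi - 1) *: (ctr R T - phi ^+ 3 *: wall s).
  rewrite /ctr big_setU1 ?nbs_notin //= (big_setD1 s sT) /=.
  set S := \sum_(t in T :\ s) wall t in E *.
  have -> : corner0 + (wall s' + S) = wall s' + (corner0 + S) by rewrite addrCA.
  have -> : wall s' = (phi - 1) *: (corner0 + S) - wall s by rewrite -E addrAC subrr add0r.
  have -> : corner0 + (wall s + S) = wall s + (corner0 + S) by rewrite addrCA.
  move: (corner0 + S) (wall s) => c r {E sT s's s'N}.
  have e : (phi - 1) * phi ^+ 3 = phi + 1.
    by rewrite phi3 mulrDr mulrCA !mulrBl phi_sqr; ring.
  rewrite scalerBr scalerDr scalerA e.
  apply/eqP; rewrite -subr_eq0; apply/eqP/rowP => i; rewrite !mxE; ring.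
by rewrite /normal /centre key /act !(reflsD, reflsZ, reflsN).
Qed.

End Centres.

(** * The simplex satisfies the conditions imposed on the part *)

Section UpperBound.
Variable R : realType.
Local Notation B := (@minkowski R).
Local Notation phi := (phi R).
Local Notation wall := (wall R).
Local Notation corner0 := (corner0 R).
Local Notation corner := (corner R).
Variable us : seq (point R).
Hypothesis sus : spacelike us.
Hypothesis mosaicP : forall k X, mosaic_face k X <->
  exists w U, [/\ clique U, #|U| = k & X = cube us w U].
Variable T0 : {set 'I_120}.
Hypothesis tT0 : tet T0.
Local Notation vert := (vert us).
Local Notation cube := (cube us).
Local Notation centre := (centre us).
Local Notation normal := (normal us).
Local Notation valid := (valid T0).
Local Notation apexes := (apexes T0).
Local Notation height := (height us).
Local Notation simplex_cube := (simplex_cube us T0).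
Implicit Types (w u : seq 'I_120) (U T tau : {set 'I_120}) (x y z : point R).

Lemma apexes_nil : apexes [::] = T0.
Proof. by apply/setP => a; rewrite inE andbT. Qed.

Lemma valid_nil : valid [::].
Proof. by apply/validP. Qed.

Lemma base_simplex_cube : simplex_cube (cube [::] T0).
Proof. by exists [::], T0; rewrite apexes_nil valid_nil. Qed.

Lemma simplex_cube_mosaic : (simplex_cube `<=` @mosaic_face R 4)%classic.
Proof.
move=> X [w [T [_ tT _ ->]]]; apply/mosaicP; exists w, T.
by rewrite tet_clique ?tet_card.
Qed.

Lemma tet_cubeP X : mosaic_face 4 X <-> exists w T, tet T /\ X = cube w T.
Proof.
split=> [/mosaicP[w [T [cT T4 ->]]]|[w [T [tT ->]]]].
  by exists w, T; rewrite /tet cT T4.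
by apply/mosaicP; exists w, T; rewrite tet_clique ?tet_card.
Qed.

Lemma valid_tet_apexes w T : tet T -> T \subset descents w -> apexes w = set0.
Proof.
move=> tT /fintype.subsetP TD; apply/setP => a; rewrite in_set0.
apply/negP => aA; suff : a \in nbs T by rewrite tet_nbs0.
by apply/nbsP => s /TD sD; rewrite adj_sym (apexes_descents aA).
Qed.

(** At a vertex of largest value all of [T] are descents. An apex commutes with every descent, and
    no letter commutes with a whole tetrahedron; so there is no apex, and every hypercube at the
    vertex qualifies. *)
Lemma simplex_growth : growth_closed (vert [::]) simplex_cube.
Proof.
move=> X x X' SX Xx xmax /tet_cubeP[w' [U [tU X'E]]] X'x.
have [w [T [_ tT _ XE]]] := SX.
have cT := tet_clique tT; have cU := tet_clique tU.
have [w1 xE wE] : exists2 w1, x = vert w1 & cube w1 T = X.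
  by rewrite XE in Xx *; apply: cube_rep.
have [w2 rw2 E] := reduced_vert us w1; rewrite -E in xE.
have X2 : cube w2 T = X.
  by rewrite -wE; apply: cube_at => //; rewrite -xE wE.
have TD : T \subset descents w2.
  apply: contraT => /(value_lt_top sus mosaicP rw2 tT) lt.
  have Xy : X (vert (w2 ++ enum (T :\: descents w2))).
    rewrite -X2 -(cube_cat us w2 cT (enum_sub (subsetDl T (descents w2)))).
    exact: vert_cube.
  by have := xmax _ Xy; rewrite leqNgt xE lt.
rewrite X'E -(@cube_at _ _ sus w' w2) -?xE -?X'E //.
exists w2, U; rewrite (valid_tet_apexes tT TD) sub0set; split=> //.
have SX2 : simplex_cube (cube w2 T) by rewrite X2.
by have [] := simplex_cube_at sus tT rw2 SX2.
Qed.

Lemma vertex_far w : reduced w -> B (vert w) (vert [::]) <= - (2 * (size w)%:R).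
Proof.
move=> rw; rewrite refls_mk //; have := vertex_dist R rw.
by rewrite corner_norm; have := level_lt0 R; lra.
Qed.

(** The centre is half the sum of two opposite vertices. The base vertex recedes linearly by
    [vertex_dist], as seen from [z] by [hyp4_dominates], and the other one contributes with the
    right sign. *)
Lemma centre_far z : hyp4 z -> exists2 k, 0 < k &
  forall w T, reduced w -> tet T -> k * (size w)%:R <= - B z (centre w T).
Proof.
move=> hz; have [k k0 h] := hyp4_dominates hz (hyp4_vert sus [::]).
exists k => // w T rw tT.
have h1 := h _ (hyp4_vert sus w); have h2 := vertex_far rw.
have -> : centre w T = 2^-1 *: (vert w + vert (w ++ enum T)).
  have e : ctr R T = 2^-1 *: (corner0 + corner T).
    rewrite /ctr !cornerE; move: corner0 (\sum_(s in T) wall s) => c S.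
    by apply/rowP => i; rewrite !mxE; field.
  by rewrite centreE e -corner_vert ?tet_clique // !vertE /act !(reflsZ, reflsD).
have h3 := hyp4_mk_le0 hz (hyp4_vert sus (w ++ enum T)).
rewrite mkZr mkDr; rewrite (mkC _ (vert w)) in h1.
have h4 : k * (2 * (size w)%:R) <= k * - B (vert w) (vert [::]).
  by rewrite ler_pM2l //; lra.
by move: h1 h3 h4; set a := B z _; set b := B z _; set c := k * - _; lra.
Qed.

(** Beyond a bound on the word length every centre is farther from [z] than that of the base
    hypercube, so only finitely many hypercubes compete. *)
Lemma nearest_simplex_cube z : hyp4 z -> exists w T,
  [/\ valid w, tet T, apexes w \subset T &
    forall w' T', valid w' -> tet T' -> apexes w' \subset T' ->
      B z (centre w' T') <= B z (centre w T)].
Proof.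
move=> hz; have [k k0 far] := centre_far hz.
set K := - B z (centre [::] T0).
have K0 : 0 <= K / k.
  by rewrite divr_ge0 ?(ltW k0) //; have := far [::] T0 isT tT0; rewrite mulr0.
pose N := Num.bound (K / k).
pose P (i : N.-bseq 'I_120 * {set 'I_120}) :=
  [&& valid i.1, tet i.2 & apexes i.1 \subset i.2].
have P0 : P ([bseq], T0) by rewrite /P /= valid_nil tT0 apexes_nil /=.
pose F (i : N.-bseq 'I_120 * {set 'I_120}) := B z (centre i.1 i.2).
case: (@arg_maxP _ _ _ ([bseq], T0) P F P0) => -[w T] /and3P[vw tT AT] hmax.
exists (val w), T; split=> // w' T' vw' tT' AT'.
case: (leqP (size w') N) => szw.
  by apply: (hmax (Bseq szw, T')); apply/and3P.
have := hmax ([bseq], T0) P0; apply: le_trans => /=.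
rewrite -lerN2 -/K; apply: le_trans (far w' T' (valid_reduced vw') tT').
rewrite mulrC -ler_pdivrMr //; apply: ltW; apply: lt_trans (archi_boundP K0) _.
by rewrite ltr_nat.
Qed.

Lemma vert_height_centre w T w' a : tet T -> -1 <= height a (vert w') ->
  near a w -> B (vert w') (normal w T a) <= 0.
Proof.
move=> tT h na; rewrite normalE mkBr mkZr act_near //.
have := vert_centre_le sus w w' tT; rewrite -phi3.
have p0 : 0 < phi ^+ 3 by rewrite exprn_gt0 ?phi_gt0.
rewrite -/(height a (vert w')); nra.
Qed.

(** Among the hypercubes of the simplex the one with the centre nearest to [z] contains [z]. At a
    facet in a bounding half-space, the inequality is inherited from the endpoints; at any other
    facet, the neighbour is also in the simplex, and a violated inequality would make its centre
    nearer. *)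
Lemma simplex_convex : convex_part simplex_cube.
Proof.
move=> x y [X1 SX1 hx] [X2 SX2 hy] z hz; have hz4 := hz.1.
have bound w T a : a \in T0 -> near a w -> tet T -> B z (normal w T a) <= 0.
  move=> aT na tT.
  have side X p : simplex_cube X -> cone X p -> B p (normal w T a) <= 0.
    move=> SX; apply: cone_le0 => q Xq.
    have := simplex_cube_in sus SX Xq aT.
    have [w1 [T1 [_ tT1 _ XE]]] := SX.
    move: Xq; rewrite XE => /(cube_verts (tet_clique tT1))[tau _ ->] hq.
    exact: vert_height_centre.
  apply: cone_le0 hz.2 => _ [->|->].
    exact: side SX1 hx.2.
  exact: side SX2 hy.2.
have [w [T [vw tT AT hmax]]] := nearest_simplex_cube hz4.
exists (cube w T); first by exists w, T.
apply: hull_of_normals => // w' s rw' E sT.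
have [vw' AT'] : valid w' /\ apexes w' \subset T.
  have S' : simplex_cube (cube w' T) by rewrite E; exists w, T.
  exact: (simplex_cube_at sus tT rw' S').
have [s' [s's s'T N tT']] := flip_exists tT sT.
have s'N : s' \in nbs (T :\ s) by rewrite N !inE eqxx orbT.
case: (boolP (s \in apexes w')) => sA.
  by move: sA; rewrite inE => /andP[sT0 ns]; apply: bound.
have /(hmax w' _ vw' tT') : apexes w' \subset s' |: T :\ s.
  apply/fintype.subsetP => a aA; rewrite !inE (fintype.subsetP AT') // andbT.
  by rewrite (contraNneq _ sA) ?orbT // => <-.
rewrite (centre_flip us w' tT sT s's s'N) (centre_cube sus tT E) mkDr mkZr gerDl.
by rewrite pmulr_rle0 // subr_gt0 phi_gt1.
Qed.

Lemma pascal_sub Q0 X : Q0 = cube [::] T0 ->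
  pascal_simplex (vert [::]) Q0 X -> simplex_cube X.
Proof.
move=> ->; apply.
- exact: simplex_cube_mosaic.
- exact: base_simplex_cube.
- exact: simplex_growth.
- exact: simplex_convex.
Qed.

End UpperBound.

Local Open Scope nat_scope.

Definition quad (x y a b : 'I_120) : {set 'I_120} := [set x; y; a; b].

Lemma quadC x y a b : quad x y a b = quad x y b a.
Proof. by rewrite /quad -!setUA [[set a] :|: _]setUC. Qed.

Lemma tet_other x y a b : tet (quad x y a b) -> forall z, adj x z -> adj y z ->
  adj a z -> adj b z -> False.
Proof.
move=> tT z xz yz az bz; have : z \in nbs (quad x y a b).
  by apply/nbsP => u; rewrite !inE => /orP[/orP[/orP[]|]|] /eqP->.
by rewrite tet_nbs0.
Qed.

(** The pentagon of common neighbours in cyclic order. The five hypercubes around the square spanned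
    by [x] and [y] correspond to its edges. *)
Definition ring_at (x y p q r s t : 'I_120) : Prop :=
  [/\ adj x y, uniq [:: p; q; r; s; t],
      forall z, (adj x z && adj y z) = (z \in [:: p; q; r; s; t])
    & [/\ adj p q, adj q r, adj r s, adj s t & adj t p]].

Lemma ring_rot x y p q r s t : ring_at x y p q r s t -> ring_at x y q r s t p.
Proof.
move=> [xy U E [pq qr rs st tp]]; split=> //.
  by rewrite -[_ :: _]/(rot 1 [:: p; q; r; s; t]) rot_uniq.
by move=> z; rewrite E -[[:: q; r; s; t; p]]/(rot 1 [:: p; q; r; s; t]) mem_rot.
Qed.

Lemma ring_exists (x y p : 'I_120) : adj x y -> adj x p -> adj y p ->
  exists q r s t, ring_at x y p q r s t.
Proof.
move=> xy xp yp; have c3 : clique (p |: [set x; y]).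
  apply: cliqueU1; last by rewrite nbsU1 nbs1 xp.
  by apply: cliqueU1; rewrite ?clique1 ?nbs1 // adj_sym.
have [N _] := card_nbs c3.
rewrite cardsU1 cards2 adj_neq // !inE negb_or ![p == _]eq_sym !adj_neq // in N.
have /card_gt0P[q] : 0 < #|nbs (p |: [set x; y])| by rewrite N.
rewrite !nbsU1 nbs1 => /and3P[pq xq yq].
have [r [s [t [U E [qr rs st tp]]]]] := ring_adj xy xp yp xq yq pq.
by exists q, r, s, t.
Qed.

Lemma ring_mem x y p q r s t z : ring_at x y p q r s t -> z \in [:: p; q; r; s; t] ->
  adj x z /\ adj y z.
Proof. by move=> [_ _ E _]; rewrite -E => /andP[]. Qed.

Lemma tet_pair T x y : tet T -> x \in T -> y \in T -> x != y ->
  exists a b, [/\ T = quad x y a b, adj a b, adj x a /\ adj y a & adj x b /\ adj y b].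
Proof.
move=> tT xT yT xy; have c2 : #|T :\ x :\ y| = 2.
  have := cardsD1 y (T :\ x); rewrite tet_cardD1 // !inE eq_sym xy yT.
  by case.
have /cards2P[a [b [ab E]]] : #|T :\ x :\ y| == 2 by rewrite c2.
have /cliqueP cT := tet_clique tT.
have : a \in T :\ x :\ y by rewrite E !inE eqxx.
have : b \in T :\ x :\ y by rewrite E !inE eqxx orbT.
rewrite !inE => /and3P[yb xb bT] /and3P[ya xa aT].
exists a, b; split; last 3 first.
- exact: cT.
- by split; apply: cT; rewrite // eq_sym.
- by split; apply: cT; rewrite // eq_sym.
rewrite /quad -setUA -E -{1}(setD1K xT) -{1}(@setD1K _ y (T :\ x)) ?setUA //.
by rewrite !inE eq_sym xy yT.
Qed.

Lemma ring_tets x y p q r s t T : ring_at x y p q r s t -> tet T ->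
    x \in T -> y \in T ->
  [\/ T = quad x y p q, T = quad x y q r, T = quad x y r s |
      T = quad x y s t \/ T = quad x y t p].
Proof.
move=> H tT xT yT; have [xy U E [pq qr rs st tp]] := H.
have [a [b [TE ab [xa ya] [xb yb]]]] := tet_pair tT xT yT (adj_neq xy).
have : a \in [:: p; q; r; s; t] by rewrite -E xa.
have : b \in [:: p; q; r; s; t] by rewrite -E xb.
(* Two letters of the pentagon that are not consecutive have a common neighbour in it, which
   together with [x] and [y] would make a clique of five. *)
have nb z : z \in [:: p; q; r; s; t] -> adj z a -> adj z b -> False.
  move=> /(ring_mem H)[xz yz] za zb; rewrite TE in tT.
  by apply: (tet_other tT xz yz); rewrite adj_sym.
have np : adj p a -> adj p b -> False by apply: nb; rewrite !inE eqxx.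
have nq : adj q a -> adj q b -> False by apply: nb; rewrite !inE eqxx ?orbT.
have nr : adj r a -> adj r b -> False by apply: nb; rewrite !inE eqxx ?orbT.
have ns : adj s a -> adj s b -> False by apply: nb; rewrite !inE eqxx ?orbT.
have nt : adj t a -> adj t b -> False by apply: nb; rewrite !inE eqxx ?orbT.
have [qp rq sr ts pt] : [/\ adj q p, adj r q, adj s r, adj t s & adj p t].
  by rewrite !(adj_sym q p, adj_sym r q, adj_sym s r, adj_sym t s, adj_sym p t).
rewrite !inE TE; move=> /or4P[||| /orP[]] /eqP bE /or4P[||| /orP[]] /eqP aE;
  subst a b; try (by rewrite adjxx in ab);
  try (by case: (np)); try (by case: (nq)); try (by case: (nr));
  try (by case: (ns)); try (by case: (nt));
  try (by constructor 1); try (by constructor 1; rewrite quadC);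
  try (by constructor 2); try (by constructor 2; rewrite quadC);
  try (by constructor 3); try (by constructor 3; rewrite quadC);
  try (by constructor 4; left); try (by constructor 4; left; rewrite quadC);
  try (by constructor 4; right); try (by constructor 4; right; rewrite quadC).
Qed.

(** * The smallest convex part *)

Section Percolation.
Variable Z : {set 'I_120} -> Prop.
(** The two effects of convexity around a square, for two nonadjacent hypercubes: on the short side
    the single hypercube between them is present, on the long side at least one of the two. *)
Hypothesis between : forall x y p q r s t, ring_at x y p q r s t ->
  Z (quad x y p q) -> Z (quad x y r s) -> Z (quad x y q r).
Hypothesis reflex : forall x y p q r s t, ring_at x y p q r s t ->
  Z (quad x y p q) -> Z (quad x y r s) -> Z (quad x y s t) \/ Z (quad x y t p).

Definition known (U : {set 'I_120}) : Prop := forall T, tet T -> U \subset T -> Z T.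

Lemma knownS (U W : {set 'I_120}) : U \subset W -> known U -> known W.
Proof. by move=> UW kU T tT WT; apply: kU => //; apply: subset_trans WT. Qed.

Lemma ring_fill x y p q r s t : ring_at x y p q r s t ->
  Z (quad x y p q) -> Z (quad x y r s) -> known [set x; y].
Proof.
move=> H Zpq Zrs T tT; rewrite subUset !sub1set => /andP[xT yT].
have Zqr := between H Zpq Zrs.
have H1 := ring_rot H; have H2 := ring_rot H1; have H3 := ring_rot H2.
have H4 := ring_rot H3.
have [Zst|Ztp] := reflex H Zpq Zrs.
  have Ztp : Z (quad x y t p) by apply: (between H3 Zst Zpq).
  by case: (ring_tets H tT xT yT) => [->|->|->|[->|->]].
have Zst : Z (quad x y s t) by apply: (between H2 Zrs Ztp).
by case: (ring_tets H tT xT yT) => [->|->|->|[->|->]].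
Qed.

Lemma tet_quad x y p q : adj x y -> adj x p -> adj y p -> adj x q -> adj y q ->
  adj p q -> tet (quad x y p q).
Proof.
move=> xy xp yp xq yq pq.
have E : quad x y p q = q |: (p |: (y |: [set x])).
  by apply/setP => z; rewrite !inE; do !case: (_ == _).
have cq : clique (quad x y p q).
  rewrite E; apply: cliqueU1; last by rewrite !nbsU1 nbs1 pq yq.
  apply: cliqueU1; last by rewrite nbsU1 nbs1 yp.
  by apply: cliqueU1; rewrite ?clique1 ?nbs1.
have ne i j : adj i j -> (j == i) = false.
  by move=> ij; rewrite eq_sym (negPf (adj_neq ij)).
by rewrite /tet cq E !cardsU1 cards1 !inE (ne _ _ pq) (ne _ _ yq) (ne _ _ xq)
  (ne _ _ yp) (ne _ _ xp) (ne _ _ xy).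
Qed.

(** The tetrahedra through [p] take two consecutive places of the five, and any third one is
    nonadjacent to one of these. *)
Lemma ring_known x y p T : adj x y -> p \in nbs [set x; y] ->
  known (p |: [set x; y]) -> tet T -> x \in T -> y \in T -> p \notin T -> Z T ->
  known [set x; y].
Proof.
move=> xy; rewrite nbsU1 nbs1 => /andP[xp yp] kp tT xT yT pT ZT.
have [q [r [s [t H]]]] := ring_exists xy xp yp.
have [_ _ _ [pq qr rs st tp]] := H.
have [mq mr ms mt] : [/\ adj x q /\ adj y q, adj x r /\ adj y r,
    adj x s /\ adj y s & adj x t /\ adj y t].
  by split; apply: (ring_mem H); rewrite !inE eqxx ?orbT.
have Zpq : Z (quad x y p q).
  apply: kp; first by apply: tet_quad; case: mq.
  by rewrite !subUset !sub1set !inE !eqxx ?orbT.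
have Ztp : Z (quad x y t p).
  apply: kp; first by apply: tet_quad; case: mt.
  by rewrite !subUset !sub1set !inE !eqxx ?orbT.
have H1 := ring_rot H; have H2 := ring_rot H1; have H3 := ring_rot H2.
have H4 := ring_rot H3.
case: (ring_tets H tT xT yT) => [E|E|E|[E|E]]; rewrite E in pT ZT.
- by rewrite !inE eqxx ?orbT in pT.
- exact: (ring_fill H4 Ztp ZT).
- exact: (ring_fill H Zpq ZT).
- exact: (ring_fill H3 ZT Zpq).
- by rewrite !inE eqxx ?orbT in pT.
Qed.

(** A known letter with a known neighbour makes all its neighbours known, as its link is connected
    and triangles propagate by [step]. Having such a neighbour is kept along the way, so
    connectivity of [nbs U] does the rest. *)
Lemma known_spread (U : {set 'I_120}) x0 y0 : clique U -> #|U| <= 1 ->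
    x0 \in nbs U -> y0 \in nbs U -> adj x0 y0 -> known (x0 |: U) -> known (y0 |: U) ->
    (forall x y z, x \in nbs U -> y \in nbs U -> z \in nbs U -> adj x y ->
      adj x z -> adj y z -> known (x |: U) -> known (y |: U) -> known (z |: U)) ->
  known U.
Proof.
move=> cU U1 x0U y0U xy0 kx0 ky0 step.
pose Y x := `[< known (x |: U) /\ exists y, [/\ y \in nbs U, adj x y & known (y |: U)] >].
have all_nbs x y : x \in nbs U -> known (x |: U) -> y \in nbs U -> adj x y ->
    known (y |: U) -> forall z, z \in nbs U -> adj x z -> known (z |: U).
  move=> xU kx yU xy ky z zU xz; apply/asboolP; move: z zU xz.
  have cx : clique (x |: U) := cliqueU1 cU xU.
  have cardx : #|x |: U| <= 2 by rewrite cardsU1 (nbs_notin xU) add1n.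
  have yx : y \in nbs (x |: U) by rewrite nbsU1 xy.
  move=> z zU xz; apply: (nbs_connected (Y := fun z => `[< known (z |: U) >]) cx cardx yx).
  - exact/asboolP.
  - move=> u v; rewrite !nbsU1 => /andP[xu uU] /andP[xv vU] /asboolP ku uv.
    by apply/asboolP; apply: (step x u v).
  - by rewrite nbsU1 xz.
have spread : forall x, x \in nbs U -> Y x.
  apply: (nbs_connected cU (leqW U1) x0U).
    by apply/asboolP; split=> //; exists y0.
  move=> x y xU yU /asboolP[kx [z [zU xz kz]]] xy; apply/asboolP; split.
    exact: (all_nbs x z).
  by exists x; rewrite adj_sym.
move=> T tT UT; have [|v vT vU] := card_setD UT.
  by rewrite (tet_card tT); apply: leq_ltn_trans U1 _.
have /spread/asboolP[kv _] : v \in nbs U by apply: tet_sub_nbs vT vU.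
by apply: kv; rewrite // subUset sub1set vT.
Qed.

(** In a triangle x, y, z of the link of [a], the ring of the edge a, z is settled by [ring_known]:
    all its tetrahedra through [x] are known, and so is the one through [y] that avoids [x]. *)
Lemma link_known a x y : adj a x -> adj a y -> adj x y -> known [set a; x] ->
  known [set a; y] -> known [set a].
Proof.
move=> ax ay xy kx ky; apply: (@known_spread [set a] x y); rewrite ?clique1 ?cards1 ?nbs1 //.
- by rewrite setUC.
- by rewrite setUC.
move=> {ax ay xy kx ky} {}x {}y z; rewrite !nbs1 => ax ay az xy xz yz kx ky.
rewrite setUC; have zN : x \in nbs [set a; z] by rewrite nbsU1 nbs1 ax adj_sym.
have c3 : clique (y |: [set a; z]).
  apply: cliqueU1; last by rewrite nbsU1 nbs1 ay adj_sym.
  by rewrite setUC; apply: cliqueU1; rewrite ?clique1 ?nbs1.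
have xN : x \in nbs (y |: [set a; z]) by rewrite nbsU1 zN adj_sym xy.
have [N _] := card_nbs c3.
have cz : #|[set a; z]| = 2 by rewrite cards2 adj_neq.
have yN : y \notin [set a; z] by rewrite !inE negb_or ![y == _]eq_sym !adj_neq // adj_sym.
rewrite cardsU1 yN cz in N.
have /card_gt0P[q /setD1P[qx qN]] : 0 < #|nbs (y |: [set a; z]) :\ x|.
  have E := cardsD1 x (nbs (y |: [set a; z])); rewrite N xN in E.
  by rewrite lt0n; apply/eqP => k0; rewrite k0 in E.
apply: (@ring_known a z x (q |: (y |: [set a; z]))) => //.
- by apply: knownS kx; rewrite setUC !subUset !sub1set !inE !eqxx ?orbT.
- rewrite /tet cliqueU1 //= cardsU1 (nbs_notin qN) cardsU1 yN cz //.
- by rewrite !inE eqxx ?orbT.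
- by rewrite !inE eqxx ?orbT.
- rewrite !inE !negb_or eq_sym qx !adj_neq //; first by rewrite adj_sym.
- apply: ky; last by rewrite !subUset !sub1set !inE !eqxx ?orbT.
  by rewrite /tet cliqueU1 //= cardsU1 (nbs_notin qN) cardsU1 yN cz.
Qed.

Lemma all_known x y : adj x y -> known [set x] -> known [set y] -> known set0.
Proof.
move=> xy kx ky; apply: (@known_spread set0 x y); rewrite ?clique0 ?cards0 ?nbs0 ?in_setT ?setU0 //.
move=> u v z _ _ _ uv uz vz; rewrite !setU0 => ku kv.
apply: (@link_known z u v); rewrite ?(adj_sym z) //.
- by apply: knownS ku; rewrite sub1set !inE eqxx orbT.
- by apply: knownS kv; rewrite sub1set !inE eqxx orbT.
Qed.

(** Induction on the number of letters missing from [A], so that [A] enlarged by a letter [t]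
    adjacent to [s] is settled already. For three letters [grow] supplies the only other
    tetrahedron. For two letters it supplies the extra tetrahedron of the ring; for one and for
    none, [s] and [t] form the known adjacent pair. *)
Lemma percolate (A : {set 'I_120}) s : clique A -> s \in nbs A -> known (s |: A) ->
    (forall T T', tet T -> s |: A \subset T -> tet T' -> T :\ s \subset T' -> Z T') ->
  known A.
Proof.
have [n] := ubnP (4 - #|A|); elim: n A => // n IH A lt_n cA sA ks grow.
have cs := cliqueU1 cA sA.
have [N le3] := card_nbs cs; rewrite cardsU1 (nbs_notin sA) add1n in N le3.
have deeper t : t \in nbs (s |: A) -> known (t |: A).
  rewrite nbsU1 => /andP[st tA]; apply: IH.
  - by rewrite cardsU1 (nbs_notin tA); lia.
  - exact: cliqueU1.
  - by rewrite nbsU1 adj_sym st.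
  - by apply: knownS ks; rewrite setUCA subsetUr.
  - move=> T T' tT sub tT' sub'; apply: (grow T T') => //.
    by apply: subset_trans sub; rewrite setUCA subsetUr.
have [A3|A3] := eqVneq #|A| 3.
  move=> T tT AT; have tsA : tet (s |: A).
    by rewrite /tet cs cardsU1 (nbs_notin sA) A3.
  apply: (grow (s |: A) T) => //.
  by rewrite setU1K ?nbs_notin.
have lt2 : #|A| <= 2 by move: A3 le3; case: #|A| => [|[|[|[|m]]]].
have /card_gt0P[t tN] : 0 < #|nbs (s |: A)|.
  by rewrite N; move: lt2; case: #|A| => [|[|[|m]]].
have kt := deeper t tN; move: (tN); rewrite nbsU1 => /andP[st tA].
move: lt2; rewrite leq_eqVlt ltnS leq_eqVlt ltnS leqn0.
case/orP=> [/cards2P[x [y [xy AE]]]|/orP[/cards1P[a AE]|]].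
- have xyA : adj x y by apply: (cliqueP _ cA); rewrite ?AE ?inE ?eqxx ?orbT.
  have [T2 [t2 sub2]] : exists T2, tet T2 /\ t |: (s |: A) \subset T2.
    by have [T2 ? ?] := tet_extend (cliqueU1 cs tN); exists T2.
  have sT2 : s \in T2 by apply: (subsetP sub2); rewrite !inE eqxx orbT.
  have [s' [s's s'T _ tT']] := flip_exists t2 sT2.
  rewrite AE; apply: (ring_known (p := s) (T := s' |: T2 :\ s)) => //.
  + by rewrite -AE.
  + by rewrite -AE.
  + have xT2 : x \in T2 by apply: (subsetP sub2); rewrite AE !inE eqxx !orbT.
    have : x != s by apply: contraNneq (nbs_notin sA) => <-; rewrite AE !inE eqxx.
    by rewrite !inE xT2 => ->; rewrite orbT.
  + have yT2 : y \in T2 by apply: (subsetP sub2); rewrite AE !inE eqxx !orbT.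
    have : y != s by apply: contraNneq (nbs_notin sA) => <-; rewrite AE !inE eqxx orbT.
    by rewrite !inE yT2 => ->; rewrite orbT.
  + by rewrite !inE eqxx orbF eq_sym.
  + apply: (grow T2) => //; last exact: subsetUr.
    by apply: subset_trans sub2; rewrite subsetUr.
- rewrite AE; rewrite AE in sA tA ks kt; apply: (@link_known a s t) => //.
  + by rewrite nbs1 in sA.
  + by rewrite nbs1 in tA.
  + by rewrite setUC.
  + by rewrite setUC.
- rewrite cards_eq0 => /eqP A0; rewrite A0 !setU0 in ks kt *.
  exact: all_known ks kt.
Qed.

End Percolation.

Local Open Scope ring_scope.

(** * Which hypercubes contain a given point *)

Section LowerBound.
Variable R : realType.
Local Notation B := (@minkowski R).
Local Notation phi := (phi R).
Local Notation wall := (wall R).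
Local Notation corner0 := (corner0 R).
Local Notation corner := (corner R).
Variable us : seq (point R).
Hypothesis sus : spacelike us.
Hypothesis mosaicP : forall k X, mosaic_face k X <->
  exists w U, [/\ clique U, #|U| = k & X = cube us w U].
Local Notation vert := (vert us).
Local Notation cube := (cube us).
Local Notation centre := (centre us).
Implicit Types (w u : seq 'I_120) (U T tau : {set 'I_120}) (x y z : point R).

Lemma normalise z : B z z < 0 -> 0 < z 0 (rshift 4 0) ->
  exists2 l, 0 < l & hyp4 (l *: z).
Proof.
move=> z1 z0; have q0 : 0 < (3 - 2 * phi) / B z z.
  by rewrite -mulrNN -invrN divr_gt0 // oppr_gt0 ?level_lt0.
exists (Num.sqrt ((3 - 2 * phi) / B z z)); first by rewrite sqrtr_gt0.
split; last by rewrite mxE mulr_gt0 ?sqrtr_gt0.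
by rewrite mkZl mkZr mulrA -expr2 sqr_sqrtr ?ltW // divfK // ltr0_neq0.
Qed.

Lemma act_clique_neg tau s : clique tau -> s \in tau ->
  act (enum tau) (wall s) = - wall s.
Proof.
move=> /cliqueP ct st; have : s \in enum tau by rewrite mem_enum.
have : forall i j, i \in enum tau -> j \in enum tau -> i != j -> adj i j.
  by move=> i j; rewrite !mem_enum; apply: ct.
elim: (enum tau) (enum_uniq (mem tau)) => // t l IH /= /andP[tl Ul] adjl.
have adjl' i j : i \in l -> j \in l -> i != j -> adj i j.
  by move=> il jl; apply: adjl; rewrite inE ?il ?jl orbT.
rewrite -[act _ _]/(reflection (wall t) (act l (wall s))) inE.
case: (eqVneq s t) => [-> _|st' /= sl]; last first.
  rewrite (IH Ul adjl' sl) reflection_fix // mkNl wall_adj ?oppr0 //.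
  by apply: adjl; rewrite ?inE ?eqxx ?sl ?orbT.
rewrite act_near.
  rewrite reflection_wall wall_norm mulr1 -[X in X - _]scale1r -scalerBl.
  have -> : 1 - 2 = -1 :> R by ring.
  by rewrite scaleN1r.
apply/allP => i il; apply: adjl; rewrite ?inE ?eqxx ?il ?orbT //.
by apply: contraNneq tl => ->.
Qed.

(** The vertex of the hypercube farthest from the origin, reached along the letters that are not
    descents yet. *)
Definition top w T : seq 'I_120 := w ++ enum (T :\: descents w).

Lemma top_reduced w T : clique T -> reduced w ->
  reduced (top w T) /\ T \subset descents (top w T).
Proof.
move=> cT rw; have ct := cliqueS (subsetDl T (descents w)) cT.
have dis : [disjoint T :\: descents w & descents w].
  by rewrite -setI_eq0; apply/eqP/setP => t; rewrite !inE; case: (t \in descents w); rewrite ?andbF.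
have [rt ->] := reduced_enum rw ct dis; split=> //.
apply/fintype.subsetP => t tT; rewrite !inE tT andbT.
case: (boolP (t \in descents w)) => //= tD.
apply/forall_inP => r; rewrite inE => /andP[rD rT].
by apply: (cliqueP _ cT) => //; apply: contraNneq rD => ->.
Qed.

(** If the two vertices differed in a letter [s] of [T], the reflection would reverse the sign of
    the product with the wall [s], which is positive for both. *)
Lemma top_unique w w' T : clique T -> reduced w -> reduced w' ->
  T \subset descents w -> T \subset descents w' -> cube w T (vert w') ->
  vert w = vert w'.
Proof.
move=> cT rw rw' /fintype.subsetP TD /fintype.subsetP TD' /(cube_verts cT)[tau tauT E].
have ct := cliqueS tauT cT; rewrite E.
case: (set_0Vmem tau) => [->|[s st]]; first by rewrite enum_set0 cats0.
have sT := fintype.subsetP tauT _ st.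
have := TD _ sT; have := TD' _ sT; rewrite !(descentsP R) //.
rewrite -!act_mkV (vert_act sus E) act_cat act_clique_neg //.
by rewrite /act reflsN mkNl -/(act w _) oppr_gt0 => /lt_trans h /h; rewrite ltxx.
Qed.

Lemma value_le_top w T y : tet T -> reduced w -> cube w T y ->
  (value (vert [::]) y <= value (vert [::]) (vert (top w T)))%N.
Proof.
move=> tT rw wy; have cT := tet_clique tT.
have [w1 yE Ew] := cube_rep sus cT wy.
have [w2 rw2 E2] := reduced_vert us w1; rewrite -E2 in yE.
have X2 : cube w2 T = cube w T by rewrite (cube_ext us T (vert_act sus E2)).
have topin v : cube v T (vert (top v T)).
  by rewrite -(cube_cat us v cT (enum_sub (subsetDl T (descents v)))); apply: vert_cube.
have [rt1 TD1] := top_reduced cT rw; have [rt2 TD2] := top_reduced cT rw2.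
have -> : vert (top w T) = vert (top w2 T).
  apply: (top_unique (T := T)) => //.
  have -> : cube (top w T) T = cube w T by apply: cube_at => //; apply: topin.
  by rewrite -X2; apply: topin.
rewrite yE; case: (boolP (T \subset descents w2)) => [sub|]; last first.
  by move/(value_lt_top sus mosaicP rw2 tT)/ltnW.
rewrite (_ : vert (top w2 T) = vert w2) //; apply: (top_unique (T := T)) => //.
have -> : cube (top w2 T) T = cube w2 T by apply: cube_at => //; apply: topin.
exact: vert_cube.
Qed.

(** Each centre has the largest product with [z] that any hypercube can reach, so the two products
    agree. Equality forces every vertex of the second hypercube with a nonzero coefficient to be
    nearest to the first centre as well. *)
Lemma hull_shared w T w' T' z : tet T -> tet T' -> cone (cube w T) z ->
    cone (cube w' T') z -> exists n (p : 'I_n -> point R) (c : 'I_n -> R),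
  [/\ forall i, cube w' T' (p i), forall i, c i != 0 -> cube w T (p i),
      forall i, 0 <= c i & z = \sum_i c i *: p i].
Proof.
move=> tT tT' [m [q [d [Xq d0 zE]]]] [n [p [c [Xp c0 zE']]]].
exists n, p, c; split=> //.
pose k : R := 1 + 2 * phi.
have pB i : B (p i) (centre w T) <= - k.
  by have [tau _ ->] := cube_verts (tet_clique tT') (Xp i); apply: vert_centre_le.
have le : B z (centre w' T') <= B z (centre w T).
  rewrite zE !mk_suml; apply: ler_sum => j _; rewrite !mkZl.
  rewrite ler_wpM2l // (vert_centre sus tT (Xq j)).
  by have [tau _ ->] := cube_verts (tet_clique tT) (Xq j); apply: vert_centre_le.
have sum0 : \sum_i c i * (- k - B (p i) (centre w T)) <= 0.
  have -> : \sum_i c i * (- k - B (p i) (centre w T)) =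
      B z (centre w' T') - B z (centre w T).
    rewrite zE' !mk_suml -sumrB; apply: eq_bigr => i _.
    by rewrite !mkZl (vert_centre sus tT' (Xp i)) mulrBr.
  by rewrite subr_le0.
have pos i : 0 <= c i * (- k - B (p i) (centre w T)).
  by rewrite mulr_ge0 // subr_ge0.
have /eqP := le_anti (introT andP (conj sum0 (sumr_ge0 _ (fun i _ => pos i)))).
rewrite psumr_eq0 // => /allP h i ci.
have := h i (mem_index_enum i); rewrite mulf_eq0 (negPf ci) /= subr_eq0 => /eqP E.
have [tau _ pE] := cube_verts (tet_clique tT') (Xp i).
have [|//] := vert_centre_lt sus w (w' ++ enum tau) tT.
  by rewrite -pE -E ltxx.
by rewrite -pE.
Qed.

Lemma mk_corner_wall T tau s : clique T -> tau \subset T -> s \in T ->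
  B (corner tau) (wall s) = if s \in tau then 1 else -1.
Proof.
move=> cT tauT sT; rewrite mkC !cornerE mkDr mkZr wall_corner.
case: ifPn => st; first by rewrite mk_wall_sum ?(cliqueS tauT cT) //; ring.
rewrite mk_wall_sum_nbs; first by ring.
by apply: clique_nbs st; apply: cliqueS cT; rewrite subUset sub1set sT.
Qed.

(** Seen from the first vertex, the second is reached by letters of [T']. Without [s] among them,
    its product with the wall [s] could not rise from -1 to 1. *)
Lemma shared_letter w T w' T' tau1 tau2 s : tet T -> tet T' ->
    tau1 \subset T -> tau2 \subset T -> s \in T -> s \notin tau1 -> s \in tau2 ->
    cube w' T' (refls us (act w (corner tau1))) ->
    cube w' T' (refls us (act w (corner tau2))) -> s \in T'.
Proof.
move=> tT tT' sub1 sub2 sT s1 s2; have cT := tet_clique tT.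
have ct1 := cliqueS sub1 cT; rewrite corner_vert // => in1.
rewrite -(cube_at sus (tet_clique tT') in1) => -[tau3 sub3 /(refls_inj sus)].
rewrite act_cat => /act_inj E.
have := mk_corner_wall cT sub2 sT; rewrite s2 E act_mkV act_rev_near; last first.
  apply/allP => t; rewrite mem_enum => tt; apply: (cliqueP _ cT) => //.
    exact: (fintype.subsetP sub1).
  by apply: contraNneq s1 => ->.
case: (boolP (s \in T')) => // sT'.
rewrite mkC !cornerE mkDr wall_corner mkZr => h.
have : B (wall s) (\sum_(t in tau3) wall t) <= 0.
  by apply: mk_wall_sum_le0; apply: contra sT' => /(fintype.subsetP sub3).
lra.
Qed.

(* [z] is located through the signs of its coordinates along the directions of
   the hypercube: a coordinate that is not extremal forces the other hypercube
   to extend in that direction. *)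
Lemma located w T w' T' z (W : {set 'I_120}) : tet T -> tet T' -> cone (cube w T) z ->
    cone (cube w' T') z -> B z (centre w T) < 0 -> W \subset T ->
    (forall s, s \in W -> `|B z (refls us (act w (wall s)))| * (1 + 2 * phi) <
       - B z (centre w T)) ->
    (forall s, s \in T -> s \notin W -> B z (refls us (act w (wall s))) * (1 + 2 * phi) =
       B z (centre w T)) ->
  W \subset T' /\ (exists2 tau : {set 'I_120}, tau \subset W & cube w' T' (refls us (act w (corner tau)))).
Proof.
move=> tT tT' hz hz' neg WT inW outW; have cT := tet_clique tT.
have [n [p [c [Xp Yp c0 zE]]]] := hull_shared tT tT' hz hz'.
have p0 : 0 < 1 + 2 * phi by have := phi_gt0 R; lra.
(* With weights only on vertices of the first hypercube, the product of [z] with the centre is -K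
   phi^3, and its coordinate along [s] is a weighted sum of signs. *)
set K := \sum_i c i.
have zK : B z (centre w T) = - (K * (1 + 2 * phi)).
  rewrite zE mk_suml mulr_suml -sumrN; apply: eq_bigr => i _; rewrite mkZl.
  case: (eqVneq (c i) 0) => [->|ci]; first by rewrite !mul0r oppr0.
  by rewrite (vert_centre sus tT (Yp i ci)) mulrN.
have K0 : 0 < K by move: neg; rewrite zK oppr_lt0 pmulr_lgt0.
pose f s x := B x (refls us (act w (wall s))).
have fz s : f s z = \sum_i c i * f s (p i).
  by rewrite /f zE mk_suml; apply: eq_bigr => i _; rewrite mkZl.
have rep i : c i != 0 -> exists2 tau : {set 'I_120}, tau \subset T &
    p i = refls us (act w (corner tau)) by move=> /Yp[tau ? ?]; exists tau.
have fcorner tau s : tau \subset T -> s \in T ->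
    f s (refls us (act w (corner tau))) = if s \in tau then 1 else -1.
  by move=> sub sT; rewrite /f refls_mk // act_mk (mk_corner_wall cT).
(* A weighted sum of signs strictly between -K and K must involve both signs. *)
have both s : s \in W -> (exists i (tau : {set 'I_120}), [/\ c i != 0, tau \subset T,
      p i = refls us (act w (corner tau)) & s \notin tau]) /\
    (exists i (tau : {set 'I_120}), [/\ c i != 0, tau \subset T,
      p i = refls us (act w (corner tau)) & s \in tau]).
  move=> sW; have sT := fintype.subsetP WT _ sW.
  have : `|f s z| < K.
    by have := inW s sW; rewrite zK opprK -/(f s z) ltr_pM2r.
  rewrite ltr_norml => /andP[lo hi]; split; apply: contrapT => none.
    suff E : f s z = K by rewrite E ltxx in hi.
    rewrite fz; apply: eq_bigr => i _; case: (eqVneq (c i) 0) => [->|ci]; first by rewrite mul0r.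
    have [tau sub pE] := rep i ci; rewrite pE fcorner //.
    case: ifPn => [_|st]; first by rewrite mulr1.
    by case: none; exists i, tau.
  suff E : f s z = - K by rewrite E ltxx in lo.
  rewrite fz -sumrN; apply: eq_bigr => i _.
  case: (eqVneq (c i) 0) => [->|ci]; first by rewrite mul0r oppr0.
  have [tau sub pE] := rep i ci; rewrite pE fcorner //.
  case: ifPn => [st|_]; last by rewrite mulrN1.
  by case: none; exists i, tau.
split.
  apply/fintype.subsetP => s sW; have sT := fintype.subsetP WT _ sW.
  have [[i [tau1 [_ sub1 E1 n1]]] [j [tau2 [_ sub2 E2 n2]]]] := both s sW.
  by apply: (shared_letter (w := w) (w' := w') tT tT' sub1 sub2 sT n1 n2); [rewrite -E1 | rewrite -E2]; apply: Xp.
have [i ci] : exists i, c i != 0.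
  apply: contrapT => none; move: K0; rewrite /K big1 ?ltxx // => i _.
  by apply/eqP; apply: contrapT => /negP ci; apply: none; exists i.
have [tau sub pE] := rep i ci; exists tau; last by rewrite -pE; apply: Xp.
apply/fintype.subsetP => s st; apply: contraT => sW.
have sT := fintype.subsetP sub _ st.
have fK : f s z = - K.
  have := outW s sT sW; rewrite -/(f s z) zK -mulNr => /mulIf; apply.
  by rewrite gt_eqF.
(* The coordinate along [s] is -K, so no vertex with positive weight can have sign +1 there; the
   vertex [p i] would. *)
have : \sum_j c j * (1 + f s (p j)) <= 0.
  rewrite (eq_bigr (fun j => c j + c j * f s (p j))) => [|j _]; last by rewrite mulrDr mulr1.
  by rewrite big_split /= -fz fK subrr.
rewrite leNgt => /negP; case.
rewrite (bigD1 i) //= ltr_pwDl //.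
  by rewrite mulr_gt0 // ?lt0r ?ci ?c0 // pE fcorner // st -lt0r addr_gt0.
apply: sumr_ge0 => j _; case: (eqVneq (c j) 0) => [->|cj]; first by rewrite mul0r.
have [tau' sub' ->] := rep j cj; rewrite mulr_ge0 // fcorner //.
by case: ifP => _; rewrite ?subrr // addr_ge0.
Qed.

End LowerBound.

(** * Convex parts around a square *)

Section ConvexParts.
Variable R : realType.
Local Notation B := (@minkowski R).
Local Notation phi := (phi R).
Local Notation wall := (wall R).
Local Notation corner0 := (corner0 R).
Local Notation corner := (corner R).
Variable us : seq (point R).
Hypothesis sus : spacelike us.
Hypothesis mosaicP : forall k X, mosaic_face k X <->
  exists w U, [/\ clique U, #|U| = k & X = cube us w U].
Variable T0 : {set 'I_120}.
Hypothesis tT0 : tet T0.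
Local Notation vert := (vert us).
Local Notation cube := (cube us).
Local Notation centre := (centre us).
Local Notation valid := (valid T0).
Local Notation apexes := (apexes T0).
Local Notation simplex_cube := (simplex_cube us T0).
Variable S : set (set (point R)).
Hypothesis Smosaic : (S `<=` @mosaic_face R 4)%classic.
Hypothesis Sbase : S (cube [::] T0).
Hypothesis Sgrowth : growth_closed (vert [::]) S.
Hypothesis Sconvex : convex_part S.
Implicit Types (w u : seq 'I_120) (U T tau : {set 'I_120}).

(** For positive multiples of points of the region, geodesic convexity becomes closure under
    addition. *)
Definition region_cone (z : point R) : Prop :=
  exists2 l, 0 < l & (\bigcup_(T in S) hyp_hull T)%classic (l *: z).

Lemma region_cone_vertex X x : S X -> X x -> region_cone x.
Proof.
move=> SX Xx; have [w [T [tT XE]]] := (tet_cubeP mosaicP X).1 (Smosaic SX).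
exists 1; rewrite ?scale1r ?ltr01 //; exists X => //; split; last exact: cone_in.
by move: Xx; rewrite XE; apply: (cube_hyp4 sus (tet_clique tT)).
Qed.

Lemma region_coneD x y : region_cone x -> region_cone y -> region_cone (x + y).
Proof.
move=> [a a0 ra] [b b0 rb].
have [X1 _ [hx _]] := ra; have [X2 _ [hy _]] := rb.
have nz (c : R) : 0 < c -> c != 0 by move=> h; rewrite gt_eqF.
have xE : x = a^-1 *: (a *: x) by rewrite scalerA mulVf ?nz ?scale1r.
have yE : y = b^-1 *: (b *: y) by rewrite scalerA mulVf ?nz ?scale1r.
have xy := hyp4_mk_le0 hx hy.
have [l l0 hl] : exists2 l, 0 < l & hyp4 (l *: (x + y)).
  apply: normalise.
    rewrite xE yE; move: (a *: x) (b *: y) hx hy xy {ra rb xE yE} => p q [p1 _] [q1 _] pq.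
    rewrite !mkE p1 q1 (mkC q); have L0 := level_lt0 R.
    have ia : 0 < a^-1 by rewrite invr_gt0.
    have ib : 0 < b^-1 by rewrite invr_gt0.
    have h1 : a^-1 * (a^-1 * (3 - 2 * phi)) < 0 by rewrite !pmulr_rlt0.
    have h2 : b^-1 * (b^-1 * (3 - 2 * phi)) < 0 by rewrite !pmulr_rlt0.
    have h3 : a^-1 * (b^-1 * B p q) <= 0 by rewrite !pmulr_rle0.
    move: h1 h2 h3; rewrite (mulrCA b^-1); lra.
  move: hx.2 hy.2; rewrite !mxE !pmulr_rgt0 //; lra.
exists l => //; apply: (Sconvex ra rb); split=> //.
rewrite scalerDr; apply: coneD.
  have -> : l *: x = (l / a) *: (a *: x) by rewrite scalerA divfK ?nz.
  apply: coneZ; first by rewrite divr_ge0 ?ltW.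
  by apply: cone_in; left.
have -> : l *: y = (l / b) *: (b *: y) by rewrite scalerA divfK ?nz.
apply: coneZ; first by rewrite divr_ge0 ?ltW.
by apply: cone_in; right.
Qed.

Lemma region_cone_cube z : region_cone z -> exists w T,
  [/\ tet T, S (cube w T) & cone (cube w T) z].
Proof.
move=> [l l0 [X SX [_ hX]]].
have [w [T [tT XE]]] := (tet_cubeP mosaicP X).1 (Smosaic SX).
exists w, T; split; rewrite // -XE //.
have -> : z = l^-1 *: (l *: z) by rewrite scalerA mulVf ?scale1r ?gt_eqF.
by apply: coneZ => //; rewrite invr_ge0 ltW.
Qed.

Lemma cone_corner w T tau : tau \subset T -> cone (cube w T) (refls us (act w (corner tau))).
Proof. by move=> sub; apply: cone_in; exists tau. Qed.

Lemma region_corner w T tau : S (cube w T) -> tau \subset T ->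
  region_cone (refls us (act w (corner tau))).
Proof. by move=> SX sub; apply: (region_cone_vertex SX); exists tau. Qed.

Lemma corner1 q : corner [set q] = corner0 + 2 *: wall q.
Proof. by rewrite !cornerE big_set1. Qed.

Lemma corner2 x y : x != y -> corner [set x; y] = corner0 + 2 *: (wall x + wall y).
Proof. by move=> xy; rewrite !cornerE big_setU1 ?inE //= big_set1. Qed.

Lemma corner3 x y q : x != y -> x != q -> y != q ->
  corner [set x; y; q] = corner0 + 2 *: (wall x + wall y + wall q).
Proof.
move=> xy xq yq; rewrite !cornerE -setUA big_setU1 ?inE ?negb_or ?xy //=.
by rewrite big_setU1 ?inE //= big_set1 addrA.
Qed.

Lemma ring_adjs x y p q r s t : ring_at x y p q r s t ->
  [/\ adj x y, adj x p /\ adj y p, adj x q /\ adj y q, adj x r /\ adj y r &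
     (adj x s /\ adj y s) /\ (adj x t /\ adj y t)].
Proof.
move=> H; have [xy _ _ _] := H.
by split=> //; [| | |split]; apply: (ring_mem H); rewrite !inE eqxx ?orbT.
Qed.

Lemma quad_sum x y a b : tet (quad x y a b) -> adj x y -> adj x a -> adj y a ->
  adj x b -> adj y b -> adj a b ->
  ctr R (quad x y a b) = corner0 + (wall x + wall y + wall a + wall b).
Proof.
move=> tT xy xa ya xb yb ab; rewrite /ctr /quad -!setUA.
rewrite !big_setU1 ?inE ?negb_or ?adj_neq //= ?adj_neq //.
by rewrite big_set1 !addrA.
Qed.

Lemma quad_sub1 x y a b q : q \in quad x y a b -> [set q] \subset quad x y a b.
Proof. by rewrite sub1set. Qed.

Lemma quad_sub3 x y a b q : q \in quad x y a b ->
  [set x; y; q] \subset quad x y a b.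
Proof. by move=> qT; rewrite !subUset !sub1set qT !inE !eqxx ?orbT. Qed.

Section Rules.
Variable w : seq 'I_120.
Local Notation Z T := (S (cube w T)).

Definition place (x : point R) : point R := refls us (act w x).

Lemma placeD x y : place (x + y) = place x + place y.
Proof. by rewrite /place /act !reflsD. Qed.

Lemma place_mk x y : B (place x) (place y) = B x y.
Proof. by rewrite refls_mk // act_mk. Qed.

(** Two vertices are taken from each hypercube, so chosen that the directions [x] and [y] cancel out
    and the point sits over the middle of the square. *)
Lemma region_two x y a b q p : x != y -> x != q -> y != q -> x != p -> y != p ->
  forall a' b', Z (quad x y a b) -> Z (quad x y a' b') ->
  q \in quad x y a b -> p \in quad x y a' b' ->
  region_cone (place (4 *: (corner0 + (wall x + wall y + wall q + wall p)))).
Proof.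
move=> xy xq yq xp yp a' b' Zq Zp qT pT.
have -> : 4 *: (corner0 + (wall x + wall y + wall q + wall p)) =
    (corner [set q] + corner [set x; y; q]) + (corner [set p] + corner [set x; y; p]).
  rewrite !corner1 !corner3 //.
  move: corner0 (wall x) (wall y) (wall q) (wall p) => c u v u' v'.
  by apply/rowP => i; rewrite !mxE; ring.
rewrite placeD (placeD (corner [set q])) (placeD (corner [set p])).
apply: region_coneD; apply: region_coneD.
- exact: (region_corner Zq (quad_sub1 qT)).
- exact: (region_corner Zq (quad_sub3 qT)).
- exact: (region_corner Zp (quad_sub1 pT)).
- exact: (region_corner Zp (quad_sub3 pT)).
Qed.

Lemma quad4 x y a b : [/\ x \in quad x y a b, y \in quad x y a b,
  a \in quad x y a b & b \in quad x y a b].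
Proof. by split; rewrite !inE eqxx ?orbT. Qed.

(** The sum of the four vertices is a multiple of the centre of the missing hypercube. All four
    coordinates are interior there, so by [located] any hypercube containing it has the same four
    directions. *)
Lemma between_cubes x y p q r s t : ring_at x y p q r s t ->
  Z (quad x y p q) -> Z (quad x y r s) -> Z (quad x y q r).
Proof.
move=> H Z1 Z2; have [xy [xp yp] [xq yq] [xr yr] _] := ring_adjs H.
have [_ _ _ [_ qr _ _ _]] := H.
have tT : tet (quad x y q r) by apply: tet_quad.
have cT := tet_clique tT.
have [_ _ _ qin] := quad4 x y p q; have [_ _ rin _] := quad4 x y r s.
have zE : 4 *: (corner0 + (wall x + wall y + wall q + wall r)) =
    4 *: ctr R (quad x y q r) by rewrite quad_sum.
have := region_two (adj_neq xy) (adj_neq xq) (adj_neq yq) (adj_neq xr) (adj_neq yr)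
  Z1 Z2 qin rin.
rewrite zE => /region_cone_cube[w' [T' [tT' ST' hT']]].
have hT : cone (cube w (quad x y q r)) (place (4 *: ctr R (quad x y q r))).
  rewrite -zE.
  have -> : 4 *: (corner0 + (wall x + wall y + wall q + wall r)) =
      (corner [set q] + corner [set x; y; q]) + (corner [set r] + corner [set x; y; r]).
    rewrite !corner1 !corner3 ?adj_neq //.
    move: corner0 (wall x) (wall y) (wall q) (wall r) => c u v u' v'.
    by apply/rowP => i; rewrite !mxE; ring.
  have [_ _ qT rT] := quad4 x y q r.
  rewrite placeD (placeD (corner [set q])) (placeD (corner [set r])).
  apply: coneD; apply: coneD; apply: cone_corner.
  - exact: quad_sub1.
  - exact: quad_sub3.
  - exact: quad_sub1.
  - exact: quad_sub3.
have ctrB : B (place (4 *: ctr R (quad x y q r))) (centre w (quad x y q r)) < 0.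
  have -> : B (place (4 *: ctr R (quad x y q r))) (centre w (quad x y q r)) =
      4 * B (ctr R (quad x y q r)) (ctr R (quad x y q r)) by rewrite place_mk mkZl.
  rewrite pmulr_rlt0 // {1}/ctr mkDl mk_corner0_ctr // mk_suml big1 ?addr0.
    by have := phi_gt0 R; lra.
  by move=> i iT; apply: mk_wall_ctr.
have [||sub [tau tauT Yt]] := @located R us sus w _ w' T' _ (quad x y q r) tT tT' hT hT' ctrB (subxx _).
- move=> i iT; rewrite place_mk mkZl mkC mk_wall_ctr // mulr0 normr0 mul0r.
  by rewrite oppr_gt0.
- by move=> i ->.
have TE := tet_sub_eq tT tT' sub.
have ct := cliqueS tauT cT; rewrite corner_vert // in Yt.
have := cube_at sus (tet_clique tT') Yt; rewrite -TE cube_cat ?enum_sub // => ->.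
by rewrite TE.
Qed.

(** The letters [s] and [p] are the two apexes on the triangle x, y, t, so [wall_flip] rewrites the
    sum of the four vertices as a point of the facet common to the two missing hypercubes. It is
    interior to that facet, and a hypercube containing it is one of the two. *)
Lemma reflex_cubes x y p q r s t : ring_at x y p q r s t ->
  Z (quad x y p q) -> Z (quad x y r s) -> Z (quad x y s t) \/ Z (quad x y t p).
Proof.
move=> H Z1 Z2; have [xy [xp yp] _ _ [[xs ys] [xt yt]]] := ring_adjs H.
have [_ U _ [_ _ _ st tp]] := H.
have sp : s != p.
  by move: U; rewrite /= !inE !negb_or => /andP[/and4P[_ _ + _] _]; rewrite eq_sym.
set T := quad x y s t; have tT : tet T by apply: tet_quad.
have cT := tet_clique tT; have [xT yT sT tT1] := quad4 x y s t.
have [_ _ pin _] := quad4 x y p q; have [_ _ _ sin] := quad4 x y r s.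
have WE : T :\ s = [set x; y; t].
  apply/setP => i; rewrite !inE; case: (eqVneq i s) => [->|_] /=; last by rewrite orbF.
  by rewrite ![s == _]eq_sym (negPf (adj_neq xs)) (negPf (adj_neq ys)) eq_sym (negPf (adj_neq st)).
have pN : p \in nbs (T :\ s).
  by rewrite WE; apply/nbsP => i; rewrite !inE => /orP[/orP[]|] /eqP->.
have ps : p != s by rewrite eq_sym.
have flip := wall_flip R tT sT ps pN.
have sumW : \sum_(i in T :\ s) wall i = wall x + wall y + wall t.
  rewrite WE -setUA !big_setU1 ?inE ?negb_or ?adj_neq //= big_set1 addrA //.
rewrite sumW in flip.
pose z := (4 * phi) *: corner0 + (4 * phi) *: (wall x + wall y) + (4 * (phi - 1)) *: wall t.
have zE : 4 *: (corner0 + (wall x + wall y + wall s + wall p)) = z.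
  rewrite -[wall x + wall y + wall s + wall p]addrA flip /z.
  move: corner0 (wall x) (wall y) (wall t) => c u v u'.
  by apply/rowP => i; rewrite !mxE; ring.
have := region_two (adj_neq xy) (adj_neq xs) (adj_neq ys) (adj_neq xp) (adj_neq yp)
  Z2 Z1 sin pin.
rewrite zE => /region_cone_cube[w' [T' [tT' ST' hT']]].
have p1 := phi_gt1 R; have q0 := phi_gt0 R.
have q1 : 0 < 1 + 2 * phi by rewrite addr_gt0 // mulr_gt0.
have phi1 : 0 <= phi + 1 by rewrite addr_ge0 // ltW.
have phi1m : 0 <= phi - 1 by rewrite subr_ge0 ltW.
(* None of the four vertices used involves [s], which puts the point on the facet missing this
   direction. *)
have hT : cone (cube w T) (place z).
  have -> : z = (phi + 1) *: (corner set0 + corner [set x; y]) +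
      (phi - 1) *: (corner [set t] + corner [set x; y; t]).
    rewrite corner_set0 corner1 corner2 ?corner3 ?adj_neq //.
    rewrite /z; move: corner0 (wall x) (wall y) (wall t) => c u v u'.
    by apply/rowP => i; rewrite !mxE; ring.
  have placeZ a v : place (a *: v) = a *: place v by rewrite /place /act !reflsZ.
  rewrite placeD !placeZ (placeD (corner set0)) (placeD (corner [set t])); apply: coneD; (apply: coneZ => //; apply: coneD).
  - by apply: cone_corner; apply: finset.sub0set.
  - by apply: cone_corner; rewrite subUset !sub1set xT yT.
  - by apply: cone_corner; apply: quad_sub1.
  - by apply: cone_corner; apply: quad_sub3.
have zB v : B z v = 4 * phi * B corner0 v + 4 * phi * (B (wall x) v + B (wall y) v) +
    4 * (phi - 1) * B (wall t) v by rewrite /z !mkE.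
have K0 : 0 < 4 * phi * (1 + 2 * phi) by rewrite mulr_gt0 // mulr_gt0.
have zctr : B (place z) (centre w T) = - (4 * phi * (1 + 2 * phi)).
  rewrite place_mk zB mk_corner0_ctr // !mk_wall_ctr //; ring.
have zneg : B (place z) (centre w T) < 0.
  by rewrite zctr oppr_lt0 K0.
have a0 i j : adj i j -> B (wall i) (wall j) = 0 /\ B (wall j) (wall i) = 0.
  by move=> ij; rewrite !wall_adj // adj_sym.
have [Exy Eyx] := a0 _ _ xy; have [Exs Esx] := a0 _ _ xs; have [Eys Esy] := a0 _ _ ys.
have [Ext Etx] := a0 _ _ xt; have [Eyt Ety] := a0 _ _ yt; have [Est Ets] := a0 _ _ st.
have bx : B z (wall x) = 0.
  by rewrite zB (mkC corner0) wall_corner wall_norm Eyx Etx; ring.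
have by_ : B z (wall y) = 0.
  by rewrite zB (mkC corner0) wall_corner wall_norm Exy Ety; ring.
have bt : B z (wall t) = -4.
  by rewrite zB (mkC corner0) wall_corner wall_norm Ext Eyt; ring.
have bs : B z (wall s) = - (4 * phi).
  by rewrite zB (mkC corner0) wall_corner Exs Eys Ets; ring.
have [||sub [tau tauW Yt]] :=
    @located R us sus w _ w' T' _ (T :\ s) tT tT' hT hT' zneg (subsetDl _ _).
- move=> i; rewrite WE zctr opprK !inE => /orP[/orP[]|] /eqP->; rewrite place_mk.
  + by rewrite bx normr0 mul0r.
  + by rewrite by_ normr0 mul0r.
  + rewrite bt normrN ger0_norm // ltr_pM2r //.
    by rewrite -[X in X < _]mulr1 ltr_pM2l.
- move=> i iT; rewrite inE iT andbT inE negbK => /eqP->.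
  by rewrite place_mk bs zctr mulNr.
have tauT' : tau \subset T' by apply: fintype.subset_trans sub.
have ct' := cliqueS tauT' (tet_clique tT'); rewrite corner_vert // in Yt.
have := cube_at sus (tet_clique tT') Yt; rewrite cube_cat ?enum_sub ?tet_clique // => XE.
have [|r' r'T r'W] := card_setD sub; first by rewrite tet_cardD1 // (tet_card tT').
have T'E : T' = r' |: T :\ s.
  apply/eqP; rewrite eq_sym eqEcard subUset sub1set r'T sub.
  by rewrite cardsU1 r'W tet_cardD1 // (tet_card tT').
have r'N : r' \in nbs (T :\ s) := tet_sub_nbs tT' sub r'T r'W.
have [s2 [s2s s2T N _]] := flip_exists tT sT.
have ps2 : p = s2.
  by move: pN; rewrite N !inE (negPf ps) => /eqP.
move: r'N; rewrite N !inE -ps2 => /orP[/eqP r's|/eqP r'p].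
  by left; move: ST'; rewrite -XE T'E r's setD1K.
right; move: ST'; rewrite -XE T'E r'p WE.
by rewrite (_ : p |: _ = quad x y t p) // /quad setUC.
Qed.

End Rules.

(** Induction on the length. The hypercubes at the longer word in the direction of its last letter
    [s] are hypercubes at the shorter word; growth adds those across their facets without the
    direction [s], and [percolate] gives all the others. *)
Lemma simplex_cube_sub w T : valid w -> tet T -> apexes w \subset T -> S (cube w T).
Proof.
have [n] := ubnP (size w); elim: n w T => // n IH w T lt_n vw tT AT.
case: (lastP w) lt_n vw AT => [_ _|{}w s lt_n vw AT].
  by rewrite apexes_nil => sub; rewrite -(tet_sub_eq tT0 tT sub).
have rw := valid_reduced vw.
have sD : s \in descents (rcons w s) by rewrite descents_rcons in_dstep eqxx.
have cA : clique (apexes (rcons w s)).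
  by apply: cliqueS (tet_clique tT0); apply/fintype.subsetP => a; rewrite inE => /andP[].
have sA : s \in nbs (apexes (rcons w s)).
  by apply/nbsP => a aA; apply: apexes_descents aA sD.
move: (vw); rewrite valid_rcons => /and3P[vw0 _ /forall_inP vA].
have inS U : tet U -> s |: apexes (rcons w s) \subset U -> S (cube (rcons w s) U).
  move=> tU; rewrite subUset sub1set => /andP[sU AU].
  rewrite cube_rcons ?tet_clique //; apply: IH => //.
    by move: lt_n; rewrite size_rcons.
  apply/fintype.subsetP => a aA; have /orP[/eqP<-//|as_] := vA a aA.
  by apply: (fintype.subsetP AU); rewrite apexes_rcons inE aA.
apply: (percolate (Z := fun U => S (cube (rcons w s) U)) _ _ cA sA) AT => //.
- exact: between_cubes.
- exact: reflex_cubes.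
move=> U U' tU sub tU' sub'.
pose x := vert (top (rcons w s) U); have cU := tet_clique tU.
have DsU : U :\: descents (rcons w s) \subset U :\ s.
  apply/fintype.subsetP => i; rewrite !inE => /andP[iD iU]; rewrite iU andbT.
  by apply: contraNneq iD => ->.
(* As [s] is already a descent, the top of [U] is reached by letters of [U] other than [s], hence is
   a vertex of the hypercube of [U'] too. *)
apply: (Sgrowth (inS U tU sub) (x := x)).
- rewrite -(cube_cat us (rcons w s) cU (enum_sub (subsetDl U (descents (rcons w s))))).
  exact: vert_cube.
- by move=> y; apply: (value_le_top sus mosaicP).
- by apply/mosaicP; exists (rcons w s), U'; rewrite tet_clique ?tet_card.
- rewrite -(cube_cat us (rcons w s) (tet_clique tU') (enum_sub (fintype.subset_trans DsU sub'))).
  exact: vert_cube.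
Qed.

End ConvexParts.

Lemma pascal_simplexP (R : realType) us T0 (X : set (point R)) : spacelike us ->
  (forall k X, mosaic_face k X <->
    exists w U, [/\ clique U, #|U| = k & X = cube us w U]) -> tet T0 ->
  pascal_simplex (vert us [::]) (cube us [::] T0) X <-> simplex_cube us T0 X.
Proof.
move=> sus mosaicP tT0; split=> [|[w [T [vw tT AT ->]]] S Sm Sb Sg Sc].
  exact: pascal_sub.
exact: (simplex_cube_sub sus mosaicP tT0 Sm Sb Sg Sc vw tT AT).
Qed.

Lemma set_card_between (U T : {set 'I_120}) k : U \subset T ->
  (#|T| <= k + #|U|)%N -> (k <= #|T|)%N -> exists2 W : {set 'I_120}, #|W| = k & W :|: U = T.
Proof.
move=> UT le1 le2; pose V := [set x in take (#|T| - k) (enum U)].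
have VU : V \subset U.
  by apply/fintype.subsetP => x; rewrite inE => /mem_take; rewrite mem_enum.
have cV : #|V| = (#|T| - k)%N.
  rewrite cardsE (card_uniqP (take_uniq _ (enum_uniq _))) size_takel //.
  by rewrite -cardE leq_subLR.
exists (T :\: V).
  by rewrite cardsD (setIidPr (fintype.subset_trans VU UT)) cV subKn.
apply/setP => x; rewrite !in_setU in_setD.
have := fintype.subsetP UT x; have := fintype.subsetP VU x.
by case: (x \in V) (x \in U) (x \in T) => [] [] [] //= h1 h2; rewrite ?h1 ?h2.
Qed.

(** If [U] is smaller than a tetrahedron containing it, flipping a letter outside [U] yields a
    second one. *)
Lemma uniq_tet (U : {set 'I_120}) : clique U ->
  (exists! T : {set 'I_120}, tet T /\ U \subset T) <-> tet U.
Proof.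
move=> cU; split=> [[T [[tT UT] uT]]|tU]; last first.
  by exists U; do !split=> // T [tT UT]; apply: tet_sub_eq.
case: (eqVneq U T) => [->//|UT'].
have /subsetPn[s sT sU] : ~~ (T \subset U).
  by apply: contra UT' => TU; rewrite eqEsubset UT.
have [s' [s's s'T _ tT']] := flip_exists tT sT.
have /finset.setP/(_ s') : T = s' |: T :\ s; last by rewrite !inE eqxx (negPf s'T).
apply: uT; split=> //.
apply/fintype.subsetP => i iU; rewrite !inE (fintype.subsetP UT) // andbT.
by rewrite (contraNneq _ sU) ?orbT // => <-.
Qed.

(** * Levels and vertex types *)

Section Levels.
Variable R : realType.
Variable us : seq (point R).
Hypothesis sus : spacelike us.
Hypothesis mosaicP : forall k X, mosaic_face k X <->
  exists w U, [/\ clique U, #|U| = k & X = cube us w U].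
Variable T0 : {set 'I_120}.
Hypothesis tT0 : tet T0.
Local Notation vert := (vert us).
Local Notation cube := (cube us).
Local Notation valid := (valid T0).
Local Notation apexes := (apexes T0).
Local Notation V0 := (vert [::]).
Local Notation Q0 := (cube [::] T0).
Implicit Types (w u : seq 'I_120) (U T tau : {set 'I_120}).

Definition star U : {set 'I_120} := U :|: nbs U.

Lemma clique_apexes w : clique (apexes w).
Proof.
by apply: cliqueS (tet_clique tT0); apply/fintype.subsetP => a; rewrite inE => /andP[].
Qed.

Lemma star_clique U s : clique U -> (s \in star U) = clique (U :|: [set s]).
Proof.
move=> cU; rewrite inE setUC; case: (boolP (s \in U)) => [sU|sU] /=.
  by rewrite (setUidPr _) ?sub1set.
by apply/idP/idP => [|/clique_nbs]; [apply: cliqueU1 | apply].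
Qed.

Lemma mosaic_face_at k X w : mosaic_face k X -> X (vert w) ->
  exists U, [/\ clique U, #|U| = k & X = cube w U].
Proof.
move=> /mosaicP[w' [U [cU kU ->]]] /(cube_at sus cU) <-.
by exists U.
Qed.

Lemma pascal_cube_at w X : reduced w -> X (vert w) -> pascal_simplex V0 Q0 X <->
  exists T, [/\ valid w, tet T, apexes w \subset T & X = cube w T].
Proof.
move=> rw Xw; rewrite (pascal_simplexP X sus mosaicP tT0); split=> [SX|[T [vw tT AT ->]]].
  have [w1 [T [_ tT _ XE]]] := SX.
  have E : X = cube w T by rewrite XE in Xw *; rewrite (cube_at sus (tet_clique tT) Xw).
  by rewrite E in SX *; have [] := simplex_cube_at sus tT rw SX; exists T.
by exists w, T.
Qed.

Lemma pascal_face_at k w U : reduced w -> clique U -> #|U| = k ->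
  pascal_face V0 Q0 k (cube w U) <-> valid w /\ clique (apexes w :|: U).
Proof.
move=> rw cU kU; split=> [[_ [X SX sub]]|[vw cAU]].
  have Xw : X (vert w) by apply: sub; apply: vert_cube.
  have [T [vw tT AT XE]] := (pascal_cube_at rw Xw).1 SX.
  split=> //; apply: cliqueS (tet_clique tT); rewrite subUset AT /=.
  by apply/(cube_subset sus w cU (tet_clique tT)); rewrite -XE.
have [T tT] := tet_extend cAU; rewrite subUset => /andP[AT UT].
split; first by apply/mosaicP; exists w, U.
exists (cube w T); first by apply/(pascal_cube_at rw (vert_cube _ _ _)); exists T.
by apply/(cube_subset sus w cU (tet_clique tT)).
Qed.

Lemma pascal_edgeC x y : pascal_edge V0 Q0 x y -> pascal_edge V0 Q0 y x.
Proof. by rewrite /pascal_edge classical_sets.setUC. Qed.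

Lemma pascal_edgeP w y : reduced w -> pascal_edge V0 Q0 (vert w) y <->
  valid w /\ exists2 s, s \in star (apexes w) & y = vert (rcons w s).
Proof.
move=> rw; split=> [H|[vw [s sA ->]]]; last first.
  rewrite /pascal_edge -(cube1 sus); apply/(pascal_face_at rw (clique1 s) (cards1 s)).
  by split; rewrite // -star_clique ?clique_apexes.
have [H1 _] := H.
have [|U [cU /eqP/cards1P[s US] E]] := mosaic_face_at (w := w) H1; first by left.
rewrite /pascal_edge E US in H.
have [vw cAU] := (pascal_face_at rw (clique1 s) (cards1 s)).1 H.
split=> //; exists s; first by rewrite star_clique ?clique_apexes.
have : (cube w U)%classic (vert (rcons w s)) by rewrite US (cube1 sus); right.
rewrite -E => -[] // F; have := vert_rcons_neq sus w s.
by rewrite F eqxx.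
Qed.

Lemma mosaic_edge_pascal x y : pascal_edge V0 Q0 x y -> mosaic_edge x y.
Proof. by case. Qed.

Lemma track_pascal w u : valid (w ++ u) ->
  path (fun x y => `[< pascal_edge V0 Q0 x y >]) (vert w) (track us w u).
Proof.
elim: u w => //= s u IH w; rewrite -cat_rcons => vws; rewrite IH // andbT.
have := valid_cat vws; rewrite valid_rcons => /and3P[vw _ /forall_inP vA].
apply/asboolP/(pascal_edgeP _ (valid_reduced vw)); split=> //; exists s => //.
rewrite inE; case: (boolP (s \in apexes w)) => //= sA; apply/nbsP => a aA.
by have /orP[/eqP sa|//] := vA a aA; rewrite -sa (negPf sA) in aA.
Qed.

(** All prefixes of a valid word are valid, so the geodesics of the mosaic stay in the simplex and
    distances along its edges are word lengths. *)
Lemma levelP n x : level V0 Q0 n x <->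
  exists w, [/\ valid w, size w = n & x = vert w].
Proof.
have tracks p y : paths (pascal_edge V0 Q0) V0 y p -> exists2 u, p = track us [::] u & y = vert u.
  move=> [pth <-]; have [u E] := path_track sus mosaicP mosaic_edge_pascal pth.
  by exists u; rewrite // E last_track.
have far w u : valid w -> vert w = vert u -> (size w <= size u)%N.
  move=> /valid_reduced rw E; apply: (@reduced_size_le R) => //.
  exact: (vert_act sus).
have trackw w : valid w -> paths (pascal_edge V0 Q0) V0 (vert w) (track us [::] w).
  by move=> vw; split; [apply: track_pascal | rewrite last_track].
split=> [[p [pxp minp] sp]|[w [vw <- ->]]]; last first.
  exists (track us [::] w); last exact: size_track.
  split; first exact: trackw.
  move=> q /tracks[u -> E]; rewrite !size_track; apply: far vw E.
have [u E xE] := tracks _ _ pxp; have [w rw Ew] := reduced_vert us u.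
have vw : valid w.
  case/lastP: p => [|p y] in pxp {minp sp E}.
    move: pxp => [_ E]; apply: (valid_eq sus rw _ (valid_nil _)).
    by rewrite Ew -xE -E.
  move: pxp => [+ E]; rewrite rcons_path last_rcons in E * => /andP[_ /asboolP].
  by rewrite E xE -Ew => /pascal_edgeC/(pascal_edgeP _ rw)[].
exists w; split=> //; last by rewrite xE Ew.
apply/eqP; rewrite -sp eqn_leq E size_track far ?Ew //=.
by have := trackw w vw; rewrite Ew -xE => /minp; rewrite E !size_track.
Qed.

Lemma level_vert n w : reduced w -> level V0 Q0 n (vert w) <-> valid w /\ size w = n.
Proof.
move=> rw; rewrite levelP; split=> [[w' [vw' <- E]]|[vw sw]]; last by exists w.
split; first by apply: (valid_eq sus rw (esym E)).
by apply: (@reduced_size_eq R) => //; [apply: valid_reduced vw' | apply: (vert_act sus)].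
Qed.

Lemma degree_vert w : valid w -> degree V0 Q0 (vert w) = #|star (apexes w)|.
Proof.
move=> vw; have rw := valid_reduced vw.
rewrite /degree -(card_fset_set_image (f := fun s => vert (rcons w s))); last first.
  by move=> s t _ _; apply: (vert_rcons_inj sus).
congr #|` fset_set _|; apply/seteqP; split=> y /=.
  by move/pascal_edgeC/(pascal_edgeP _ rw) => [_ [s sA ->]]; exists s.
by case=> s sA <-; apply/pascal_edgeC/(pascal_edgeP _ rw); split=> //; exists s.
Qed.

Lemma descents_star w : descents w \subset star (apexes w).
Proof.
apply/fintype.subsetP => s sD; rewrite inE; apply/orP; right.
by apply/nbsP => a aA; apply: (apexes_descents aA).
Qed.

Lemma incoming_vert w : valid w -> incoming V0 Q0 (vert w) = #|descents w|.
Proof.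
move=> vw; have rw := valid_reduced vw.
rewrite /incoming -(card_fset_set_image (f := fun s => vert (rcons w s))); last first.
  by move=> s t _ _; apply: (vert_rcons_inj sus).
congr #|` fset_set _|; apply/seteqP; split=> y /=.
  move=> [/pascal_edgeC/(pascal_edgeP _ rw)[_ [s sA ->]] [m [ly lx]]]; exists s => //.
  apply/negPn/negP => sD.
  have rws : reduced (rcons w s) by rewrite reduced_rcons rw.
  have [_] := (level_vert _ rws).1 ly; have [_ sw] := (level_vert _ rw).1 lx.
  by rewrite size_rcons sw => /eqP; rewrite -[m in X in _ == X]addn0 -addn2 eqn_add2l.
case=> s sD <-; split.
  apply/pascal_edgeC/(pascal_edgeP _ rw); split=> //; exists s => //.
  exact: (fintype.subsetP (descents_star w)).
have [w' [rw' sw E]] := exchange R rw sD.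
have E' : vert (rcons w s) = vert w'.
  apply: eq_vert => x; rewrite (act_rcons_eq s E); apply: act_rconsK.
have vw's : valid (rcons w' s) by apply: (valid_eq sus rw' _ vw); apply: eq_vert.
have vw' : valid w' by move: vw's; rewrite -cats1 => /valid_cat.
exists (size w'); rewrite E' -sw; split; apply/level_vert => //.
exact: valid_reduced vw'.
Qed.

(** The hypercubes of the simplex on a face [U] at [w] are the tetrahedra containing the apexes and
    [U]. There is a single one exactly when these letters already form a tetrahedron, which k
    letters can achieve only if at least 4 - k apexes are given. *)
Lemma on_cone_face_vert k w : (k <= 4)%N -> valid w ->
  on_cone_face V0 Q0 k (vert w) <-> (4 - k <= #|apexes w|)%N.
Proof.
move=> k4 vw; have rw := valid_reduced vw.
have cA := clique_apexes w.
have uniqP U : clique U ->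
    (exists! X, pascal_simplex V0 Q0 X /\ (cube w U `<=` X)%classic) <-> tet (apexes w :|: U).
  move=> cU; split=> [[X [[SX sub] uX]]|tAU].
    have Xw : X (vert w) by apply: sub; apply: vert_cube.
    have [T [_ tT AT XE]] := (pascal_cube_at rw Xw).1 SX.
    rewrite XE (cube_subset sus w cU (tet_clique tT)) in sub.
    have AUT : apexes w :|: U \subset T by rewrite subUset AT.
    apply/uniq_tet; first exact: cliqueS AUT (tet_clique tT).
    exists T; split=> // T' [tT']; rewrite subUset => /andP[AT' UT'].
    apply: (cube_inj sus (tet_clique tT) (tet_clique tT') (w := w)); rewrite -XE; apply: uX; split.
      by apply/(pascal_cube_at rw (vert_cube _ _ _)); exists T'.
    by apply/(cube_subset sus w cU (tet_clique tT')).
  exists (cube w (apexes w :|: U)); split.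
    split; first by apply/(pascal_cube_at rw (vert_cube _ _ _)); exists (apexes w :|: U); rewrite finset.subsetUl.
    by apply/(cube_subset sus w cU (tet_clique tAU)); rewrite finset.subsetUr.
  move=> X [SX sub].
  have Xw : X (vert w) by apply: sub; apply: vert_cube.
  have [T [_ tT AT XE]] := (pascal_cube_at rw Xw).1 SX.
  rewrite XE (cube_subset sus w cU (tet_clique tT)) in sub.
  by rewrite XE (tet_sub_eq tAU tT) // subUset AT.
split=> [[X [mX Xw uX]]|le].
  have [U [cU kU XE]] := mosaic_face_at mX Xw.
  rewrite XE in uX; have /andP[_ /eqP c4] := (uniqP U cU).1 uX.
  move: c4; rewrite cardsU kU; move: #|apexes w| #|_ :&: _| => a i c4.
  by rewrite -c4 leq_subLR addnC leq_subr.
have AT0 : apexes w \subset T0 by apply/fintype.subsetP => a; rewrite inE => /andP[].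
have [||U kU UA] := @set_card_between _ _ k AT0.
- by rewrite (tet_card tT0) -leq_subLR.
- by rewrite (tet_card tT0).
have cU : clique U by apply: cliqueS (tet_clique tT0); rewrite -UA finset.subsetUl.
exists (cube w U); split.
- by apply/mosaicP; exists w, U.
- exact: vert_cube.
- by apply/uniqP; rewrite // setUC UA.
Qed.

Lemma card_star U : clique U -> #|star U| = nth 0%N [:: 120; 13; 7; 5; 4] #|U|.
Proof.
move=> cU; rewrite cardsU; have [-> le4] := card_nbs cU.
have -> : U :&: nbs U = set0.
  apply/setP => i; rewrite in_setI in_set0; apply/negP => /andP[iU /nbs_notin].
  by rewrite iU.
rewrite cards0; move: #|U| le4; do 5 case=> //.
Qed.

Lemma of_type_vert t w : valid w -> of_type V0 Q0 t (vert w) <->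
  #|apexes w| = (4 - type_face_dim t)%N /\ #|descents w| = type_incoming t.
Proof.
move=> vw; have [d4 d4'] : ((type_face_dim t <= 4) /\ ((type_face_dim t).-1 <= 4))%N by case: t.
have onP := on_cone_face_vert d4 vw; have offP := on_cone_face_vert d4' vw.
have [_ le4] := card_nbs (clique_apexes w).
rewrite /of_type /in_cone_face_interior /= degree_vert // incoming_vert //.
rewrite card_star ?clique_apexes //.
split=> [[[/onP h1 h2] _ ->]|[h ->]].
  split=> //; move: h1 {onP} (fun h => h2 (offP.2 h)) => {h2 offP}.
  by case: t d4 d4' => /=; move: #|apexes w| le4; do 5 case=> //.
split=> //; [split; [apply/onP | move/offP] | ]; rewrite h; by case: t d4 d4' {onP offP h}.
Qed.

(** Both sides count the pairs of a vertex and a reduced word for it, since validity and [P] depend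
    only on the vertex. *)
Lemma value_sum_level n (P : set (point R)) (p : pred (seq 'I_120)) :
  (forall w, valid w -> P (vert w) <-> p w) ->
  value_sum V0 (level V0 Q0 n `&` P)%classic =
    Z.of_nat #|[set w : n.-tuple 'I_120 | valid w && p w]|.
Proof.
move=> Pp; congr Z.of_nat; set A := (_ `&` _)%classic.
have AP x : A x <-> exists w : n.-tuple 'I_120, valid w && p w /\ vert w = x.
  split=> [[/levelP[w [vw sw ->]] /(Pp w vw) pw]|[w [/andP[vw pw] <-]]].
    by exists (Tuple (introT eqP sw)); rewrite /= vw.
  by split; [apply/levelP; exists w; rewrite size_tuple | apply/(Pp w vw)].
have finA : finite_set A.
  apply: (@sub_finite_set _ _ [set vert (tval w) | w in [set: n.-tuple 'I_120]]%classic).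
    by move=> x /AP[w [_ <-]]; exists w.
  exact: finite_image.
rewrite fsbig_finite //=.
rewrite -sum1_card.
under [RHS]eq_bigl do rewrite inE.
transitivity (\sum_(x <- fset_set A) \sum_(w : n.-tuple 'I_120 | valid w && p w) (vert w == x : nat))%N.
  rewrite big_seq [RHS]big_seq; apply: eq_bigr => x.
  rewrite in_fset_set // => /set_mem /AP[w [/andP[vw pw] <-]].
  rewrite (value_geodesics sus mosaicP (valid_reduced vw) (size_tuple w)).
  rewrite -sum1_card big_mkcond [RHS]big_mkcond /=; apply: eq_bigr => u _.
  rewrite inE; case: (eqVneq (vert u) (vert w)) => [E|_]; last by rewrite andbF; case: ifP.
  rewrite andbT; case: (boolP (reduced u)) => ru /=.
    have vu : valid u by apply: (valid_eq sus ru (esym E) vw).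
    rewrite vu /=; suff -> : p u by [].
    by apply/(Pp u vu); rewrite E; apply/(Pp w vw).
  by case: (boolP (valid u)) => [/valid_reduced|//]; rewrite (negPf ru).
rewrite exchange_big /=; apply: eq_bigr => w pw.
rewrite (bigD1_seq (vert w)) ?fset_uniq //=; last first.
  by rewrite in_fset_set //; apply/mem_set/AP; exists w.
by rewrite eqxx big1 // => x; rewrite eq_sym => /negPf->.
Qed.

End Levels.

Local Open Scope nat_scope.

Lemma sum_tuple_rcons (T : finType) n (F : n.+1.-tuple T -> nat) :
  \sum_t F t = \sum_(t : n.-tuple T) \sum_(x : T) F [tuple of rcons t x].
Proof.
rewrite pair_big (reindex (fun p : n.-tuple T * T => [tuple of rcons p.1 p.2])) //=.
apply: onW_bij; apply: inj_card_bij.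
  move=> [t x] [t' x'] /(congr1 val) /= /rcons_inj[/val_inj-> ->] //.
by rewrite card_prod !card_tuple expnSr.
Qed.

(** * Counting successors *)

Section Profile.
Variables A D : {set 'I_120}.
Hypothesis cAD : clique (A :|: D).
Hypothesis DA : D \subset nbs A.

(** The number of old last letters that survive the letter [s]; the new word has one descent more,
    namely [s]. *)
Definition degree_in s : nat := #|[set t in D | adj s t]|.
Definition profile j : nat := #|[set s in nbs A :\: D | degree_in s == j]|.

Lemma cardU_disjoint (E : {set 'I_120}) : E \subset D -> #|A :|: E| = (#|A| + #|E|)%N.
Proof.
move=> ED; rewrite cardsU (_ : A :&: E = set0) ?cards0 ?subn0 //.
apply/setP => i; rewrite in_setI in_set0; apply/negP => /andP[iA iE].
have := nbs_notin (fintype.subsetP DA i (fintype.subsetP ED i iE)); by rewrite iA.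
Qed.

Lemma card_le4 : #|A| + #|D| <= 4.
Proof. by rewrite -cardU_disjoint //; apply: clique_le4. Qed.

Lemma degree_in_le s : degree_in s <= #|D|.
Proof. by apply: subset_leq_card; apply/fintype.subsetP => t; rewrite inE => /andP[]. Qed.

Lemma degree_in_self s : s \in D -> degree_in s = #|D|.-1.
Proof.
move=> sD; rewrite (cardsD1 s D) sD /=; apply: eq_card => t; rewrite !inE.
case: (eqVneq t s) => [->|ts]; first by rewrite adjxx andbF.
case: (boolP (t \in D)) => //= tD; apply: (cliqueP _ cAD); rewrite 1?eq_sym //.
  by rewrite inE sD orbT.
by rewrite inE tD orbT.
Qed.

(** Double counting of the pairs of [s] and an i-element subset E of [D] commuting with it: for a
    given E these [s] are the common neighbours of the clique formed by [A] and E. *)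
Lemma sum_degree_in i : \sum_(s in nbs A) 'C(degree_in s, i) =
  'C(#|D|, i) * nth 0 [:: 120; 12; 5; 2] (#|A| + i).
Proof.
under eq_bigr => s _ do rewrite -cards_draws -sum1_card.
rewrite (exchange_big_dep [pred E : {set 'I_120} | (E \subset D) && (#|E| == i)]) /=; last first.
  move=> s E _; rewrite inE => /andP[ED ->]; rewrite andbT.
  by apply: fintype.subset_trans ED _; apply/fintype.subsetP => t; rewrite inE => /andP[].
rewrite -cards_draws -sum_nat_const /=.
apply: eq_big => E; first by rewrite inE.
move=> /andP[ED /eqP Ei].
have cAE : clique (A :|: E) by apply: cliqueS cAD; apply: setUS.
have [cN _] := card_nbs cAE.
rewrite -Ei -cardU_disjoint // -cN -sum1_card; apply: eq_bigl => s.
rewrite [E \in _]inE eqxx andbT; apply/andP/idP => [[/nbsP sA sE]|/nbsP sAE].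
  apply/nbsP => t; rewrite inE => /orP[/sA //|/(fintype.subsetP sE)].
  by rewrite inE adj_sym => /andP[].
split; first by apply/nbsP => t tA; apply: sAE; rewrite inE tA.
apply/fintype.subsetP => t tE; rewrite inE (fintype.subsetP ED) //= adj_sym.
by apply: sAE; rewrite inE tE orbT.
Qed.

(** A letter of [D] commutes with all the others in [D], which gives the separate term. What remains
    is the i-th binomial moment of the profile, and the moments up to 4 determine it. *)
Lemma sum_profile i : \sum_(j <- iota 0 5) profile j * 'C(j, i) + #|D| * 'C(#|D|.-1, i) =
  'C(#|D|, i) * nth 0 [:: 120; 12; 5; 2] (#|A| + i).
Proof.
rewrite -sum_degree_in (big_setID D) /= (setIidPr DA) addnC; congr addn.
  rewrite -sum_nat_const; apply: eq_bigr => s sD.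
  by rewrite degree_in_self.
under eq_bigr => j _ do rewrite /profile -sum1_card big_distrl /=.
rewrite (exchange_big_dep [in nbs A :\: D]) /=; last first.
  by move=> j s _; rewrite inE => /andP[].
apply: eq_bigr => s sN.
under eq_bigl => j do rewrite inE sN /= eq_sym.
have le4 : degree_in s < 5.
  by rewrite ltnS (leq_trans (degree_in_le s)) // (leq_trans _ card_le4) // leq_addl.
rewrite -big_filter (_ : [seq j <- _ | _] = [:: degree_in s]) ?big_seq1 ?mul1n //.
by move: (degree_in s) le4; do 5 case=> //.
Qed.

Definition profile_table (a d : nat) : seq nat :=
  match a, d with
  | 3, 1 => [:: 1]
  | 2, 2 => [:: 1; 2] | 2, 1 => [:: 2; 2]
  | 1, 3 => [:: 3; 3; 3] | 1, 2 => [:: 4; 4; 2] | 1, 1 => [:: 6; 5]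
  | 0, 4 => [:: 94; 12; 6; 4] | 0, 3 => [:: 97; 12; 6; 2]
  | 0, 2 => [:: 101; 12; 5] | 0, 1 => [:: 107; 12]
  | _, _ => [::]
  end.

Lemma profileE j : 0 < #|D| \/ #|A| = 4 -> profile j = nth 0 (profile_table #|A| #|D|) j.
Proof.
move=> h.
case: (ltnP j 5) => j5; last first.
  rewrite nth_default; last by apply: leq_trans j5; move: #|A| #|D|; do 5 case=> //; do 5 case=> //.
  apply/eqP; rewrite cards_eq0; apply/eqP/setP => s; rewrite [in RHS]inE inE.
  apply/negP => /andP[_ /eqP sj]; move: j5; rewrite -sj leqNgt ltnS.
  by rewrite (leq_trans (degree_in_le s)) // (leq_trans _ card_le4) // leq_addl.
have := (sum_profile 0, sum_profile 1, sum_profile 2, sum_profile 3, sum_profile 4).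
rewrite !big_cons !big_nil.
have := card_le4; move: h j5.
move: #|A| #|D| (profile) => a d p.
case: a => [|[|[|[|[|a]]]]]; case: d => [|[|[|[|[|d]]]]] h j5 le4 //=; try by case: h.
all: have -> : 'C(4, 2) = 6 by [].
all: have -> : 'C(4, 3) = 4 by [].
all: have -> : 'C(3, 2) = 3 by [].
all: rewrite ?bin0 ?bin1 ?binn !bin_small // => -[[[[e0 e1] e2] e3] e4].
all: case: j j5 => [|[|[|[|[|//]]]]] _ /=; lia.
Qed.

End Profile.

(** An appended letter may itself be an apex: it ceases to be one and commutes with all descents.
    Otherwise it commutes with all apexes, these are kept, and [d'.-1] descents survive. *)
Definition offspring a d a' d' : nat :=
  (if (a == a'.+1) && (d' == d.+1) then a else 0) +
  (if (a == a') && (0 < d') then nth 0 (profile_table a d) d'.-1 else 0).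

(** In the order of the types 1, A, B, C, D, E, F, G, H, K. A letter never increases the number of
    apexes, whence the block triangular shape. *)
Definition states : seq (nat * nat) :=
  [:: (3, 1); (2, 2); (2, 1); (1, 3); (1, 2); (1, 1); (0, 4); (0, 3); (0, 2); (0, 1)].

Section Census.
Variable T0 : {set 'I_120}.
Hypothesis tT0 : tet T0.
Local Notation valid := (valid T0).
Local Notation apexes := (apexes T0).

Definition in_state a d (w : seq 'I_120) : bool :=
  (#|apexes w| == a) && (#|descents w| == d).

Definition words n a d : nat := #|[set w : n.-tuple 'I_120 | valid w && in_state a d w]|.

Lemma clique_apexes_descents w : valid w -> clique (apexes w :|: descents w).
Proof.
move=> vw; apply/cliqueP => s t.
have cA := cliqueP _ (clique_apexes tT0 w).
have cD := cliqueP _ (clique_descents (valid_reduced vw)).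
move=> /finset.setUP[sA|sD] /finset.setUP[tA|tD] st.
- exact: cA.
- exact: (apexes_descents sA tD).
- by rewrite adj_sym; exact: (apexes_descents tA sD).
- exact: cD.
Qed.

Lemma descents_nbs w : descents w \subset nbs (apexes w).
Proof.
by apply/fintype.subsetP => s sD; apply/nbsP => a aA; apply: (apexes_descents aA).
Qed.

Lemma card_offspring w a' d' : valid w -> 0 < #|descents w| \/ #|apexes w| = 4 ->
  \sum_(s : 'I_120) (valid (rcons w s) && in_state a' d' (rcons w s) : nat) =
  offspring #|apexes w| #|descents w| a' d'.
Proof.
move=> vw h; have cAD := clique_apexes_descents vw; have DA := descents_nbs w.
have cA := clique_apexes tT0 w.
transitivity (\sum_(s in apexes w) ((#|apexes w| == a'.+1) && (d' == #|descents w|.+1) : nat) +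
    \sum_(s in nbs (apexes w) :\: descents w)
      ((#|apexes w| == a') && (d' == (degree_in (descents w) s).+1) : nat)).
  rewrite [X in _ = X + _]big_mkcond [X in _ = _ + X]big_mkcond -big_split /=.
  apply: eq_bigr => s _; rewrite valid_rcons vw in_setD /in_state apexes_rcons descents_rcons /=.
  have ds : s \notin descents w -> #|dstep (descents w) s| = (degree_in (descents w) s).+1.
    by move=> sD; rewrite /dstep cardsU1 inE (negPf sD) add1n.
  case: (boolP (s \in apexes w)) => [sA|sA].
    have sN : (s \in nbs (apexes w)) = false by apply/negP => /nbs_notin; rewrite sA.
    have sD : s \notin descents w by apply/negP => /(fintype.subsetP DA); rewrite sN.
    rewrite sN andbF addn0 ds // sD /=.
    have -> : [forall a in apexes w, (s == a) || adj a s].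
      apply/forall_inP => a aA; case: eqVneq => //= sa.
      by apply: (cliqueP _ cA) => //; rewrite eq_sym.
    have -> : degree_in (descents w) s = #|descents w|.
      apply: eq_card => t; rewrite inE; case: (boolP (t \in descents w)) => //= tD.
      exact: apexes_descents sA tD.
    rewrite (cardsD1 s (apexes w)) sA add1n eqSS /= (eq_sym _ d').
    rewrite (_ : [set a in apexes w | adj a s] = apexes w :\ s) //.
    apply/setP => a; rewrite in_setD1 [in LHS]inE andbC.
    case: (eqVneq a s) => [->|as_] /=; first by rewrite adjxx.
    by case: (boolP (a \in apexes w)) => aA; rewrite ?andbF ?andbT //; apply: (cliqueP _ cA).
  rewrite add0n; have -> : [forall a in apexes w, (s == a) || adj a s] = (s \in nbs (apexes w)).
    apply/forall_inP/nbsP => H a aA; have := H a aA; last by move=> ->; rewrite orbT.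
    by case: eqVneq aA => //= <- ; rewrite (negPf sA).
  case: (boolP (s \in descents w)) => //= sD; rewrite ds //.
  case: (boolP (s \in nbs (apexes w))) => // sN.
  rewrite (_ : [set a in apexes w | adj a s] = apexes w) 1?(eq_sym d') //.
  apply/setP => a; rewrite [in LHS]inE andbC.
  by case: (boolP (a \in apexes w)) => aA; rewrite ?andbF ?andbT //; move/nbsP: sN => /(_ a aA).
rewrite sum_nat_const /offspring; congr (_ + _).
  by case: ifP => _; rewrite ?muln1 ?muln0.
case: (#|apexes w| == a') => /=; last by rewrite big1.
case: d' => [|d'] /=; first by rewrite big1.
rewrite -(profileE cAD DA) // /profile -sum1_card.
under [RHS]eq_bigl => s do rewrite inE.
rewrite -big_mkcondr /=; apply: eq_bigl => s; by rewrite eqSS eq_sym.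
Qed.

Lemma descents_gt0 (w : seq 'I_120) : 0 < size w -> 0 < #|descents w|.
Proof.
case/lastP: w => [//|w s] _.
by rewrite card_gt0; apply/set0Pn; exists s; rewrite descents_rcons in_dstep eqxx.
Qed.

Lemma state_cases w : 0 < #|descents w| \/ #|apexes w| = 4.
Proof.
case: (posnP (size w)) => [/size0nil->|/descents_gt0]; last by left.
by right; rewrite apexes_nil (tet_card tT0).
Qed.

Lemma words_offspring n a' d' : words n.+1 a' d' =
  \sum_(t : n.-tuple 'I_120 | valid t) offspring #|apexes t| #|descents t| a' d'.
Proof.
rewrite /words -sum1_card big_mkcond sum_tuple_rcons [RHS]big_mkcond.
apply: eq_bigr => t _; case: (boolP (valid t)) => vt; last first.
  rewrite big1 // => s _; rewrite inE [tval _]/= valid_rcons (negPf vt) //.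
rewrite -card_offspring //; last exact: state_cases.
by apply: eq_bigr => s _; rewrite inE [tval _]/=; case: ifP.
Qed.

(** The empty word is in the state (4, 0), which never recurs, so the census starts at level 1. *)
Lemma words1 a d : words 1 a d = offspring 4 0 a d.
Proof.
rewrite words_offspring (big_pred1 [tuple]) => [|t]; last first.
  by rewrite (tuple0 t) /= valid_nil.
by rewrite /= apexes_nil (tet_card tT0) /descents /= cards0.
Qed.

Lemma sum_states n (F : nat -> nat -> nat) :
  \sum_(t : n.+1.-tuple 'I_120 | valid t) F #|apexes t| #|descents t| =
  \sum_(st <- states) words n.+1 st.1 st.2 * F st.1 st.2.
Proof.
under [RHS]eq_bigr => st _.
  rewrite /words -sum1_card big_distrl /= big_mkcond.
  under eq_bigr => t _ do rewrite inE mul1n.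
  over.
rewrite exchange_big big_mkcond /=; apply: eq_bigr => t _.
case: (boolP (valid t)) => vt; last by rewrite big1.
have := card_le4 (clique_apexes_descents vt) (descents_nbs t).
have : 0 < #|descents t| by apply: descents_gt0; rewrite size_tuple.
rewrite /in_state; move: #|apexes t| #|descents t| => a d d1 ad.
rewrite !big_cons big_nil.
move: d1 ad; case: a => [|[|[|[|[|a]]]]]; case: d => [|[|[|[|[|d]]]]] //= _ ad.
all: by rewrite ?addn0.
Qed.

End Census.

(** * Linear recurrences *)

Local Arguments Z.mul : simpl never.
Local Arguments Z.add : simpl never.
Local Open Scope Z_scope.

Definition census_step (v : seq Z) : seq Z :=
  if v is [:: p; a; b; c; d; e; f; g; h; k] then
    [:: p; 3 * p + 2 * a + 2 * b; a + 2 * b;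
        2 * a + 3 * c + 2 * d; 2 * b + 3 * c + 4 * d + 5 * e; 3 * c + 4 * d + 6 * e;
        c + 4 * f + 2 * g; d + 6 * f + 6 * g + 5 * h; e + 12 * f + 12 * g + 12 * h + 12 * k;
        94 * f + 97 * g + 101 * h + 107 * k]
  else [::].

(** The index is shifted by one: [census 0] describes level 1, with its four vertices of type 1. *)
Definition census n : seq Z := iter n census_step [:: 4; 0; 0; 0; 0; 0; 0; 0; 0; 0].

Lemma census_words (T0 : {set 'I_120}) n : tet T0 ->
  census n = [seq Z.of_nat (words T0 n.+1 st.1 st.2) | st <- states].
Proof.
move=> tT0; elim: n => [|n IH]; first by rewrite /= !words1.
have W a d : words T0 n.+2 a d =
    (\sum_(st <- states) words T0 n.+1 st.1 st.2 * offspring st.1 st.2 a d)%N.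
  by rewrite words_offspring // (sum_states tT0 n (fun a' d' => offspring a' d' a d)).
rewrite /census iterS -/(census n) IH /= !W !big_cons !big_nil /=.
move: (words T0 n.+1) => V.
by do 10 (congr (_ :: _); first by rewrite /offspring /=; lia).
Qed.

Local Notation x j n := (nth 0 (census n) j%N).

Lemma size_census n : size (census n) = 10%N.
Proof.
elim: n => // n; rewrite /census iterS -/(census n).
by case: (census n) => // ? [|? [|? [|? [|? [|? [|? [|? [|? [|? []]]]]]]]]].
Qed.

Lemma census_nth n :
  x 0 n.+1 = x 0 n /\ x 1 n.+1 = 3 * x 0 n + 2 * x 1 n + 2 * x 2 n /\
  x 2 n.+1 = x 1 n + 2 * x 2 n /\ x 3 n.+1 = 2 * x 1 n + 3 * x 3 n + 2 * x 4 n /\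
  x 4 n.+1 = 2 * x 2 n + 3 * x 3 n + 4 * x 4 n + 5 * x 5 n /\
  x 5 n.+1 = 3 * x 3 n + 4 * x 4 n + 6 * x 5 n /\
  x 6 n.+1 = x 3 n + 4 * x 6 n + 2 * x 7 n /\
  x 7 n.+1 = x 4 n + 6 * x 6 n + 6 * x 7 n + 5 * x 8 n /\
  x 8 n.+1 = x 5 n + 12 * x 6 n + 12 * x 7 n + 12 * x 8 n + 12 * x 9 n /\
  x 9 n.+1 = 94 * x 6 n + 97 * x 7 n + 101 * x 8 n + 107 * x 9 n.
Proof.
have := size_census n; rewrite /census iterS -/(census n).
by case: (census n) => // ? [|? [|? [|? [|? [|? [|? [|? [|? [|? []]]]]]]]]] //=; do !split.
Qed.

Fixpoint combination (l : seq Z) n j : Z :=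
  if l is a :: l' then a * x j n + combination l' n.+1 j else 0.

(** A combination of consecutive census vectors with constant coefficients obeys the same linear
    step as the vectors. *)
Lemma combination_step l n (y := fun j : nat => combination l n j)
    (y' := fun j : nat => combination l n.+1 j) :
  y' 0%N = y 0%N /\ y' 1%N = 3 * y 0%N + 2 * y 1%N + 2 * y 2%N /\
  y' 2%N = y 1%N + 2 * y 2%N /\ y' 3%N = 2 * y 1%N + 3 * y 3%N + 2 * y 4%N /\
  y' 4%N = 2 * y 2%N + 3 * y 3%N + 4 * y 4%N + 5 * y 5%N /\
  y' 5%N = 3 * y 3%N + 4 * y 4%N + 6 * y 5%N /\
  y' 6%N = y 3%N + 4 * y 6%N + 2 * y 7%N /\
  y' 7%N = y 4%N + 6 * y 6%N + 6 * y 7%N + 5 * y 8%N /\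
  y' 8%N = y 5%N + 12 * y 6%N + 12 * y 7%N + 12 * y 8%N + 12 * y 9%N /\
  y' 9%N = 94 * y 6%N + 97 * y 7%N + 101 * y 8%N + 107 * y 9%N.
Proof.
rewrite {}/y {}/y'; elim: l n => [|a l IH] n //=.
have [-> [-> [-> [-> [-> [-> [-> [-> [-> ->]]]]]]]]] := census_nth n.
have [-> [-> [-> [-> [-> [-> [-> [-> [-> ->]]]]]]]]] := IH n.+1.
repeat split; lia.
Qed.

(** The first 3, 6 or 10 coordinates evolve among themselves, so a combination vanishing at the
    start vanishes for ever. The use of a characteristic polynomial is thereby reduced to a finite
    computation. *)
Lemma combination_eq0 m l n j : m \in [:: 3; 6; 10]%N ->
  (forall i, (i < m)%N -> combination l 0 i = 0) -> (j < m)%N -> combination l n j = 0.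
Proof.
move=> mE l0; elim: n j => [|n IH] j jm; first exact: l0.
have := combination_step l n => /=; move: mE IH jm; rewrite !inE => /or3P[] /eqP-> IH.
- rewrite !(IH 0%N isT, IH 1%N isT, IH 2%N isT) => + [E0 [E1 [E2 _]]].
  by case: j => [|[|[|//]]] _; rewrite ?E0 ?E1 ?E2.
- rewrite !(IH 0%N isT, IH 1%N isT, IH 2%N isT, IH 3%N isT, IH 4%N isT, IH 5%N isT).
  move=> + [E0 [E1 [E2 [E3 [E4 [E5 _]]]]]].
  by case: j => [|[|[|[|[|[|//]]]]]] _; rewrite ?E0 ?E1 ?E2 ?E3 ?E4 ?E5.
- rewrite !(IH 0%N isT, IH 1%N isT, IH 2%N isT, IH 3%N isT, IH 4%N isT, IH 5%N isT).
  rewrite !(IH 6%N isT, IH 7%N isT, IH 8%N isT, IH 9%N isT).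
  move=> + [E0 [E1 [E2 [E3 [E4 [E5 [E6 [E7 [E8 E9]]]]]]]]].
  by case: j => [|[|[|[|[|[|[|[|[|[|//]]]]]]]]]] _;
    rewrite ?E0 ?E1 ?E2 ?E3 ?E4 ?E5 ?E6 ?E7 ?E8 ?E9.
Qed.

(** The coefficients are listed from the oldest term to the newest. *)
Definition recurrence (l : seq Z) (y : nat -> Z) n : Z :=
  foldr (fun a s i => a * y i + s i.+1) (fun=> 0) l n.

Lemma census_recurrence m l n (js : seq nat) (y : nat -> Z) : m \in [:: 3; 6; 10]%N ->
  (forall i, (i < m)%N -> combination l 0 i = 0) ->
  all (fun j => j < m)%N js ->
  (forall i, y i = foldr (fun j s => x j i + s) 0 js) -> recurrence l y n = 0.
Proof.
move=> mE l0 jsm yE; rewrite /recurrence.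
have -> : foldr (fun a s i => a * y i + s i.+1) (fun=> 0) l n =
    foldr (fun j s => combination l n j + s) 0 js.
  elim: l n {l0} => [|a l IH] n /=; first by elim: js {jsm yE} => //= j js ->.
  rewrite IH yE; elim: js {jsm yE IH} => /= [|j js <-]; lia.
elim: js jsm {yE} => //= j js IH /andP[jm jsm].
by rewrite (combination_eq0 n mE l0 jm) IH.
Qed.

Lemma recurrence10 js (y : nat -> Z) n : all (fun j => j < 10)%N js ->
  (forall i, y i = foldr (fun j s => x j i + s) 0 js) ->
  recurrence [:: 288; -19344; 151320; -438532; 608920; -445156; 175292; -36277; 3635; -147; 1] y n = 0.
Proof. by apply: census_recurrence => //; do 10 case=> //. Qed.

Lemma recurrence6 j (y : nat -> Z) n : (j < 6)%N ->
  (forall i, y i = x j i) -> recurrence [:: 12; -92; 224; -226; 99; -18; 1] y n = 0.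
Proof.
move=> j6 yE; apply: (@census_recurrence 6%N _ _ [:: j]) => //=; rewrite ?j6 //; first by do 6 case=> //.
by move=> i; rewrite yE Z.add_0_r.
Qed.

Lemma recurrence3 j (y : nat -> Z) n : (j < 3)%N ->
  (forall i, y i = x j i) -> recurrence [:: -2; 6; -5; 1] y n = 0.
Proof.
move=> j6 yE; apply: (@census_recurrence 3%N _ _ [:: j]) => //=; rewrite ?j6 //; first by do 3 case=> //.
by move=> i; rewrite yE Z.add_0_r.
Qed.

Definition type_index (t : vertex_type) : nat :=
  match t with
  | TA => 1 | TB => 2 | TC => 3 | TD => 4 | TE => 5 | TF => 6 | TG => 7 | TH => 8 | TK => 9
  end.

Lemma sums_census (R : realType) (V0 : point R) (Q0 : set (point R)) n :
  mosaic_face 4 Q0 -> Q0 V0 ->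
  (forall t, type_sum V0 Q0 t n.+1 = nth 0 (census n) (type_index t)) /\
  level_sum V0 Q0 n.+1 = foldr (fun j s => nth 0 (census n) j + s) 0 (iota 0 10).
Proof.
move=> hQ0 hV0; have [us [sus V0E mosaicP]] := mosaic_frame hQ0 hV0.
have [w [T0 [tT0 QE]]] := (tet_cubeP mosaicP Q0).1 hQ0.
have VE : V0 = vert us [::] by [].
have Q0E : Q0 = cube us [::] T0.
  rewrite QE in hV0 *; rewrite -(cube_at sus (tet_clique tT0) (w' := [::]) (w := w)) //.
  by rewrite -VE.
rewrite VE Q0E (census_words n tT0); split=> [t|].
  rewrite /type_sum (value_sum_level sus mosaicP tT0 n.+1
    (p := in_state T0 (4 - type_face_dim t)%N (type_incoming t))); last first.
    move=> w' vw'; rewrite (of_type_vert sus mosaicP tT0 t vw') /in_state.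
    by split=> [[-> ->]|/andP[/eqP-> /eqP->]]; rewrite ?eqxx.
  by case: t.
rewrite /level_sum -(classical_sets.setIT (level _ _ _)).
rewrite (value_sum_level sus mosaicP tT0 n.+1 (p := predT)) //.
have -> : #|[set w : n.+1.-tuple 'I_120 | valid T0 w && predT (tval w)]| =
    (\sum_(st <- states) words T0 n.+1 st.1 st.2)%N.
  rewrite -sum1_card (eq_bigl (fun t : n.+1.-tuple 'I_120 => valid T0 t)); last first.
    by move=> t; rewrite inE andbT.
  rewrite (sum_states tT0 n (fun _ _ => 1%N)); apply: eq_bigr => st _.
  by rewrite muln1.
rewrite !big_cons big_nil /=; lia.
Qed.

Theorem theorem4 (R : realType) (V0 : point R) (Q0 : set (point R))
    (hQ0 : mosaic_face 4 Q0) (hV0 : Q0 V0) :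
  let a := type_sum V0 Q0 TA in
  let b := type_sum V0 Q0 TB in
  let c := type_sum V0 Q0 TC in
  let d := type_sum V0 Q0 TD in
  let e := type_sum V0 Q0 TE in
  let f := type_sum V0 Q0 TF in
  let g := type_sum V0 Q0 TG in
  let h := type_sum V0 Q0 TH in
  let k := type_sum V0 Q0 TK in
  let s := level_sum V0 Q0 in
  ((forall x : nat -> Z, List.In x [:: a; b; c; d; e; f; g; h; k; s] ->
      forall n : nat, (11 <= n)%N ->
        x n = 147 * x (n - 1)%N - 3635 * x (n - 2)%N + 36277 * x (n - 3)%N
              - 175292 * x (n - 4)%N + 445156 * x (n - 5)%N
              - 608920 * x (n - 6)%N + 438532 * x (n - 7)%N
              - 151320 * x (n - 8)%N + 19344 * x (n - 9)%N
              - 288 * x (n - 10)%N) /\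
   ([seq a n | n <- iota 1 10] =
      [:: 0; 12; 36; 108; 348; 1164; 3948; 13452; 45900; 156684] /\
    [seq b n | n <- iota 1 10] =
      [:: 0; 0; 12; 60; 228; 804; 2772; 9492; 32436; 110772] /\
    [seq c n | n <- iota 1 10] =
      [:: 0; 0; 24; 144; 840; 5808; 48552; 458736; 4588008; 46916592] /\
    [seq d n | n <- iota 1 10] =
      [:: 0; 0; 0; 96; 1296; 14400; 152592; 1592448; 16530384; 171272832] /\
    [seq e n | n <- iota 1 10] =
      [:: 0; 0; 0; 72; 1248; 15192; 166176; 1753080; 18264480; 189472440] /\
    [seq f n | n <- iota 1 10] =
      [:: 0; 0; 0; 24; 240; 2280; 26880; 667944; 51411168; 5797305000] /\
    [seq g n | n <- iota 1 10] =
      [:: 0; 0; 0; 0; 240; 5976; 255936; 24140328; 2793536160;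
          331243298952] /\
    [seq h n | n <- iota 1 10] =
      [:: 0; 0; 0; 0; 360; 38400; 4458168; 528618816; 62831416920;
          7469847072960] /\
    [seq k n | n <- iota 1 10] =
      [:: 0; 0; 0; 0; 2256; 323592; 39296736; 4682378232; 556809369792;
          66200381333976] /\
    [seq s n | n <- iota 1 10] =
      [:: 4; 16; 76; 508; 7060; 407620; 44411764; 5239632532; 622525195252;
          74007676940212])) /\
  (forall x : nat -> Z, List.In x [:: a; b; c; d; e] ->
     forall n : nat, (7 <= n)%N ->
       x n = 18 * x (n - 1)%N - 99 * x (n - 2)%N + 226 * x (n - 3)%N
             - 224 * x (n - 4)%N + 92 * x (n - 5)%N - 12 * x (n - 6)%N) /\
  (forall x : nat -> Z, List.In x [:: a; b] ->
     forall n : nat, (4 <= n)%N ->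
       x n = 5 * x (n - 1)%N - 6 * x (n - 2)%N + 2 * x (n - 3)%N).

Proof.
have type_lt10 t : all (fun j => j < 10)%N [:: type_index t] by case: t.
have H n := sums_census n hQ0 hV0.
have typeE t n : type_sum V0 Q0 t n.+1 = nth 0 (census n) (type_index t) := (H n).1 t.
have levelE n : level_sum V0 Q0 n.+1 =
  foldr (fun j s => nth 0 (census n) j + s) 0 (iota 0 10) := (H n).2.
have typesE t : [seq type_sum V0 Q0 t n | n <- iota 1 10] =
    [seq nth 0 (census n) (type_index t) | n <- iota 0 10].
  by rewrite (iotaDl 1 0) -map_comp; apply: eq_map => n /=; rewrite typeE.
have levelsE : [seq level_sum V0 Q0 n | n <- iota 1 10] =
    [seq foldr (fun j s => nth 0 (census n) j + s) 0 (iota 0 10) | n <- iota 0 10].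
  by rewrite (iotaDl 1 0) -map_comp; apply: eq_map => n; rewrite -levelE.
move=> a b c d e f g h k s; split; [split|split].
- have rec (y : nat -> Z) js : all (fun j => j < 10)%N js ->
      (forall i, y i.+1 = foldr (fun j s => nth 0 (census i) j + s) 0 js) ->
    forall n : nat, (11 <= n)%N ->
        y n = 147 * y (n - 1)%N - 3635 * y (n - 2)%N + 36277 * y (n - 3)%N
              - 175292 * y (n - 4)%N + 445156 * y (n - 5)%N
              - 608920 * y (n - 6)%N + 438532 * y (n - 7)%N
              - 151320 * y (n - 8)%N + 19344 * y (n - 9)%N
              - 288 * y (n - 10)%N.
    (* With 11 split off, the smallest index n - 10 is a successor, as required by the census
       starting at level 1. *)
    move=> jsm yE n /subnK <-; move: (n - 11)%N => {}n.
    rewrite !addnS addn0 !subSS !subn0.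
    by have := recurrence10 n jsm yE; rewrite /recurrence /=; lia.
  have recs := rec (level_sum V0 Q0) (iota 0 10) isT levelE.
  have typesR t : forall n, _ := rec (type_sum V0 Q0 t) [:: type_index t] (type_lt10 t)
    (fun i => etrans (typeE t i) (esym (Z.add_0_r _))).
  move: typesR recs => {rec typeE levelE typesE levelsE H} typesR recs y.
  do 9 (case=> [<-|]; first exact: typesR).
  by case=> [<-|[]]; exact: recs.
- by rewrite !typesE levelsE; do !split; vm_compute.
- have rec t : (type_index t < 6)%N -> forall n : nat, (7 <= n)%N ->
      type_sum V0 Q0 t n = 18 * type_sum V0 Q0 t (n - 1)%N - 99 * type_sum V0 Q0 t (n - 2)%N
        + 226 * type_sum V0 Q0 t (n - 3)%N - 224 * type_sum V0 Q0 t (n - 4)%N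
        + 92 * type_sum V0 Q0 t (n - 5)%N - 12 * type_sum V0 Q0 t (n - 6)%N.
    move=> t6 n /subnK <-; move: (n - 7)%N => {}n.
    rewrite !addnS addn0 !subSS !subn0.
    by have := recurrence6 n t6 (typeE t); rewrite /recurrence /=; lia.
  move=> y; do 4 (case=> [<-|]; first exact: rec).
  by case=> [<-|[]]; exact: rec.
- have rec t : (type_index t < 3)%N -> forall n : nat, (4 <= n)%N ->
      type_sum V0 Q0 t n = 5 * type_sum V0 Q0 t (n - 1)%N - 6 * type_sum V0 Q0 t (n - 2)%N
        + 2 * type_sum V0 Q0 t (n - 3)%N.
    move=> t3 n /subnK <-; move: (n - 4)%N => {}n.
    rewrite !addnS addn0 !subSS !subn0.
    by have := recurrence3 n t3 (typeE t); rewrite /recurrence /=; lia.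
  by move=> y; case=> [<-|]; [exact: rec|case=> [<-|[]]; exact: rec].
Qed.
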